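(* Let $1<p<\infty$. There is a constant $C_p$ depending only on $p$ such that for every probability space $(\Omega,\mathcal F,\mathbb P)$ with filtration $(\mathcal F_n)_{n\ge 1}$ satisfying $\mathcal F=\sigma(\bigcup_{n\ge1}\mathcal F_n)$, every scalar weight $w\in A_p$ and every $f\in L_p^w(\Omega)$, $$\|Sf\|_{L_p^w(\Omega)}\le C_p\,[w]_{A_p}^{\max\{\frac12,\frac1{p-1}\}}\,\|f\|_{L_p^w(\Omega)}.$$ Moreover, the estimate is sharp in terms of the dependence on $[w]_{A_p}$: for each $1<p<\infty$ the exponent $\max\{\frac12,\frac1{p-1}\}$ cannot be replaced by any smaller number $\kappa$, i.e. for $\kappa<\max\{\frac12,\frac1{p-1}\}$ there is no constant $C$ (depending only on $p$ and $\kappa$) such that $\|Sf\|_{L_p^w(\Omega)}\le C[w]_{A_p}^{\kappa}\|f\|_{L_p^w(\Omega)}$ holds for all probability spaces $(\Omega,\mathcal F,\mathbb P)$ with filtrations $(\mathcal F_n)_{n\ge1}$ satisfying $\mathcal F=\sigma(\bigcup_{n\ge1}\mathcal F_n)$, all $w\in A_p$ and all $f\in L_p^w(\Omega)$.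
   Context: $\mathbb E_n$ denotes conditional expectation with respect to $\mathcal F_n$; it is applied to functions $h$ with $\mathbb E_n|h|<\infty$ a.s. A (scalar) weight is a positive function $w\in L_1(\Omega)$. For $1<p<\infty$, $w\in A_p$ means that $$[w]_{A_p}=\sup_{n\ge1}\big\|\mathbb E_n(w)\,\mathbb E_n(w^{\frac1{1-p}})^{p-1}\big\|_{L_\infty(\Omega)}<\infty.$$ $L_p^w(\Omega)$ is the space of measurable $f$ with $\|f\|_{L_p^w(\Omega)}=(\int_\Omega |f|^p w\,d\mathbb P)^{1/p}<\infty$. A function $f\in L_p^w(\Omega)$ is identified with the martingale $f_n=\mathbb E_n(f)$; its differences are $d_1f=f_1$ and $d_nf=f_n-f_{n-1}$ for $n\ge2$, and its square function is $Sf=(\sum_{k\ge1}|d_kf|^2)^{1/2}$. *)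

(* Defs.v *)
From HB Require Import structures.
From mathcomp Require Import all_boot all_order all_algebra.
From mathcomp Require Import all_classical all_reals all_analysis.
From mathcomp Require Import measurable_realfun ess_sup_inf.

Set Implicit Arguments.
Unset Strict Implicit.
Unset Printing Implicit Defensive.

Import Order.TTheory GRing.Theory Num.Theory.
Import numFieldNormedType.Exports.

Local Open Scope classical_set_scope.
Local Open Scope ring_scope.
Local Open Scope ereal_scope.

(* Throughout, the ambient sigma-algebra is the one carried by the
   measurableType T, a sub-sigma-algebra is a set of sets, and indices are
   shifted by one: F 0 stands for F_1, F 1 for F_2, etc. *)

Definition is_filtration d (T : measurableType d) (F : nat -> set (set T)) :=
  [/\ forall n, sigma_algebra [set: T] (F n),
      forall n, F n `<=` measurable &
      forall m n, (m <= n)%N -> F m `<=` F n].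

Section conditional_expectation.
Context d (T : measurableType d) (R : realType) (P : probability T R).
Implicit Types (G : set (set T)) (h g : T -> \bar R).

(* g is a version of E[h | G], for h nonnegative and measurable; both may take
   the value +oo and h need not be integrable. Such a g always exists and is
   unique up to almost sure equality. *)
Definition is_cexp_ge0 G h g :=
  [/\ measurable_fun [set: g_sigma_algebraType G] g,
      forall x, 0 <= g x &
      forall A, G A -> \int[P]_(x in A) g x = \int[P]_(x in A) h x].

Definition cexp_ge0 G h : T -> \bar R := xget (cst 0) (is_cexp_ge0 G h).

(* E[h | G] := E[h^+ | G] - E[h^- | G]. It is meaningful, and almost surely
   finite, as soon as E[|h| | G] is almost surely finite; it is also the usual
   [0, +oo]-valued conditional expectation when h is nonnegative. *)
Definition cexp G h : T -> \bar R :=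
  fun x => cexp_ge0 G h^\+ x - cexp_ge0 G h^\- x.

End conditional_expectation.

Section martingales.
Context d (T : measurableType d) (R : realType) (P : probability T R).
Variable F : nat -> set (set T).

Definition is_weight (w : T -> R) :=
  P.-integrable setT (EFin \o w) /\ {ae P, forall x, (0 < w x)%R}.

Definition Ap_char (p : R) (w : T -> R) : \bar R :=
  ereal_sup (range (fun n : nat =>
    Lnorm P +oo (fun x => cexp P (F n) (EFin \o w) x *
      (cexp P (F n) (fun y => (w y `^ (1 - p)^-1)%:E) x) `^ (p - 1)))).

Definition in_Ap (p : R) (w : T -> R) := is_weight w /\ Ap_char p w < +oo.

Definition wnorm (p : R) (w : T -> R) (f : T -> \bar R) : \bar R :=
  (\int[P]_x (`|f x| `^ p * (w x)%:E)) `^ (p^-1)%R.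

Definition in_Lpw (p : R) (w : T -> R) (f : T -> R) :=
  measurable_fun setT f /\ wnorm p w (EFin \o f) < +oo.

Definition mart (f : T -> R) (n : nat) : T -> \bar R := cexp P (F n) (EFin \o f).

Definition mart_diff (f : T -> R) (n : nat) : T -> \bar R :=
  if n is m.+1 then fun x => mart f m.+1 x - mart f m x else mart f 0%N.

Definition square_fun (f : T -> R) : T -> \bar R :=
  fun x => (\sum_(0 <= k <oo) `|mart_diff f k x| ^+ 2) `^ (2^-1)%R.

End martingales.

Definition square_fun_estimate (R : realType) (p kappa C : R) : Prop :=
  forall (d : measure_display) (T : measurableType d) (P : probability T R)
         (F : nat -> set (set T)),
    is_filtration F ->
    @measurable d T = <<s \bigcup_n F n >> ->
    forall w : T -> R, in_Ap P F p w ->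
    forall f : T -> R, in_Lpw P p w f ->
    wnorm P p w (square_fun P F f) <=
      C%:E * (Ap_char P F p w `^ kappa) * wnorm P p w (EFin \o f).

(* Main.v *)
(* Upper bound. Write f as a difference of positive functions and denote by f_k, w_k, s_k the
   martingales of f, w and s = w^(1/(1-p)), so that w_k s_k^(p-1) <= Q = [w]_(A_p). An explicit Bellman
   function yields, for positive martingales f_k and u_k,
     E sum_k |d_k f|^2 u <= C E max_k f_k^2 u_k.
   With X_k = f_k / s_k, Doob's inequality for the measure s dP gives E (max X)^p s <= C E f^p w.
   For p > 2 take u = (Sf)^(p-2) w (truncated) and Y_k = u_k / w_k: by the A_p condition f_k^2 u_k is
   X_k^2 Y_k times a power of Q times a negative power of s_k or w_k, the latter is handled by Jensen
   and Doob in L^2, and Young's inequality absorbs E (Sf)^p w. For p <= 2 take u = H^(p-2) w with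
   H = max_k f_k and use (Sf)^p <= (Sf)^2 H^(p-2) + H^p.

   Sharpness. On nat with P{k} = 2^-(k+1), let F_n consist of the sets that are constant on [n, oo).
   The weight b^(-(p-1)k) with f = b^k, b = 2 - 1/N, has characteristic at most N^(p-1) while
   Sf >= (N/2) f. The weight (2 - 1/N)^k has characteristic at most N, and for f the indicator of the
   even integers |d_k f| = 1/3 on [k, oo), so (Sf)^2 >= N/9 on [N, oo). *)
Require Import Defs.
From HB Require Import structures.
From mathcomp Require Import all_boot all_order all_algebra.
From mathcomp Require Import all_classical all_reals all_analysis.
From mathcomp Require Import measurable_realfun ess_sup_inf.
From mathcomp Require Import ring lra.
Import Order.TTheory GRing.Theory Num.Theory.
Import numFieldNormedType.Exports.
Local Open Scope classical_set_scope.
Local Open Scope ring_scope.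
Set Implicit Arguments.
Unset Strict Implicit.
Unset Printing Implicit Defensive.

(** The exponent changes form at p = 3 because of convexity. For p > 2 one has f_k^2 u_k = X_k^2 Y_k
    (s_k^2 w_k), and w_k s_k^(p-1) <= Q bounds s_k^2 w_k either by Q^(2/(p-1)) w_k^((p-3)/(p-1)) or
    by Q s_k^(3-p). Jensen's inequality needs a convex power here: the first bound has a nonpositive
    exponent for p <= 3, the second for p >= 3, and in the other range the exponent lies between 0
    and 1. Replacing w_k and s_k by w and s turns both powers into w^((p-3)/(p-1)), so one argument
    serves both cases. Integrals take values in [0, +oo], where only finite quantities can be
    cancelled or absorbed. Hence the truncations and cutoffs, removed by monotone convergence.
    Quotients of martingales need strictly positive versions, so the estimate is proved for f^+ +
    eps and f^- + eps; the shift cancels in the differences. The two counterexamples match the two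
    terms of the maximum: one large jump gives 1/(p-1), an accumulation of equal jumps gives 1/2. *)

Import HBNNSimple.

(** * Testing conditional expectations against measurable functions *)

Section cexp_facts.
Context d (T : measurableType d) (R : realType) (P : probability T R).
Variables (G : set (set T)).
Hypotheses (sG : sigma_algebra setT G) (GT : G `<=` measurable).

Lemma sub_measurableG (A : set T) :
  measurable (A : set (g_sigma_algebraType G)) <-> G A.
Proof. by rewrite measurable_g_measurableTypeE. Qed.

Lemma measurable_sub d' (S : measurableType d') (f : T -> S) :
  measurable_fun [set: g_sigma_algebraType G] f -> measurable_fun [set: T] f.
Proof. by move=> mf _ A mA; apply/GT/sub_measurableG; exact: mf. Qed.

Lemma integral_nnsfunM (phi : {nnsfun (g_sigma_algebraType G) >-> R})
    (g : T -> \bar R) : measurable_fun setT g -> (forall x, 0 <= g x)%E ->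
  (\int[P]_x ((phi x)%:E * g x) =
   \sum_(y \in range phi) (y%:E * \int[P]_(x in phi @^-1` [set y]) g x))%E.
Proof.
move=> mg g0.
have mphi y : d.-measurable (phi @^-1` [set y] : set T).
  by apply/GT/sub_measurableG; rewrite -[X in measurable X]setTI; exact: measurable_funP.
transitivity (\int[P]_x (\sum_(y \in range phi)
    ((y * \1_(phi @^-1` [set y]) x)%:E * g x)))%E.
  apply: eq_integral => x _.
  rewrite -ge0_mule_fsuml => [|y]; last exact: nnfun_muleindic_ge0.
  by rewrite [in LHS](fimfunE phi x) -fsumEFin.
have mi (y : R) : measurable_fun [set: T] (fun x => (y * \1_(phi @^-1` [set y]) x)%:E).
  by apply/measurable_EFinP; apply: measurable_funM => //; exact: measurable_indic.
rewrite ge0_integral_fsum//; last 2 first.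
  - by move=> y; apply: emeasurable_funM.
  - by move=> y x _; rewrite mule_ge0// nnfun_muleindic_ge0.
apply: eq_fsbigr => y; rewrite inE => -[t _ yE].
under eq_integral do rewrite EFinM -muleA.
rewrite ge0_integralZl//.
- congr (_ * _)%E; rewrite [RHS]integral_mkcond; apply: eq_integral => x _.
  by rewrite muleC epatch_indic.
- apply: emeasurable_funM => //; apply/measurable_EFinP; exact: measurable_indic.
- by move=> x _; rewrite mule_ge0// lee_fin.
- by rewrite -yE lee_fin.
Qed.

(** A conditional expectation is defined by testing with sets of [G]; increasing simple functions
    extend the identity to nonnegative [G]-measurable [phi], and both sides may be +oo. *)
Lemma integral_densityM (phi : T -> R) (g h : T -> \bar R) :
  measurable_fun setT g -> (forall x, 0 <= g x)%E ->
  measurable_fun setT h -> (forall x, 0 <= h x)%E ->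
  (forall A, G A -> \int[P]_(x in A) g x = \int[P]_(x in A) h x)%E ->
  measurable_fun [set: g_sigma_algebraType G] phi -> (forall x, 0 <= phi x) ->
  (\int[P]_x ((phi x)%:E * g x) = \int[P]_x ((phi x)%:E * h x))%E.
Proof.
move=> mg g0 mh h0 gh mphi phi0.
have mEphi : measurable_fun [set: g_sigma_algebraType G] (EFin \o phi).
  exact/measurable_EFinP.
pose s := nnsfun_approx measurableT mEphi.
have key f : measurable_fun setT f -> (forall x, 0 <= f x)%E ->
    (\int[P]_x ((phi x)%:E * f x) = limn (fun n => \int[P]_x ((s n x)%:E * f x)))%E.
  move=> mf f0.
  have fg x : ((phi x)%:E * f x = limn (fun n => (s n x)%:E * f x))%E.
    apply/esym/cvg_lim => //.
    have sx : (s n x)%:E @[n --> \oo] --> (phi x)%:E.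
      by apply: (cvg_nnsfun_approx measurableT mEphi) => // y _; rewrite lee_fin.
    have := f0 x; case: (f x) => [r r0| _ |//].
      by apply: cvgeZr.
    (* Here the second factor is +oo and the product is discontinuous at 0: if [phi x] = 0 all
       approximations vanish, otherwise they are eventually positive and the product is eventually
       +oo. *)
    have [p0|p0] := eqVneq (phi x) 0.
      rewrite p0 mul0e; apply: cvg_near_cst; apply: nearW => n.
      suff -> : s n x = 0 by rewrite mul0e.
      apply/eqP; rewrite eq_le fun_ge0 andbT -p0 -lee_fin /s.
      rewrite nnsfun_approxE.
      by apply: le_approx => // y _; rewrite lee_fin.
    have pp : 0 < phi x by rewrite lt_neqAle eq_sym p0 phi0.
    rewrite gt0_muley ?lte_fin//.
    apply: cvg_near_cst.
    have sx' : s n x @[n --> \oo] --> phi x by move/fine_cvg : sx.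
    near=> n; rewrite gt0_muley// lte_fin.
    near: n; exact: (cvgr_gt _ sx').
  under eq_integral => x _ do rewrite fg.
  apply: monotone_convergence => //.
  - move=> n; apply: emeasurable_funM => //; apply/measurable_EFinP.
    by apply: measurable_sub; exact: measurable_funP.
  - by move=> n x _; rewrite mule_ge0// lee_fin.
  - move=> x _ a b ab; rewrite lee_wpmul2r// lee_fin.
    by have /lefP/(_ x) := nd_nnsfun_approx measurableT mEphi ab.
rewrite !key//; congr (limn _); apply/funext => n.
rewrite !integral_nnsfunM//; apply: eq_fsbigr => y _; congr (_ * _)%E.
apply: gh; apply/sub_measurableG; rewrite -[X in measurable X]setTI.
exact: measurable_funP.
Unshelve. all: by end_near. Qed.

End cexp_facts.

(** * Conditional expectations of functions bounded by 1 *)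

Section restricted_density.
Context d (T : measurableType d) (R : realType) (P : probability T R).
Variables (G : set (set T)).
Hypotheses (sG : sigma_algebra setT G) (GT : G `<=` measurable).
Variable (h : T -> \bar R).
Hypotheses (mh : measurable_fun setT h) (h0 : forall x, (0 <= h x)%E)
  (h1 : forall x, (h x <= 1)%E).

Let measG (A : set (g_sigma_algebraType G)) : measurable A -> d.-measurable A.
Proof. by move/(sub_measurableG sG)/GT. Qed.

Definition restricted_density (A : set (g_sigma_algebraType G)) :=
  (\int[P]_(x in A) h x)%E.

Let rd0 : restricted_density set0 = 0%E.
Proof. by rewrite /restricted_density integral_set0. Qed.

Let rd_ge0 A : (0 <= restricted_density A)%E.
Proof. by apply: integral_ge0. Qed.

Let rd_sigma_additive : semi_sigma_additive restricted_density.
Proof.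
move=> F mF tF mUF; apply: (semi_sigma_additive_nng_induced mh h0) => //.
- by move=> n; exact: measG.
- exact: measG.
Qed.

HB.instance Definition _ := isMeasure.Build _ _ _ restricted_density
  rd0 rd_ge0 rd_sigma_additive.

Let rd_fin : fin_num_fun restricted_density.
Proof.
move=> A mA; rewrite (ge0_fin_numE (rd_ge0 A)).
apply: (@le_lt_trans _ _ (\int[P]_(x in A) (cst 1 x))%E).
  by apply: ge0_le_integral => //; [exact: measG|exact: measurable_funTS].
by rewrite integral_cst ?mul1e ?(le_lt_trans (probability_le1 _ _)) ?ltry//; exact: measG.
Qed.

HB.instance Definition _ := Measure_isFinite.Build _ _ _ restricted_density rd_fin.

(** The Radon-Nikodym theorem on the coarser space yields a [G]-measurable derivative. It is applied
    to finite measures, and h <= 1 makes the measure with density [h] finite. *)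
Lemma is_cexp_ge0_bounded : exists g, is_cexp_ge0 P G h g.
Proof.
(* The distribution of the identity, seen as a map into the coarser space, is the restriction of [P]
   to [G]. *)
pose idG : T -> g_sigma_algebraType G := id.
have midG : measurable_fun setT idG.
  by move=> _ A mA; rewrite setTI; exact: measG.
pose phi : {mfun T >-> g_sigma_algebraType G} :=
  HB.pack idG (isMeasurableFun.Build _ _ _ _ idG midG).
pose mu : {finite_measure set (g_sigma_algebraType G) -> \bar R} := distribution P phi.
pose nu : {finite_measure set (g_sigma_algebraType G) -> \bar R} := restricted_density.
have numu : nu `<< mu.
  apply/null_content_dominatesP => A mA muA.
  by apply: null_set_integral => //; [exact: measG|exact: measurable_funTS].
have [g [g0 ig nug]] := radon_nikodym_finite numu.
have mg := measurable_int _ ig.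
exists g; split => // A GA.
have mA : measurable (A : set (g_sigma_algebraType G)) by apply/sub_measurableG.
have <- : nu A = (\int[P]_(x in A) h x)%E by [].
rewrite nug//= ge0_integral_pushforward//.
exact: measurable_funTS.
Qed.

End restricted_density.

(** * Conditional expectations of nonnegative functions *)

Section cexp_exists.
Context d (T : measurableType d) (R : realType) (P : probability T R).
Variables (G : set (set T)).
Hypotheses (sG : sigma_algebra setT G) (GT : G `<=` measurable).
Variable (h : T -> R).
Hypotheses (mh : measurable_fun setT h) (h0 : forall x, (0 <= h x)).

Lemma nneseries_min_layers (a : R) : 0 <= a ->
  (\sum_(0 <= n <oo) (Num.min a n.+1%:R - Num.min a n%:R)%:E = a%:E)%E.
Proof.
move=> a0; apply/cvg_lim => //; apply: cvg_near_cst.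
have [N aN] : exists N : nat, a <= N%:R.
  by exists (Num.truncn a).+1; exact/ltW/truncnS_gt.
near=> n; rewrite sumEFin telescope_sumr// (min_r a0) subr0 min_l//.
by rewrite (le_trans aN)// ler_nat; near: n; exists N.
Unshelve. all: by end_near. Qed.

(** Cutting [h] into horizontal layers of height one reduces to the bounded case; the conditional
    expectations of the layers form a nonnegative series, whose sum may be +oo. *)
Lemma is_cexp_ge0_ex : is_cexp_ge0 P G (EFin \o h) (cexp_ge0 P G (EFin \o h)).
Proof.
apply: xgetPex.
pose hn n x : \bar R := (Num.min (h x) n.+1%:R - Num.min (h x) n%:R)%:E.
have mhn n : measurable_fun setT (hn n).
  by apply/measurable_EFinP; apply: measurable_funB; apply: measurable_minr.
have hn0 n x : (0 <= hn n x)%E.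
  by rewrite lee_fin subr_ge0 le_min ge_min lexx/= ge_min ler_nat leqnSn orbT.
have hn1 n x : (hn n x <= 1)%E.
  rewrite lee_fin lerBlDr; case: (leP (h x) n%:R) => hx.
    by rewrite ge_min lerDr ler01.
  by rewrite ge_min -natr1 [_ + 1]addrC lexx orbT.
have /choice[g gP] : forall n, exists g, is_cexp_ge0 P G (hn n) g.
  by move=> n; exact: is_cexp_ge0_bounded.
have mg n : measurable_fun [set: T] (g n) by case: (gP n) => m _ _; exact: measurable_sub m.
have g0 n x : (0 <= g n x)%E by case: (gP n).
exists (fun x => (\sum_(0 <= n <oo) g n x)%E); split.
- apply: ge0_emeasurable_sum => n; [|by case: (gP n)].
  by move=> x _ _; exact: g0.
- by move=> x; apply: nneseries_ge0.
- move=> A GA; have mA := GT GA.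
  rewrite integral_nneseries//; last by move=> n; exact: measurable_funTS.
  transitivity (\sum_(0 <= n <oo) (\int[P]_(x in A) hn n x))%E.
    by apply: eq_eseriesr => n _; case: (gP n) => _ _; exact.
  rewrite -integral_nneseries//; last by move=> n; exact: measurable_funTS.
  by apply: eq_integral => x _; rewrite nneseries_min_layers.
Qed.

End cexp_exists.

(** * The pointwise Bellman inequality *)

Section bellman_pointwise.
Variable R : realType.
Implicit Types s x y K : R.

(** With x^2 = f_(k+1)/f_k and y^4 = u_(k+1)/u_k the average (1 + 2x^2 + y^4)/4 has conditional mean
    1 at time k. The squares on the right are four times its excess over xy, and this excess pays
    for the square function. *)
Lemma bellman_defect x y :
  1 + 2 * x ^+ 2 + y ^+ 4 - 4 * x * y = 2 * (x - y) ^+ 2 + (y ^+ 2 - 1) ^+ 2.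
Proof. ring. Qed.

Lemma le_expn (k : nat) (y c : R) : 0 <= y -> y <= c -> y ^+ k <= c ^+ k.
Proof. by move=> y0 yc; rewrite lerXn2r ?nnegrE ?(le_trans y0). Qed.

(** Split x^2 - 1 into (x - y)(x + y) and y^2 - 1, the quantities of the defect. The factor x + y
    may be large, but the powers of s and y in front turn it into sxy + sy^2, which is bounded. *)
Lemma bellman_small s x y : 0 < s -> s <= 1 -> 0 < x -> 0 < y -> y <= 2 -> s * x * y <= 2 ->
  s ^+ 3 * ((x ^+ 2 - 1) ^+ 2 * y ^+ 4) <= 200 * (2 * (x - y) ^+ 2 + (y ^+ 2 - 1) ^+ 2).
Proof.
move=> s0 s1 x0 y0 y2 sxy.
have -> : (x ^+ 2 - 1) ^+ 2 = ((x ^+ 2 - y ^+ 2) + (y ^+ 2 - 1)) ^+ 2 by ring.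
set b := y ^+ 2 - 1.
have h1 : ((x ^+ 2 - y ^+ 2) + b) ^+ 2 <= 2 * (x ^+ 2 - y ^+ 2) ^+ 2 + 2 * b ^+ 2.
  by have := sqr_ge0 ((x ^+ 2 - y ^+ 2) - b); lra.
have sy4 : 0 <= s ^+ 3 * y ^+ 4 by rewrite mulr_ge0// exprn_ge0// ltW.
have y4 : y ^+ 4 <= 16.
  by have := le_expn 4 (ltW y0) y2; lra.
have s3 : s ^+ 3 <= 1 by rewrite exprn_ile1// ltW.
have sy4' : s ^+ 3 * y ^+ 4 <= 16.
  by rewrite -[leRHS]mul1r ler_pM// exprn_ge0// ltW.
have sy2 : s * y ^+ 2 <= 4.
  by rewrite -[leRHS]mul1r ler_pM ?sqr_ge0 ?(ltW s0)//; have := le_expn 2 (ltW y0) y2; lra.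
have q : s ^+ 3 * y ^+ 4 * (x + y) ^+ 2 <= 144.
  have -> : s ^+ 3 * y ^+ 4 * (x + y) ^+ 2 = (s * y ^+ 2) * (s * x * y + s * y ^+ 2) ^+ 2 by ring.
  have e : (s * x * y + s * y ^+ 2) ^+ 2 <= 36.
    have := @le_expn 2 (s * x * y + s * y ^+ 2) 6.
    by rewrite addr_ge0 ?mulr_ge0 ?sqr_ge0 ?(ltW s0) ?(ltW x0) ?(ltW y0)// => /(_ isT); lra.
  have := @ler_pM _ _ _ _ _ _ _ sy2 e; rewrite mulr_ge0 ?sqr_ge0 ?(ltW s0)//.
  by move=> /(_ isT isT); lra.
have e1 : s ^+ 3 * y ^+ 4 * (x ^+ 2 - y ^+ 2) ^+ 2 <= 144 * (x - y) ^+ 2.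
  have -> : (x ^+ 2 - y ^+ 2) ^+ 2 = (x + y) ^+ 2 * (x - y) ^+ 2 by ring.
  by rewrite mulrA ler_wpM2r// sqr_ge0.
have e2 : s ^+ 3 * y ^+ 4 * b ^+ 2 <= 16 * b ^+ 2 by rewrite ler_wpM2r ?sqr_ge0.
have := ler_wpM2l sy4 h1.
have := sqr_ge0 (x - y); have := sqr_ge0 b; lra.
Qed.

Lemma bellman_large x y : 0 < x -> 2 <= y ->
  x * y + y ^+ 4 <= 200 * (2 * (x - y) ^+ 2 + (y ^+ 2 - 1) ^+ 2).
Proof.
move=> x0 y2.
have y4 : 4 <= y ^+ 2 by have := @le_expn 2 2 y (ler0n _ 2) y2; lra.
have h : 9 / 16 * (y ^+ 2) ^+ 2 <= (y ^+ 2 - 1) ^+ 2.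
  have : (3 / 4 * y ^+ 2) ^+ 2 <= (y ^+ 2 - 1) ^+ 2.
    by apply: le_expn; lra.
  lra.
have -> : y ^+ 4 = (y ^+ 2) ^+ 2 by ring.
have h2 : y ^+ 2 <= (y ^+ 2) ^+ 2 / 4.
  by have : y ^+ 2 * 4 <= y ^+ 2 * y ^+ 2; [rewrite ler_wpM2l// sqr_ge0 | rewrite expr2; lra].
have := sqr_ge0 (x - 2 * y); have := sqr_ge0 (x - y).
have : x * y <= (x-y)^+2 + 2 * y ^+2; last by lra.
have := sqr_ge0 (x - (3/2) * y); have := sqr_ge0 y; lra.
Qed.

(** This is [bellman_step] divided by m^4, with x = a'/a, y = b'/b and s = ab/m, so that s x y =
    a'b'/m. *)
Lemma bellman_unit s x y : 0 < s -> s <= 1 -> 0 < x -> 0 < y ->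
  1000^-1 * (s ^+ 4 * ((x ^+ 2 - 1) ^+ 2 * y ^+ 4)) +
    Num.max 1 (s * x * y) ^+ 3 * (s * x * y) + 3
  <= 3 * Num.max 1 (s * x * y) ^+ 4 + s / 4 * (1 + 2 * x ^+ 2 + y ^+ 4).
Proof.
move=> s0 s1 x0 y0; set t := s * x * y.
have t0 : 0 < t by rewrite !mulr_gt0.
have D := bellman_defect x y.
set Q := 2 * (x - y) ^+ 2 + (y ^+ 2 - 1) ^+ 2 in D *.
have Q0 : 0 <= Q by rewrite /Q; have := sqr_ge0 (x - y); have := sqr_ge0 (y ^+ 2 - 1); lra.
have -> : s / 4 * (1 + 2 * x ^+ 2 + y ^+ 4) = t + s * Q / 4.
  by rewrite -D /t; field.
have sQ0 : 0 <= s * Q by rewrite mulr_ge0// ltW.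
have sq : 0 <= (x ^+ 2 - 1) ^+ 2 * y ^+ 4 by rewrite mulr_ge0 ?sqr_ge0 ?exprn_ge0 ?ltW.
set W := (x ^+ 2 - 1) ^+ 2 * y ^+ 4 in sq *.
have s3 : 0 <= s ^+ 3 <= 1 by rewrite exprn_ge0 ?exprn_ile1// ltW.
have x4 : (x ^+ 2 - 1) ^+ 2 <= x ^+ 4 + 1.
  by have := sqr_ge0 x; rewrite (_ : x ^+ 4 = (x ^+ 2) ^+ 2); [lra | ring].
have y40 : 0 <= y ^+ 4 by rewrite exprn_ge0// ltW.
have Wle : W <= x ^+ 4 * y ^+ 4 + y ^+ 4.
  by rewrite /W; have := ler_wpM2r y40 x4; lra.
have s34 : s ^+ 4 * W = s * (s ^+ 3 * W) by ring.
have t4 : s ^+ 4 * W <= t ^+ 4 + s * y ^+ 4.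
  have : s ^+ 4 * W <= s ^+ 4 * (x ^+ 4 * y ^+ 4 + y ^+ 4) by rewrite ler_wpM2l// exprn_ge0// ltW.
  have : s ^+ 4 * y ^+ 4 <= s * y ^+ 4.
    by rewrite ler_wpM2r// exprS -[leRHS]mulr1 ler_wpM2l ?(ltW s0)//; case/andP: s3.
  rewrite (_ : t ^+ 4 = s ^+ 4 * (x ^+ 4 * y ^+ 4)); [lra | rewrite /t; ring].
(* For t <= 1 the running maximum does not move and the defect [Q] alone has to pay. For t > 1 it
   moves to [t], and the surplus of 3 t^4 over t^4 + 3 - t pays as well. *)
case: (leP t 1) => t1.
  rewrite !expr1n !mul1r.
  suff : s ^+ 3 * W <= 200 * Q by move=> h; have := ler_wpM2l (ltW s0) h; rewrite -s34; lra.
  case: (leP y 2) => y2; first by apply: bellman_small => //; rewrite -/t; lra.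
  apply: le_trans (bellman_large x0 (ltW y2)).
  have : s ^+ 3 * W <= s ^+ 3 * (x ^+ 4 * y ^+ 4 + y ^+ 4) by rewrite ler_wpM2l//; case/andP: s3.
  have : s ^+ 3 * y ^+ 4 <= y ^+ 4 by rewrite -[leRHS]mul1r ler_wpM2r//; case/andP: s3.
  have : s ^+ 3 * (x ^+ 4 * y ^+ 4) <= x * y; last by lra.
  have -> : s ^+ 3 * (x ^+ 4 * y ^+ 4) = t ^+ 3 * (x * y) by rewrite /t; ring.
  by rewrite -[leRHS]mul1r ler_wpM2r ?exprn_ile1// ?mulr_ge0// ltW.
rewrite -exprSr.
have t41 : 1 <= t ^+ 4 by rewrite exprn_ege1// ltW.
suff : s ^+ 4 * W <= 500 * (t ^+ 4 - 1) + 250 * (s * Q) by lra.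
case: (leP y 2) => y2.
  case: (leP t 2) => t2.
    have : s ^+ 3 * W <= 200 * Q by apply: bellman_small.
    by move=> h; have := ler_wpM2l (ltW s0) h; rewrite -s34; lra.
  have : s * y ^+ 4 <= 16.
    rewrite -[leRHS]mul1r ler_pM ?(ltW s0)//.
    by have := le_expn 4 (ltW y0) y2; lra.
  have : 16 <= t ^+ 4 by have := @le_expn 4 2 t (ler0n _ 2) (ltW t2); lra.
  lra.
have := ler_wpM2l (ltW s0) (bellman_large x0 (ltW y2)).
have -> : s * (x * y + y ^+ 4) = t + s * y ^+ 4 by rewrite /t; ring.
rewrite -/Q; lra.
Qed.

(* To be read with a^2 = f_k, b^4 = u_k and m^4 = max_(j <= k) f_j^2 u_j, the primed letters standing
   for time k+1. The last factor on the right has conditional expectation 1 at time k, so that the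
   inequality telescopes. *)
Lemma bellman_step (a b a' b' m : R) : 0 < a -> 0 < b -> 0 < a' -> 0 < b' -> a * b <= m ->
  1000^-1 * ((a' ^+ 2 - a ^+ 2) ^+ 2 * b' ^+ 4) +
    Num.max m (a' * b') ^+ 3 * (a' * b') + 3 * m ^+ 4
  <= 3 * Num.max m (a' * b') ^+ 4 +
     m ^+ 3 * (a * b) * (4^-1 + a' ^+ 2 / (2 * a ^+ 2) + b' ^+ 4 / (4 * b ^+ 4)).
Proof.
move=> a0 b0 a'0 b'0 abm.
have m0 : 0 < m by apply: lt_le_trans abm; rewrite mulr_gt0.
have := @bellman_unit (a * b / m) (a' / a) (b' / b).
rewrite !divr_gt0 ?mulr_gt0// ler_pdivrMr// mul1r => /(_ isT abm isT isT).
have -> : a * b / m * (a' / a) * (b' / b) = a' * b' / m by field; rewrite !gt_eqF.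
have -> : Num.max 1 (a' * b' / m) = Num.max m (a' * b') / m.
  by rewrite maxr_pMl ?invr_ge0 ?(ltW m0)// divff ?gt_eqF.
set M := Num.max _ _ => h.
have := ler_wpM2l (ltW (exprn_gt0 4 m0)) h.
have E1 : m ^+ 4 * (1000^-1 * ((a * b / m) ^+ 4 * (((a' / a) ^+ 2 - 1) ^+ 2 * (b' / b) ^+ 4)) +
  (M / m) ^+ 3 * (a' * b' / m) + 3) = 1000^-1 * ((a' ^+ 2 - a ^+ 2) ^+ 2 * b' ^+ 4) +
    M ^+ 3 * (a' * b') + 3 * m ^+ 4 by field; rewrite !gt_eqF.
have E2 : m ^+ 4 * (3 * (M / m) ^+ 4 + a * b / m / 4 * (1 + 2 * (a' / a) ^+ 2 + (b' / b) ^+ 4)) =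
  3 * M ^+ 4 +
     m ^+ 3 * (a * b) * (4^-1 + a' ^+ 2 / (2 * a ^+ 2) + b' ^+ 4 / (4 * b ^+ 4)).
  by field; rewrite !gt_eqF.
by rewrite E1 E2.
Qed.

(** The numerical value is hidden behind a choice; later arguments use only 0 < c <= 1. *)
Lemma bellman_const_ex : exists2 c : R, 0 < c <= 1 & forall a b a' b' m : R,
  0 < a -> 0 < b -> 0 < a' -> 0 < b' -> a * b <= m ->
  c * ((a' ^+ 2 - a ^+ 2) ^+ 2 * b' ^+ 4) +
    Num.max m (a' * b') ^+ 3 * (a' * b') + 3 * m ^+ 4
  <= 3 * Num.max m (a' * b') ^+ 4 +
     m ^+ 3 * (a * b) * (4^-1 + a' ^+ 2 / (2 * a ^+ 2) + b' ^+ 4 / (4 * b ^+ 4)).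
Proof. by exists 1000^-1; [rewrite invr_gt0 invf_le1; lra|exact: bellman_step]. Qed.

End bellman_pointwise.

Definition bellman_const (R : realType) : R := s2val (cid2 (bellman_const_ex R)).
Arguments bellman_const {R}.

Lemma bellman_const_itv (R : realType) : 0 < bellman_const :> R /\ bellman_const <= 1 :> R.
Proof. by case/andP: (s2valP (cid2 (bellman_const_ex R))). Qed.

Lemma bellman_step_const (R : realType) (a b a' b' m : R) :
  0 < a -> 0 < b -> 0 < a' -> 0 < b' -> a * b <= m ->
  bellman_const * ((a' ^+ 2 - a ^+ 2) ^+ 2 * b' ^+ 4) +
    Num.max m (a' * b') ^+ 3 * (a' * b') + 3 * m ^+ 4
  <= 3 * Num.max m (a' * b') ^+ 4 +
     m ^+ 3 * (a * b) * (4^-1 + a' ^+ 2 / (2 * a ^+ 2) + b' ^+ 4 / (4 * b ^+ 4)).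
Proof. exact: (s2valP' (cid2 (bellman_const_ex R))). Qed.

(** * Measurability of powers and quotients *)

Section measurability.
Context d (T : measurableType d) (R : realType).
Implicit Types (D : set T) (f g : T -> R).

Lemma measurable_fun_powR D f p : measurable_fun D f ->
  measurable_fun D (fun x => f x `^ p).
Proof. by move=> mf; apply: (measurableT_comp (measurable_powR p)). Qed.

Lemma measurable_fun_inv D f : (forall x, 0 <= f x) -> measurable_fun D f ->
  measurable_fun D (fun x => (f x)^-1).
Proof.
move=> f0 mf; rewrite (_ : (fun x => _) = (fun x => f x `^ (-1))).
  exact: measurable_fun_powR.
by apply/funext => x; rewrite powR_inv1.
Qed.

Lemma measurable_fun_div D f g : (forall x, 0 <= g x) -> measurable_fun D f ->
  measurable_fun D g -> measurable_fun D (fun x => f x / g x).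
Proof. by move=> g0 mf mg; apply: measurable_funM => //; exact: measurable_fun_inv. Qed.

End measurability.

Ltac mfun := repeat first [ done | apply: measurable_funB | apply: measurable_funD
  | apply: measurable_funM | apply: measurable_funX ].
Ltac nneg := move=> ?; repeat first [ done | apply: addr_ge0 | apply: mulr_ge0
  | apply: exprn_ge0 | apply: ltW; done ].

(** * Integrals of real functions with values in the extended line *)

Section eint.
Context d (T : measurableType d) (R : realType) (P : probability T R).
Implicit Types f g : T -> R.

Definition eint f : \bar R := (\int[P]_x (f x)%:E)%E.

Lemma eint_ge0 f : (forall x, 0 <= f x) -> (0 <= eint f)%E.
Proof. by move=> f0; apply: integral_ge0 => x _; rewrite lee_fin. Qed.

Lemma eq_eint f g : f =1 g -> eint f = eint g.
Proof. by move=> fg; apply: eq_integral => x _; rewrite fg. Qed.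

Lemma eint_cst c : eint (fun=> c) = c%:E.
Proof. by rewrite /eint integral_cst// [X in (_ * X)%E](_ : _ = 1%E) ?mule1//; exact: probability_setT. Qed.

Lemma eintD f g : measurable_fun setT f -> measurable_fun setT g ->
  (forall x, 0 <= f x) -> (forall x, 0 <= g x) ->
  eint (fun x => f x + g x) = (eint f + eint g)%E.
Proof.
move=> mf mg f0 g0; rewrite /eint -ge0_integralD//.
- by move=> x _; rewrite lee_fin.
- exact/measurable_EFinP.
- by move=> x _; rewrite lee_fin.
- exact/measurable_EFinP.
Qed.

Lemma eintZ c f : 0 <= c -> measurable_fun setT f -> (forall x, 0 <= f x) ->
  eint (fun x => c * f x) = (c%:E * eint f)%E.
Proof.
move=> c0 mf f0; rewrite /eint -ge0_integralZl//.
- exact/measurable_EFinP.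
- by move=> x _; rewrite lee_fin.
Qed.

Lemma le_eint f g : measurable_fun setT f -> measurable_fun setT g ->
  (forall x, 0 <= f x) -> (forall x, f x <= g x) -> (eint f <= eint g)%E.
Proof.
move=> mf mg f0 fg; apply: ge0_le_integral => //.
- by move=> x _; rewrite lee_fin.
- exact/measurable_EFinP.
- exact/measurable_EFinP.
- by move=> x _; rewrite lee_fin.
Qed.

Lemma eint_convex3 (A B C : T -> R) e :
  measurable_fun setT A -> measurable_fun setT B -> measurable_fun setT C ->
  (forall x, 0 <= A x) -> (forall x, 0 <= B x) -> (forall x, 0 <= C x) ->
  eint A = e -> eint B = e -> eint C = e ->
  eint (fun x => 4^-1 * A x + (2^-1 * B x + 4^-1 * C x)) = e.
Proof.
move=> mA mB mC A0 B0 C0 eA eB eC.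
have mZ c f : measurable_fun setT f -> measurable_fun setT (fun x => c * f x).
  by move=> mf; exact: measurable_funM.
rewrite eintD ?eintD ?eintZ//; try by [exact: mZ|move=> x; rewrite mulr_ge0].
- rewrite eA eB eC -ge0_muleDl ?lee_fin// -ge0_muleDl ?lee_fin ?addr_ge0//.
  by rewrite -!EFinD (_ : 4^-1 + (2^-1 + 4^-1) = 1) ?mul1e//; field.
- by apply: measurable_funD; exact: mZ.
- by move=> x; rewrite addr_ge0 ?mulr_ge0.
Qed.

(** Removes truncations: at each point the truncated functions agree with [g] from some index on, so
    a bound uniform in the truncation survives. *)
Lemma eint_monotone (f : nat -> T -> R) g c :
  (forall n, measurable_fun setT (f n)) -> (forall n x, 0 <= f n x) ->
  (forall x, nondecreasing_seq (f ^~ x)) ->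
  (forall x, \forall n \near \oo, f n x = g x) ->
  (forall n, (eint (f n) <= c)%E) -> (eint g <= c)%E.
Proof.
move=> mf f0 ndf fg fc.
have -> : eint g = limn (fun n => eint (f n)).
  rewrite /eint -monotone_convergence//.
  - apply: eq_integral => x _; apply/esym/cvg_lim => //.
    by apply: cvg_near_cst; apply: filterS (fg x) => n ->.
  - by move=> n; exact/measurable_EFinP.
  - by move=> n x _; rewrite lee_fin.
  - by move=> x _ a b ab; rewrite lee_fin; exact: ndf.
apply: lime_le; last exact: nearW.
apply: ereal_nondecreasing_is_cvgn => a b ab.
by apply: le_eint => // x; exact: ndf.
Qed.

End eint.

(** * Running maxima *)

Fixpoint rmax (T : Type) (R : realType) (Z : nat -> T -> R) n x : R :=
  if n is k.+1 then Num.max (rmax Z k x) (Z k.+1 x) else Z 0%N x.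

Section rmax.
Context (T : Type) (R : realType).
Implicit Types (Z : nat -> T -> R).

Lemma rmax_ge Z n k x : (k <= n)%N -> Z k x <= rmax Z n x.
Proof.
elim: n => [|n IH]; first by rewrite leqn0 => /eqP ->.
rewrite leq_eqVlt => /predU1P[->|kn] /=; first by rewrite le_max lexx orbT.
by rewrite le_max IH.
Qed.

Lemma rmax_le Z n x c : (forall k, (k <= n)%N -> Z k x <= c) -> rmax Z n x <= c.
Proof.
elim: n => [|n IH] h; first exact: h.
by rewrite /= ge_max h// andbT IH// => k kn; apply: h; rewrite ltnW.
Qed.

Lemma rmax_nd Z x n : rmax Z n x <= rmax Z n.+1 x.
Proof. by rewrite /= le_max lexx. Qed.

Lemma rmax_ge0 Z n x : (forall k, 0 <= Z k x) -> 0 <= rmax Z n x.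
Proof. by move=> Z0; rewrite (le_trans (Z0 0%N))// rmax_ge. Qed.

Lemma rmax_gt0 Z n x : (forall k, 0 < Z k x) -> 0 < rmax Z n x.
Proof. by move=> Z0; rewrite (lt_le_trans (Z0 0%N))// rmax_ge. Qed.

End rmax.

(** * Positive versions and the integrated Bellman inequality *)

Section filtered.
Context d (T : measurableType d) (R : realType) (P : probability T R).
Variable F : nat -> set (set T).
Hypothesis FF : is_filtration F.

Definition adapted k (g : T -> R) := measurable_fun [set: g_sigma_algebraType (F k)] g.

(** A real, everywhere positive version of the conditional expectation. Dividing by it and taking
    its powers is legitimate at every point; null sets are dealt with only where such versions are
    constructed. *)
Definition pos_version (f : T -> R) k (g : T -> R) :=
  [/\ adapted k g, forall x, 0 < g x & forall phi, adapted k phi -> (forall x, 0 <= phi x) ->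
    eint P (fun x => (phi x * g x)%R) = eint P (fun x => (phi x * f x)%R)].

Lemma adapted_measurable k g : adapted k g -> measurable_fun [set: T] g.
Proof. case: FF => s m _; exact: (measurable_sub (s k) (m k)). Qed.

Lemma adapted_le j k g : (j <= k)%N -> adapted j g -> adapted k g.
Proof.
case: FF => s m le jk ag _ A mA; apply/(sub_measurableG (s k))/(le _ _ jk).
by apply/(sub_measurableG (s j)); exact: ag.
Qed.

Lemma adapted_rmax k Z : (forall j, adapted j (Z j)) -> adapted k (rmax Z k).
Proof.
move=> aZ; elim: k => [|k IH]; first exact: aZ.
apply: measurable_maxr; last exact: aZ.
by move: IH; apply: adapted_le.
Qed.

Section bellman.
Variables (f u : T -> R) (f_ u_ : nat -> T -> R).
Hypotheses (mf : measurable_fun setT f) (mu : measurable_fun setT u)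
  (f0 : forall x, 0 < f x) (u0 : forall x, 0 < u x)
  (fP : forall k, pos_version f k (f_ k)) (uP : forall k, pos_version u k (u_ k)).

Definition sqsum (n : nat) (x : T) : R :=
  (f_ 0%N x) ^+ 2 + \sum_(k < n) (f_ k.+1 x - f_ k x) ^+ 2.

Let a k x := f_ k x `^ 2^-1.
Let b k x := u_ k x `^ 4^-1.
Let m := rmax (fun k x => a k x * b k x).

Let af k : adapted k (f_ k). Proof. by case: (fP k). Qed.
Let au k : adapted k (u_ k). Proof. by case: (uP k). Qed.
Let f_0 k x : 0 < f_ k x. Proof. by case: (fP k). Qed.
Let u_0 k x : 0 < u_ k x. Proof. by case: (uP k). Qed.
Let a0 k x : 0 < a k x. Proof. exact: powR_gt0. Qed.
Let b0 k x : 0 < b k x. Proof. exact: powR_gt0. Qed.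
Let a2 k x : a k x ^+ 2 = f_ k x.
Proof. by rewrite -powR_mulrn ?powR_ge0// -powRrM mulVf// powRr1// ltW. Qed.
Let b4 k x : b k x ^+ 4 = u_ k x.
Proof. by rewrite -powR_mulrn ?powR_ge0// -powRrM mulVf// powRr1// ltW. Qed.
Let m0 k x : 0 < m k x. Proof. by apply: rmax_gt0 => j; apply: mulr_gt0; [exact: a0|exact: b0]. Qed.
Let aa k : adapted k (a k). Proof. exact: measurable_fun_powR _ (@af k). Qed.
Let ab k : adapted k (b k). Proof. exact: measurable_fun_powR _ (@au k). Qed.
Let am k : adapted k (m k).
Proof. by apply: adapted_rmax => j; exact: measurable_funM (@aa j) (@ab j). Qed.
(** The correction term of the Bellman function: it equals m^4 at time 0, is at most m^4 later, and
    its integral is carried from step to step. *)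
Let U k x := m k x ^+ 3 * (a k x * b k x).
Let aU k : adapted k (U k).
Proof. by apply: measurable_funM; [exact: measurable_funX _ (@am k)|exact: measurable_funM (@aa k) (@ab k)]. Qed.
Let U0 k x : 0 <= U k x. Proof. by apply: mulr_ge0; [apply: exprn_ge0|apply: mulr_ge0]; exact: ltW. Qed.

Lemma bellman_integral n :
  (eint P (fun x => (sqsum n x * u x)%R) <=
   (4 / bellman_const)%:E * eint P (fun x => (rmax (fun k x => f_ k x ^+ 2 * u_ k x) n x)%R))%E.
Proof.
have mE k x : rmax (fun k x => f_ k x ^+ 2 * u_ k x) k x = m k x ^+ 4.
  have e j : f_ j x ^+ 2 * u_ j x = (a j x * b j x) ^+ 4.
    by rewrite exprMn b4 (exprM _ 2 2) a2.
  rewrite /m; elim: k => [|k IH] /=; first exact: e.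
  rewrite IH e; case: (leP (_ * _) (rmax _ _ _)) => h.
    by rewrite max_l// lerXn2r// nnegrE ltW// ?mulr_gt0//; exact: m0.
  by rewrite max_r// lerXn2r// ?nnegrE ltW// ?mulr_gt0//; exact: m0.
have [c0 c1] := bellman_const_itv R.
pose M k := eint P (fun x => (m k x ^+ 4)%R).
rewrite (eq_eint _ (mE n)) -/(M n).
have mm k : measurable_fun setT (m k) by apply: adapted_measurable (@am k).
have M0 k : (0 <= M k)%E by apply: eint_ge0 => x; rewrite exprn_ge0// ltW.
have Mle k : (M k <= M k.+1)%E.
  apply: le_eint => [| |x|x]; try exact: measurable_funX.
    by rewrite exprn_ge0// ltW.
  by rewrite lerXn2r ?nnegrE ?(ltW (m0 _ _))//; exact: rmax_nd.
have Mle' k : (k <= n)%N -> (M k <= M n)%E by move=> /(homo_leq lexx le_trans Mle).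
(* An infinite right-hand side leaves nothing to prove. Otherwise every [M k] with k <= n is finite,
   and 3 [M k] can be cancelled in the induction step. *)
have [Moo|Mn] := eqVneq (M n) +oo%E.
  by rewrite Moo gt0_muley ?leey// lte_fin divr_gt0.
have Mfin k : (k <= n)%N -> M k \is a fin_num.
  by move=> kn; rewrite ge0_fin_numE// (le_lt_trans (Mle' _ kn))// ltey.
(* Adding the integral of [U k] makes the induction close. At time 0 the left-hand side is (c + 1)
   M_0, so c <= 1 suffices for the start. *)
suff H : forall k, (k <= n)%N ->
  (bellman_const%:E * eint P (fun x => (sqsum k x * u x)%R) + eint P (U k) <= 3%:E * M k)%E.
  have /(le_trans (leeDl _ (eint_ge0 _ (U0 n)))) := H n (leqnn n).
  rewrite -(@lee_pmul2l _ bellman_const^-1%:E)//= ?lte_fin ?invr_gt0//.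
  rewrite muleA -EFinM mulVf ?gt_eqF// mul1e muleA -EFinM.
  move=> /le_trans; apply; rewrite lee_wpmul2r//.
  by rewrite lee_fin mulrC ler_wpM2r ?invr_ge0 ?(ltW c0)//; lra.
have mf_ k : measurable_fun setT (f_ k) := adapted_measurable (@af k).
have mu_ k : measurable_fun setT (u_ k) := adapted_measurable (@au k).
have mU k : measurable_fun setT (U k) := adapted_measurable (@aU k).
have msq k : measurable_fun setT (sqsum k).
  apply: measurable_funD; first exact: measurable_funX.
  by apply: measurable_sum => i; apply: measurable_funX; exact: measurable_funB.
have sq0 k x : 0 <= sqsum k x.
  by rewrite addr_ge0 ?sqr_ge0// sumr_ge0// => i _; exact: sqr_ge0.
elim=> [|k IH] kn.
  have e0 : eint P (fun x => (sqsum 0 x * u x)%R) = M 0%N.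
    transitivity (eint P (fun x => (f_ 0%N x ^+ 2 * u x)%R)).
      by apply: eq_eint => x; rewrite /sqsum big_ord0 addr0.
    case: (uP 0%N) => _ _ <-; last by move=> x; exact: sqr_ge0.
      by apply: eq_eint => x; rewrite -(mE 0%N).
    exact: measurable_funX (@af 0%N).
  have e1 : eint P (U 0%N) = M 0%N.
    by apply: eq_eint => x; rewrite /U -exprSr.
  have M00 : 0 <= fine (M 0%N) by exact/fine_ge0.
  rewrite e0 e1 -(fineK (Mfin _ kn)) -!EFinM -EFinD lee_fin.
  by have := ler_wpM2r M00 c1; lra.
pose dd x := (f_ k.+1 x - f_ k x) ^+ 2.
pose V x := U k x * (4^-1 + f_ k.+1 x / (2 * f_ k x) + u_ k.+1 x / (4 * u_ k x)).
have step : (bellman_const%:E * eint P (fun x => (dd x * u x)%R) + eint P (U k.+1) + 3%:E * M k <=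
   3%:E * M k.+1 + eint P (U k))%E.
  (* The martingale property enters here: U_k / v_k is F_k-measurable, so in the test against it
     v_(k+1) may be replaced by v_k, which cancels. *)
  have eV (v : T -> R) (v_ : nat -> T -> R) : measurable_fun setT v ->
      (forall j, pos_version v j (v_ j)) ->
      eint P (fun x => (U k x / v_ k x * v_ k.+1 x)%R) = eint P (U k).
    move=> mv vP.
    have [av v0 ev] := vP k; have [av' v'0 ev'] := vP k.+1.
    have Uv0 x : 0 <= U k x / v_ k x by rewrite divr_ge0// ltW.
    have aUv : adapted k (fun x => U k x / v_ k x).
      by apply: measurable_fun_div (@aU k) av => x; exact/ltW.
    rewrite ev'//; last exact: adapted_le aUv.
    by rewrite -ev//; apply: eq_eint => x; rewrite divfK// gt_eqF.
  have mUv (v_ : nat -> T -> R) : (forall j x, 0 < v_ j x) -> (forall j, measurable_fun setT (v_ j)) ->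
      measurable_fun setT (fun x => U k x / v_ k x * v_ k.+1 x).
    move=> v0 mv; apply: measurable_funM => //.
    by apply: measurable_fun_div => // x; exact/ltW.
  have Uv0 (v_ : nat -> T -> R) x : (forall j x, 0 < v_ j x) ->
      0 <= U k x / v_ k x * v_ k.+1 x.
    by move=> v0; rewrite mulr_ge0 ?divr_ge0// ltW.
  have eVU : eint P (fun x => (4^-1 * U k x + (2^-1 * (U k x / f_ k x * f_ k.+1 x) +
      4^-1 * (U k x / u_ k x * u_ k.+1 x)))%R) = eint P (U k).
    apply: eint_convex3 => //; (try exact: mUv); try (move=> x; exact: Uv0).
    - exact: (eV f).
    - exact: (eV u).
  have mdd : measurable_fun setT dd.
    by apply: measurable_funX; exact: measurable_funB.
  have -> : eint P (fun x => (dd x * u x)%R) = eint P (fun x => (dd x * u_ k.+1 x)%R).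
    case: (uP k.+1) => _ _ <- //; last by move=> x; exact: sqr_ge0.
    by apply: measurable_funX; apply: (measurable_funB (@af k.+1)); exact: adapted_le (@af k).
  have dd0 x : 0 <= dd x * u_ k.+1 x by rewrite mulr_ge0 ?sqr_ge0// ltW.
  have m4 j : measurable_fun setT (fun x => m j x ^+ 4) by exact: measurable_funX.
  have m40 j x : 0 <= m j x ^+ 4 by rewrite exprn_ge0// ltW.
  have mddu : measurable_fun setT (fun x => dd x * u_ k.+1 x) by exact: measurable_funM.
  have mV : measurable_fun setT (fun x => 4^-1 * U k x + (2^-1 * (U k x / f_ k x * f_ k.+1 x) +
      4^-1 * (U k x / u_ k x * u_ k.+1 x))).
    by apply: measurable_funD; [mfun|apply: measurable_funD; (apply: measurable_funM; [done|exact: mUv])].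
  have V0 x : 0 <= 4^-1 * U k x + (2^-1 * (U k x / f_ k x * f_ k.+1 x) +
      4^-1 * (U k x / u_ k x * u_ k.+1 x)).
    by apply: addr_ge0; [exact: mulr_ge0|apply: addr_ge0; (apply: mulr_ge0; [done|exact: Uv0])].
  have EL : eint P (fun x => (bellman_const * (dd x * u_ k.+1 x) + (U k.+1 x + 3 * m k x ^+ 4))%R) =
      (bellman_const%:E * eint P (fun x => (dd x * u_ k.+1 x)%R) + (eint P (U k.+1) + 3%:E * M k))%E.
    have c0' := ltW c0.
    by rewrite eintD ?eintD ?eintZ//; (try by mfun); nneg.
  have ER : eint P (fun x => (3 * m k.+1 x ^+ 4 + (4^-1 * U k x + (2^-1 * (U k x / f_ k x * f_ k.+1 x) +
      4^-1 * (U k x / u_ k x * u_ k.+1 x))))%R) = (3%:E * M k.+1 + eint P (U k))%E.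
    by rewrite eintD ?eintZ ?eVU//; (try by mfun); nneg.
  have c0' := ltW c0.
  rewrite -addeA -ER -EL; apply: le_eint => [| |x|x]; try by mfun.
    by apply: addr_ge0; [exact: mulr_ge0|apply: addr_ge0; [exact: U0|exact: mulr_ge0]].
  have := @bellman_step_const R _ _ _ _ _ (@a0 k x) (@b0 k x) (@a0 k.+1 x) (@b0 k.+1 x)
    (rmax_ge (fun k x => a k x * b k x) x (leqnn k)).
  rewrite !a2 !b4 -[rmax _ k x]/(m k x) -[Num.max _ _]/(m k.+1 x) -/(U k.+1 x) -/(dd x).
  have -> : m k x ^+ 3 * (a k x * b k x) = U k x by [].
  have fn : f_ k x != 0 by rewrite gt_eqF.
  have un : u_ k x != 0 by rewrite gt_eqF.
  have -> : U k x * (4^-1 + f_ k.+1 x / (2 * f_ k x) + u_ k.+1 x / (4 * u_ k x)) =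
    4^-1 * U k x + (2^-1 * (U k x / f_ k x * f_ k.+1 x) + 4^-1 * (U k x / u_ k x * u_ k.+1 x)).
    by field; rewrite fn un.
  by rewrite -addrA.
have mdd : measurable_fun setT dd by apply: measurable_funX; exact: measurable_funB.
have eS : eint P (fun x => (sqsum k.+1 x * u x)%R) =
    (eint P (fun x => (sqsum k x * u x)%R) + eint P (fun x => (dd x * u x)%R))%E.
  rewrite -eintD; [|by mfun|by mfun|move=> x|move=> x].
  - by apply: eq_eint => x; rewrite -mulrDl /sqsum big_ord_recr/= addrA.
  - by rewrite mulr_ge0// ltW.
  - by rewrite mulr_ge0 ?sqr_ge0// ltW.
have e0 : (0 <= eint P (fun x => (sqsum k x * u x)%R))%E.
  by apply: eint_ge0 => x; rewrite mulr_ge0// ltW.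
have e1 : (0 <= eint P (fun x => (dd x * u x)%R))%E.
  by apply: eint_ge0 => x; rewrite mulr_ge0 ?sqr_ge0// ltW.
rewrite eS ge0_muleDr//.
have kn' := ltnW kn.
have F3 : (3%:E * M k)%E \is a fin_num by rewrite fin_numM// Mfin.
rewrite -(leeD2rE _ _ F3) -addeA -addeA (addeA (bellman_const%:E * eint P (fun x => (dd x * u x)%R))%E).
apply: le_trans (leeD2l _ step) _.
rewrite (addeC (3%:E * M k.+1)%E) addeA addeC.
by apply: leeD2l; exact: IH.
Qed.
End bellman.
End filtered.

(** * Convexity inequalities for powers *)

Section powers.
Variable R : realType.
Implicit Types a b c p q r s x y : R.

(** Young's inequality after scaling [a] by [c] with c^r = eta r, which leaves exactly eta in front
    of a^r. A small eta lets that term be absorbed. *)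
Lemma young_ex (K eta r s : R) : 0 <= K -> 0 < eta -> 0 < r -> 0 < s ->
  r^-1 + s^-1 = 1 ->
  exists2 C : R, 0 <= C & forall a b, 0 <= a -> 0 <= b ->
    K * a * b <= eta * a `^ r + C * b `^ s.
Proof.
move=> K0 e0 r0 s0 rs.
pose c := (eta * r) `^ r^-1.
have c0 : 0 < c by rewrite powR_gt0 ?mulr_gt0.
have cr : c `^ r = eta * r by rewrite -powRrM mulVf ?gt_eqF// powRr1// mulr_ge0// ltW.
exists ((K / c) `^ s / s); first by rewrite divr_ge0 ?powR_ge0 ?ltW.
move=> a b a0 b0.
have := @conjugate_powR R (a * c) (b * (K / c)) r s.
rewrite !mulr_ge0 ?invr_ge0 ?(ltW c0)// => /(_ isT isT r0 s0 rs).
have Kc0 : 0 <= K / c by rewrite divr_ge0// ltW.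
rewrite (powRM _ a0 (ltW c0)) cr (powRM _ b0 Kc0) => h; apply: le_trans (le_trans _ h) _.
  by rewrite [leLHS](_ : _ = a * c * (b * (K / c)))//; field; rewrite gt_eqF.
by rewrite le_eqVlt; apply/orP; left; apply/eqP; field; rewrite !gt_eqF.
Qed.

(** The convex function t^(-th) at [p] lies above its tangent line at [r]. This is Young's
    inequality with exponents 1 + th and (1 + th)/th. *)
Lemma powR_jensen_tangent (th r p : R) : 0 < th -> 0 < r -> 0 < p ->
  (1 + th) * r `^ (- th) <= p `^ (- th) + th * (r `^ (- th) / r * p).
Proof.
move=> t0 r0 p0.
have t1 : 0 < 1 + th by lra.
have := @conjugate_powR R (p `^ (- th / (1 + th))) ((r `^ (- th) / r * p) `^ (th / (1 + th)))
  (1 + th) ((1 + th) / th).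
rewrite !powR_ge0 => /(_ isT isT t1); rewrite divr_gt0// => /(_ isT).
have -> : (1 + th)^-1 + ((1 + th) / th)^-1 = 1.
  by field; rewrite !gt_eqF.
move=> /(_ erefl).
have nz : 1 + th != 0 by rewrite gt_eqF.
rewrite -!powRrM divfK// (_ : th / (1 + th) * ((1 + th) / th) = 1); last first.
  by field; rewrite !gt_eqF.
have y0 : 0 <= r `^ (- th) / r * p by rewrite mulr_ge0 ?divr_ge0 ?powR_ge0 ?ltW.
rewrite powRr1//.
have -> : r `^ (- th) / r * p = r `^ (- th - 1) * p.
  by rewrite powRD ?(gt_eqF r0) ?implybT// powR_inv1// ltW.
rewrite powRM ?powR_ge0 ?(ltW p0)// -powRrM.
have -> : (- th - 1) * (th / (1 + th)) = - th by field.
rewrite mulrCA -powRD ?(gt_eqF p0) ?implybT//.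
have -> : - th / (1 + th) + th / (1 + th) = 0 by field.
rewrite powRr0 mulr1 => h.
have := ler_wpM2l (ltW t1) h; congr (_ <= _).
by field; rewrite !gt_eqF.
Qed.

(* That is, t^q - s^q <= q' t (t^(q-1) - s^(q-1)) with q' = q / (q - 1); summed along the running
   maximum this yields Doob's inequality. *)
Lemma powR_increment (q s t : R) : 1 < q -> 0 <= s -> 0 <= t ->
  t `^ q + q / (q - 1) * (t * s `^ (q - 1)) <= s `^ q + q / (q - 1) * t `^ q.
Proof.
move=> q1 s0 t0; have q0 : 0 < q by lra.
have q10 : 0 < q - 1 by lra.
have := @conjugate_powR R t (s `^ (q - 1)) q (q / (q - 1)) t0 (powR_ge0 _ _) q0.
rewrite divr_gt0// => /(_ isT).
have -> : q^-1 + (q / (q - 1))^-1 = 1 by field; rewrite !gt_eqF.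
move=> /(_ erefl); rewrite -powRrM.
have -> : (q - 1) * (q / (q - 1)) = q by field; rewrite gt_eqF.
move=> h; have := ler_wpM2l (ltW (divr_gt0 q0 q10)) h.
have -> : q / (q - 1) * (t `^ q / q + s `^ q / (q / (q - 1))) =
   q / (q - 1) * t `^ q - t `^ q + s `^ q by field; rewrite !gt_eqF.
lra.
Qed.

End powers.

(** * Indicators of sublevel sets *)

Section cutoff.
Context d (T : measurableType d) (R : realType).
Implicit Types f : T -> R.

Definition cutoff (f : T -> R) (c : R) (x : T) : R := if f x <= c then 1 else 0.

Lemma measurable_cutoff (f : T -> R) c : measurable_fun setT f ->
  measurable_fun setT (cutoff f c).
Proof. by move=> mf; apply: measurable_fun_ifT => //; exact: measurable_fun_ler. Qed.

Lemma cutoff_ge0 f c x : 0 <= cutoff f c x.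
Proof. by rewrite /cutoff; case: ifP. Qed.

Lemma cutoff_le1 f c x : cutoff f c x <= 1.
Proof. by rewrite /cutoff; case: ifP. Qed.

Lemma cutoff_nd f x : nondecreasing_seq (fun j => cutoff f j%:R x).
Proof.
move=> i j ij; rewrite /cutoff; case: ifPn => fi; last by case: ifP.
by rewrite (le_trans fi) ?ler_nat.
Qed.

Lemma cutoff_near1 f x : \forall j \near \oo, f x <= j%:R.
Proof.
exists (Num.truncn (f x)).+1 => // j /= h; rewrite (le_trans (ltW (truncnS_gt _)))//.
by rewrite ler_nat.
Qed.

End cutoff.

(** * Jensen's inequality for negative powers and Doob's maximal inequality *)

Section maximal.
Context d (T : measurableType d) (R : realType) (P : probability T R).
Variable F : nat -> set (set T).
Hypothesis FF : is_filtration F.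
Notation adapted := (@adapted d T R F).
Notation pos_version := (@pos_version d T R P F).

Lemma adapted_cutoff k (f : T -> R) c : adapted k f -> adapted k (cutoff f c).
Proof. by move=> af; apply: measurable_cutoff; exact: af. Qed.

(** Conditional Jensen in tested form: the tangent inequality at r_k is multiplied by [a] and
    integrated. The linear term integrates to th times the integral of a r_k^(-th) and is
    subtracted. *)
Lemma jensen_powR th (rho : T -> R) k r_ a : 0 < th ->
  measurable_fun setT rho -> (forall x, 0 < rho x) ->
  pos_version rho k r_ -> adapted k a -> (forall x, 0 <= a x) ->
  (eint P (fun x => (a x * r_ x `^ (- th))%R) <= eint P (fun x => (a x * rho x `^ (- th))%R))%E.
Proof.
move=> t0 mrho rho0 [ar r0 er] aa a0.
pose h x := a x * r_ x `^ (- th).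
have h0 x : 0 <= h x by rewrite mulr_ge0 ?powR_ge0.
have ah : adapted k h by apply: (measurable_funM aa); exact: measurable_fun_powR.
have ac j : adapted k (cutoff h j) by exact: adapted_cutoff.
have mh := adapted_measurable FF ah.
have ma := adapted_measurable FF aa.
have mc j := adapted_measurable FF (ac j).
have mr := adapted_measurable FF ar.
have mp : measurable_fun setT (fun x => rho x `^ (- th)) by exact: measurable_fun_powR.
have mpr : measurable_fun setT (fun x => r_ x `^ (- th)) by exact: measurable_fun_powR.
apply: (@eint_monotone _ _ _ _ (fun j x => cutoff h j%:R x * h x)).
- by move=> n; mfun.
- by move=> n x; rewrite mulr_ge0 ?cutoff_ge0.
- by move=> x i j ij; rewrite ler_wpM2r//; exact: cutoff_nd.
- by move=> x; apply: filterS (cutoff_near1 h x) => j hj; rewrite /cutoff hj mul1r.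
move=> j.
(* On the set where h <= j the integral of [h] is at most j, so the quantity subtracted at the end
   is finite. *)
pose c := cutoff h j%:R.
have c0 x : 0 <= c x := cutoff_ge0 _ _ _.
have ch0 x : 0 <= c x * h x by rewrite mulr_ge0.
have mch : measurable_fun setT (fun x => c x * h x) by apply: measurable_funM => //; exact: mc.
have fin : eint P (fun x => (c x * h x)%R) \is a fin_num.
  rewrite ge0_fin_numE; last exact: eint_ge0.
  apply: (@le_lt_trans _ _ (eint P (fun=> j%:R))).
    apply: le_eint => // x; rewrite /c /cutoff; case: ifP => hj; rewrite ?mul1r// mul0r.
    exact: ler0n.
  by rewrite eint_cst ltry.
have car0 x : 0 <= c x * a x / r_ x * r_ x `^ (- th).
  by rewrite mulr_ge0 ?powR_ge0 ?divr_ge0 ?mulr_ge0// ltW.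
have aca : adapted k (fun x => c x * a x / r_ x * r_ x `^ (- th)).
  apply: measurable_funM; last exact: measurable_fun_powR.
  apply: measurable_fun_div => //; first by move=> x; exact: ltW.
  by apply: measurable_funM => //; exact: ac.
have e1 : eint P (fun x => (c x * a x / r_ x * r_ x `^ (- th) * rho x)%R) = eint P (fun x => (c x * h x)%R).
  rewrite -er//; apply: eq_eint => x; rewrite /h; field.
  by rewrite gt_eqF.
have mcar : measurable_fun setT (fun x => c x * a x / r_ x * r_ x `^ (- th) * rho x).
  by apply: measurable_funM => //; exact: adapted_measurable aca.
have mcap : measurable_fun setT (fun x => c x * a x * rho x `^ (- th)).
  by apply: measurable_funM => //; apply: measurable_funM => //; exact: mc.
have cap0 x : 0 <= c x * a x * rho x `^ (- th) by rewrite !mulr_ge0 ?powR_ge0.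
have cr0 x : 0 <= c x * a x / r_ x * r_ x `^ (- th) * rho x by rewrite mulr_ge0// ltW.
have t0' := ltW t0.
have : ((1 + th)%:E * eint P (fun x => (c x * h x)%R) <=
   eint P (fun x => (c x * a x * rho x `^ (- th))%R) + th%:E * eint P (fun x => (c x * h x)%R))%E.
  rewrite -{2}e1 -!eintZ//; last by lra.
  rewrite -eintD//; [|exact: measurable_funM|by move=> x; rewrite mulr_ge0].
  apply: le_eint; [exact: measurable_funM| | |].
  - by apply: measurable_funD => //; exact: measurable_funM.
  - by move=> x; rewrite mulr_ge0//; lra.
  - move=> x; have := powR_jensen_tangent t0 (r0 x) (rho0 x).
    have ca0 : 0 <= c x * a x by rewrite mulr_ge0.
    move=> /(ler_wpM2l ca0); congr (_ <= _); rewrite /h; first by ring.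
    by field; rewrite gt_eqF.
rewrite EFinD ge0_muleDl ?lee_fin// mul1e leeD2rE ?fin_numM// => hle.
apply: (le_trans hle); apply: le_eint => //; first exact: measurable_funM.
move=> x; rewrite ler_wpM2r ?powR_ge0// -[leRHS]mul1r ler_wpM2r//.
exact: cutoff_le1.
Qed.

Variables (q C : R).
Hypotheses (q1 : 1 < q).
Hypothesis hC : forall a b : R, 0 <= a -> 0 <= b ->
  q / (q - 1) * a * b <= 2^-1 * a `^ (q / (q - 1)) + C * b `^ q.
Hypothesis C0 : 0 <= C.

(** The last hypothesis says that Z_k is at most the conditional expectation of phi/v for the
    measure v dP, and the integrand on the right is (phi/v)^q v. Summing the increments of M^q gives
    E M^q v <= q' E M^(q-1) phi, up to truncation; Young's inequality with factor 1/2 then absorbs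
    the left-hand side. *)
Lemma doob_maximal (v v0 phi : T -> R) (Z : nat -> T -> R) n :
  measurable_fun setT v -> (forall x, 0 < v x) -> pos_version v 0 v0 ->
  measurable_fun setT phi -> (forall x, 0 <= phi x) ->
  (forall k, adapted k (Z k)) -> (forall k x, 0 <= Z k x) ->
  (forall k g, (k <= n)%N -> adapted k g -> (forall x, 0 <= g x) ->
    (eint P (fun x => (g x * Z k x * v x)%R) <= eint P (fun x => (g x * phi x)%R))%E) ->
  (eint P (fun x => (rmax Z n x `^ q * v x)%R) <=
   (2 * C)%:E * eint P (fun x => (phi x `^ q * v x `^ (1 - q))%R))%E.
Proof.
move=> mv vp [av0 v00 ev0] mphi phi0 aZ Z0 hZ.
have q0 : 0 < q := lt_trans ltr01 q1.
have q10 : 0 < q - 1 by rewrite subr_gt0.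
have q'0 : 0 < q / (q - 1) by rewrite divr_gt0.
have q'1 : 1 <= q / (q - 1) by rewrite ler_pdivlMr// mul1r gerBl.
pose M := rmax Z.
have aM k : adapted k (M k) by exact: adapted_rmax.
have M0 k x : 0 <= M k x by exact: rmax_ge0.
(* Absorption needs finiteness: the maximum is cut at level j and v0 <= j is imposed. That set lies
   in F_0, so it is compatible with every test function, and [v] has integral at most j over it. *)
apply: (@eint_monotone _ _ _ _ (fun j x => cutoff v0 j%:R x * Num.min (M n x) j%:R `^ q * v x)).
- move=> j; mfun; first exact/measurable_cutoff/(adapted_measurable FF av0).
  apply: measurable_fun_powR; apply: measurable_minr => //.
  exact: (adapted_measurable FF (aM n)).
- by move=> j x; rewrite !mulr_ge0 ?cutoff_ge0 ?powR_ge0// ltW.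
- move=> x i j ij; rewrite ler_wpM2r ?(ltW (vp x))//.
  rewrite ler_pM ?cutoff_ge0 ?powR_ge0//; first exact: cutoff_nd.
  rewrite ge0_ler_powR ?(ltW q0)// ?nnegrE ?le_min ?M0 ?ler0n//.
  by rewrite !ge_min lexx/= ler_nat ij orbT.
- move=> x; have h1 := cutoff_near1 v0 x; have h2 := cutoff_near1 (M n) x.
  near=> j; rewrite /cutoff ifT ?mul1r; last by near: j.
  by rewrite min_l//; near: j.
move=> j.
pose L : R := j%:R.
have L0 : 0 <= L by exact: ler0n.
pose c := cutoff v0 L.
pose t k x := Num.min (M k x) L.
have c0 x : 0 <= c x := cutoff_ge0 _ _ _.
have c1 x : c x <= 1 := cutoff_le1 _ _ _.
have t0 k x : 0 <= t k x by rewrite le_min M0.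
have at_ k : adapted k (t k) by apply: measurable_minr => //; exact: aM.
have ac k : adapted k c by apply: (adapted_le FF (leq0n k)); exact: adapted_cutoff.
have mt k : measurable_fun setT (t k) := adapted_measurable FF (at_ k).
have mtp k r : measurable_fun setT (fun x => t k x `^ r) by exact: measurable_fun_powR.
have mc : measurable_fun setT c := adapted_measurable FF (ac 0%N).
have mZ k : measurable_fun setT (Z k) := adapted_measurable FF (aZ k).
have v0' x : 0 <= v x := ltW (vp x).
pose E k := eint P (fun x => (c x * t k x `^ q * v x)%R).
pose G k := eint P (fun x => (c x * t k x `^ (q - 1) * phi x)%R).
have G0 k : (0 <= G k)%E by apply: eint_ge0 => x; rewrite !mulr_ge0 ?powR_ge0.
have EG k : (k <= n)%N -> (E k <= (q / (q - 1))%:E * G k)%E.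
  elim: k => [|k IH] kn.
    apply: (@le_trans _ _ (1%:E * G 0%N)%E); last by rewrite lee_wpmul2r ?lee_fin.
    have ag : adapted 0 (fun x => c x * t 0%N x `^ (q - 1)).
      by apply: (measurable_funM (ac 0%N)); apply: measurable_fun_powR; exact: at_.
    have g0 x : 0 <= c x * t 0%N x `^ (q - 1) by rewrite mulr_ge0 ?powR_ge0.
    have mg := adapted_measurable FF ag.
    rewrite mul1e; apply: le_trans (hZ 0%N _ kn ag g0).
    apply: le_eint => [| |x|x].
    - by mfun.
    - by mfun.
    - by rewrite !mulr_ge0 ?powR_ge0.
    - rewrite ler_wpM2r// -(mulr_powRB1 (t0 0%N x) q0) -mulrA ler_wpM2l//.
      by rewrite mulrC ler_wpM2l ?powR_ge0// ge_min lexx.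
  (* This increment is nonnegative and F_(k+1)-measurable, hence an admissible test function for
     Z_(k+1). *)
  pose g x := c x * (t k.+1 x `^ (q - 1) - t k x `^ (q - 1)).
  have tk x : t k x <= t k.+1 x.
    by rewrite le_min !ge_min lexx orbT andbT/= /M rmax_nd.
  have g0 x : 0 <= g x.
    by rewrite mulr_ge0// subr_ge0 ge0_ler_powR ?nnegrE ?(ltW q10).
  have ag : adapted k.+1 g.
    apply: (measurable_funM (ac k.+1)); apply: measurable_funB.
      by apply: measurable_fun_powR; exact: at_.
    by apply: measurable_fun_powR; apply: (adapted_le FF (leqnSn k)); exact: at_.
  have mg := adapted_measurable FF ag.
  have eG : G k.+1 = (G k + eint P (fun x => (g x * phi x)%R))%E.
    rewrite -eintD; [|by mfun|by mfun|by move=> x; rewrite !mulr_ge0 ?powR_ge0|by move=> x; rewrite mulr_ge0].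
    by apply: eq_eint => x; rewrite /g; ring.
  rewrite eG ge0_muleDr//; last by apply: eint_ge0 => x; rewrite mulr_ge0.
  have gp0 : (0 <= eint P (fun x => (g x * phi x)%R))%E by apply: eint_ge0 => x; rewrite mulr_ge0.
  apply: (@le_trans _ _ (E k + (q / (q - 1))%:E * eint P (fun x => (g x * Z k.+1 x * v x)%R))%E); last first.
    apply: leeD; first exact/IH/ltnW.
    by rewrite lee_wpmul2l ?lee_fin ?(ltW q'0)//; exact: hZ.
  have gZv0 x : 0 <= g x * Z k.+1 x * v x by apply: mulr_ge0 => //; exact: mulr_ge0.
  rewrite -eintZ ?(ltW q'0)//; [|by mfun].
  rewrite -eintD; [|by mfun|by mfun|by move=> x; rewrite !mulr_ge0 ?powR_ge0|
    by move=> x; rewrite mulr_ge0 ?gZv0 ?(ltW q'0)].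
  apply: le_eint => [| |x|x]; [by mfun|by mfun|by rewrite !mulr_ge0 ?powR_ge0|].
  suff h : t k.+1 x `^ q <= t k x `^ q +
      q / (q - 1) * ((t k.+1 x `^ (q - 1) - t k x `^ (q - 1)) * Z k.+1 x).
    have := ler_wpM2r (v0' x) (ler_wpM2l (c0 x) h).
    by congr (_ <= _); rewrite /g; ring.
  (* The truncated maximum can grow only where Z_(k+1) exceeds M_k, and there it is at most Z_(k+1);
     so Z_(k+1) may replace it as a factor of the increment. *)
  case: (leP (Z k.+1 x) (M k x)) => ZM.
    have -> : t k.+1 x = t k x by rewrite /t /M /= max_l.
    by rewrite subrr !mul0r mulr0 addr0.
  have tE : t k.+1 x = Num.min (Z k.+1 x) L by rewrite /t /M /= max_r// ltW.
  have := powR_increment q1 (t0 k x) (t0 k.+1 x).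
  have dt : 0 <= t k.+1 x `^ (q - 1) - t k x `^ (q - 1).
    by rewrite subr_ge0 ge0_ler_powR ?nnegrE ?(ltW q10).
  have : (t k.+1 x `^ (q - 1) - t k x `^ (q - 1)) * t k.+1 x <=
         (t k.+1 x `^ (q - 1) - t k x `^ (q - 1)) * Z k.+1 x.
    by rewrite ler_wpM2l// tE ge_min lexx.
  move=> /(ler_wpM2l (ltW q'0)).
  have e : t k.+1 x `^ q = t k.+1 x * t k.+1 x `^ (q - 1) by rewrite mulr_powRB1.
  rewrite {2}e; lra.
have Efin : E n \is a fin_num.
  rewrite ge0_fin_numE; last by apply: eint_ge0 => x; rewrite !mulr_ge0 ?powR_ge0.
  apply: (@le_lt_trans _ _ (eint P (fun x => (c x * L `^ q * v x)%R))).
    apply: le_eint => [| |x|x]; [by mfun|by mfun|by rewrite !mulr_ge0 ?powR_ge0|].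
    rewrite ler_wpM2r// ler_wpM2l// ge0_ler_powR ?nnegrE ?(ltW q0)//.
    by rewrite ge_min lexx orbT.
  rewrite -ev0//; last 2 first.
  - by apply: (measurable_funM (ac 0%N)).
  - by move=> x; rewrite mulr_ge0 ?powR_ge0.
  apply: (@le_lt_trans _ _ (eint P (fun=> L `^ q * L))); last by rewrite eint_cst ltry.
  have mv0 := adapted_measurable FF av0.
  apply: le_eint => [| |x|x]; [by mfun|by []|by rewrite !mulr_ge0 ?powR_ge0// ltW|].
  rewrite /c /cutoff; case: ifPn => h; last by rewrite !mul0r mulr_ge0 ?powR_ge0.
  by rewrite mul1r ler_wpM2l ?powR_ge0.
pose B := eint P (fun x => (phi x `^ q * v x `^ (1 - q))%R).
have mphiq : measurable_fun setT (fun x => phi x `^ q) by exact: measurable_fun_powR.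
have mvq r : measurable_fun setT (fun x => v x `^ r) by exact: measurable_fun_powR.
have B0 : (0 <= B)%E by apply: eint_ge0 => x; rewrite mulr_ge0 ?powR_ge0.
change (E n <= (2 * C)%:E * B)%E.
have : (E n <= (2^-1)%:E * E n + C%:E * B)%E.
  apply: (le_trans (EG n (leqnn n))).
  rewrite -!eintZ ?(ltW q'0)//; (try by mfun); (try by move=> x; rewrite !mulr_ge0 ?powR_ge0).
  rewrite -eintD; [|by mfun|by mfun|by move=> x; rewrite !mulr_ge0 ?powR_ge0|
    by move=> x; rewrite !mulr_ge0 ?powR_ge0].
  apply: le_eint => [| |x|x]; [by mfun|by mfun|by apply: mulr_ge0; [exact: ltW|rewrite !mulr_ge0 ?powR_ge0]|].
  (* Inserting v^s v^(-s) = 1 before Young's inequality makes the two powers come out as t^q v and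
     phi^q v^(1-q). *)
  pose s := (q - 1) / q.
  have := hC (mulr_ge0 (powR_ge0 (t n x) (q - 1)) (powR_ge0 (v x) s))
             (mulr_ge0 (phi0 x) (powR_ge0 (v x) (- s))).
  rewrite !powRM ?powR_ge0// -!powRrM.
  have -> : (q - 1) * (q / (q - 1)) = q by field; rewrite gt_eqF.
  have -> : s * (q / (q - 1)) = 1 by rewrite /s; field; rewrite !gt_eqF.
  have -> : - s * q = 1 - q by rewrite /s; field; rewrite gt_eqF.
  rewrite powRr1// powRN.
  have vs : v x `^ s != 0 by rewrite gt_eqF// powR_gt0.
  have -> : q / (q - 1) * (t n x `^ (q - 1) * v x `^ s) * (phi x * (v x `^ s)^-1) =
     q / (q - 1) * (t n x `^ (q - 1) * phi x).
    by field; rewrite vs gt_eqF.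
  move=> /(ler_wpM2l (c0 x)).
  have : c x * (C * (phi x `^ q * v x `^ (1 - q))) <= C * (phi x `^ q * v x `^ (1 - q)).
    by rewrite -[leRHS]mul1r ler_wpM2r// mulr_ge0// mulr_ge0 ?powR_ge0.
  rewrite mulrDr => h1 h2.
  rewrite (_ : q / (q - 1) * _ = c x * (q / (q - 1) * (t n x `^ (q - 1) * phi x))); last by ring.
  apply: le_trans h2 _; rewrite lerD// le_eqVlt; apply/orP; left; apply/eqP; ring.
(* Since 0 times +oo is 0, the case of infinite [B] with C = 0 is separate: there the finite [E n]
   is at most half of itself. *)
have [->|Bfin] := eqVneq B +oo%E.
  have [->|Cn] := eqVneq C 0; last first.
    by move=> _; rewrite gt0_muley ?leey// lte_fin mulr_gt0// lt_neqAle eq_sym Cn.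
  rewrite mul0e adde0 mulr0 mul0e -(fineK Efin) -EFinM !lee_fin; lra.
have Bf : B \is a fin_num by rewrite ge0_fin_numE// ltey.
rewrite -(fineK Efin) -(fineK Bf) -!EFinM -EFinD !lee_fin; lra.
Unshelve. all: by end_near. Qed.

End maximal.

(** * From chosen conditional expectations to positive versions *)

Section versions.
Context d (T : measurableType d) (R : realType) (P : probability T R).
Variable F : nat -> set (set T).
Hypothesis FF : is_filtration F.
Notation adapted := (@adapted d T R F).
Notation pos_version := (@pos_version d T R P F).

Section cexp.
Variables (u : T -> R) (k : nat).
Hypotheses (mu : measurable_fun setT u) (u0 : forall x, 0 <= u x).
Let Eu := cexp_ge0 P (F k) (EFin \o u).

Let sF : sigma_algebra setT (F k). Proof. by case: FF. Qed.
Let FT : F k `<=` measurable. Proof. by case: FF. Qed.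

Lemma filtration_cexp : is_cexp_ge0 P (F k) (EFin \o u) Eu.
Proof. exact: is_cexp_ge0_ex. Qed.

Lemma cexp_measurableG : measurable_fun [set: g_sigma_algebraType (F k)] Eu.
Proof. by case: filtration_cexp. Qed.

Lemma cexp_measurable : measurable_fun [set: T] Eu.
Proof. exact: (measurable_sub sF FT cexp_measurableG). Qed.

Lemma cexp_nonneg x : (0 <= Eu x)%E.
Proof. by case: filtration_cexp. Qed.

Lemma integral_cexp_testing phi : adapted k phi -> (forall x, 0 <= phi x) ->
  (\int[P]_x ((phi x)%:E * Eu x) = eint P (fun x => (phi x * u x)%R))%E.
Proof.
move=> aphi phi0; case: filtration_cexp => _ _ h.
rewrite (integral_densityM sF FT cexp_measurable cexp_nonneg _ _ h aphi phi0)//.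
exact/measurable_EFinP.
Qed.

Lemma pos_version_cexp g : adapted k g -> (forall x, 0 < g x) ->
  {ae P, forall x, (g x)%:E = Eu x} -> pos_version u k g.
Proof.
move=> ag g0 gE; split => // phi aphi phi0; rewrite -integral_cexp_testing//.
have mphi := adapted_measurable FF aphi; have mg := adapted_measurable FF ag.
have mE := cexp_measurable.
apply: ge0_ae_eq_integral => //.
- by apply/measurable_EFinP; exact: measurable_funM.
- by apply: emeasurable_funM => //; exact/measurable_EFinP.
- by move=> x _; rewrite lee_fin mulr_ge0// ltW.
- by move=> x _; rewrite mule_ge0 ?lee_fin ?cexp_nonneg.
- by apply: filterS gE => x gx _; rewrite EFinM gx.
Qed.

(** Stated with a test function because [u] may fail to be integrable; letting [phi] run through
    cutoffs that exhaust the space still gives finiteness almost everywhere. *)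
Lemma cexp_ae_fin phi : adapted k phi -> (forall x, 0 <= phi x) ->
  (eint P (fun x => (phi x * u x)%R) < +oo)%E ->
  {ae P, forall x, 0 < phi x -> (Eu x < +oo)%E}.
Proof.
move=> aphi phi0; rewrite -integral_cexp_testing// => fin.
have mphi := adapted_measurable FF aphi; have mE := cexp_measurable.
have : P.-integrable setT (fun x => (phi x)%:E * Eu x)%E.
  apply/integrableP; split.
    by apply: emeasurable_funM => //; exact/measurable_EFinP.
  under eq_integral => x _ do rewrite gee0_abs ?mule_ge0 ?lee_fin ?cexp_nonneg//.
  by [].
move/(integrable_ae measurableT); apply: filterS => x /(_ I) h px.
rewrite ltey; apply/negP => /eqP Ex; move: h.
by rewrite Ex gt0_muley.
Qed.

End cexp.

(** The zero set of the conditional expectation lies in F_k, so [u] has integral 0 over it; as u > 0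
    it is a null set. *)
Lemma cexp_ae_gt0 (u : T -> R) k : measurable_fun setT u -> (forall x, 0 < u x) ->
  {ae P, forall x, (0 < cexp_ge0 P (F k) (EFin \o u) x)%E}.
Proof.
move=> mu u0; have u0' x : 0 <= u x := ltW (u0 x).
pose Eu := cexp_ge0 P (F k) (EFin \o u).
have [_ E0 hE] := filtration_cexp k mu u0'.
have mE := cexp_measurable k mu u0'.
have sF : sigma_algebra setT (F k) by case: FF.
pose B := [set x | Eu x = 0%E].
have FB : F k B.
  apply/(sub_measurableG sF).
  rewrite -[X in measurable X]setTI.
  exact: (cexp_measurableG mu u0' measurableT (emeasurable_set1 0%E)).
have mB : measurable B by case: FF => _ h _; exact: h FB.
have B0 : (\int[P]_(x in B) `|(EFin \o u) x|)%E = 0%E.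
  transitivity (\int[P]_(x in B) (EFin \o u) x)%E.
    by apply: eq_integral => x _; rewrite gee0_abs// lee_fin.
  rewrite -hE//; apply: integral0_eq => x Bx; exact: Bx.
have : ae_eq P B (EFin \o u) (cst 0%E).
  apply/(ae_eq_integral_abs P mB) => //.
  by apply: measurable_funTS; exact/measurable_EFinP.
apply: filterS => x h; rewrite lt_neqAle E0 andbT eq_sym; apply/negP => /eqP Bx.
by have [ux] := h Bx; have := u0 x; rewrite ux ltxx.
Qed.

Lemma pos_version_ex (u : T -> R) k : measurable_fun setT u -> (forall x, 0 < u x) ->
  (eint P u < +oo)%E -> exists g, pos_version u k g.
Proof.
move=> mu u0 fin; have u0' x : 0 <= u x := ltW (u0 x).
pose Eu := cexp_ge0 P (F k) (EFin \o u).
have mG := @cexp_measurableG u k mu u0'.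
(* [fine] sends +oo to 0, so one test rejects both exceptional values; the value 1 on that null set
   keeps the version positive and adapted. *)
exists (fun x => if (0 < fine (Eu x))%R then fine (Eu x) else 1).
apply: pos_version_cexp => //.
- have mf : measurable_fun [set: g_sigma_algebraType (F k)] (fine \o Eu).
    by apply: measurableT_comp.
  by apply: measurable_fun_ifT => //; exact: measurable_fun_ltr.
- by move=> x; case: ifPn.
have h1 := cexp_ae_gt0 k mu u0.
have h2 := @cexp_ae_fin u k mu u0' (fun=> 1) (measurable_cst _) (fun=> ler01).
have {}h2 := h2 _.
have /h2 {}h2 : (eint P (fun x => (1 * u x)%R) < +oo)%E.
  by rewrite (_ : eint _ _ = eint P u)//; apply: eq_eint => x; rewrite mul1r.
near=> x.
have E0 : (0 < Eu x)%E by near: x.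
have Efin : Eu x \is a fin_num.
  rewrite ge0_fin_numE ?(ltW E0)//.
  have : (0 < 1 :> R) -> (Eu x < +oo)%E by near: x.
  by apply; exact: ltr01.
have f0 : 0 < fine (Eu x) by rewrite -lte_fin fineK.
by rewrite f0 fineK.
Unshelve. all: by end_near. Qed.

(** Turns a bound known only in tested form into one valid at every point. The set where g > b is
    null, because g - b has integral at most 0 over it; hence the minimum is still a version. *)
Lemma pos_version_min (u : T -> R) k (g b : T -> R) : measurable_fun setT u -> (eint P u < +oo)%E -> (forall x, 0 <= u x) ->
  pos_version u k g -> adapted k b -> (forall x, 0 < b x) ->
  (forall phi, adapted k phi -> (forall x, 0 <= phi x) ->
    (eint P (fun x => (phi x * u x)%R) <= eint P (fun x => (phi x * b x)%R))%E) ->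
  pos_version u k (fun x => Num.min (g x) (b x)).
Proof.
move=> mu ufin u0 [ag g0 eg] ab b0 ub.
pose c x : R := if g x <= b x then 0 else 1.
have ac : adapted k c by apply: measurable_fun_ifT => //; exact: (measurable_fun_ler ag ab).
have c0 x : 0 <= c x by rewrite /c; case: ifP.
have mc := adapted_measurable FF ac.
have mg := adapted_measurable FF ag.
have mb := adapted_measurable FF ab.
have d0 x : 0 <= c x * (g x - b x).
  by rewrite /c; case: ifPn => h; rewrite ?mul0r// mul1r subr_ge0 ltW// ltNge.
have md : measurable_fun setT (fun x => c x * (g x - b x)) by mfun.
have cb0 x : 0 <= c x * b x by rewrite mulr_ge0// ltW.
have mcb : measurable_fun setT (fun x => c x * b x) by mfun.
have fin : (eint P (fun x => (c x * g x)%R) < +oo)%E.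
  rewrite eg//; apply: le_lt_trans ufin; apply: le_eint => [| |x|x]; [by mfun|by []|by rewrite mulr_ge0|].
  by rewrite /c; case: ifP; rewrite ?mul0r ?mul1r.
have eD : eint P (fun x => (c x * g x)%R) =
   (eint P (fun x => (c x * b x)%R) + eint P (fun x => (c x * (g x - b x))%R))%E.
  by rewrite -eintD//; apply: eq_eint => x; ring.
have bfin : eint P (fun x => (c x * b x)%R) \is a fin_num.
  rewrite ge0_fin_numE; last exact: eint_ge0.
  by apply: le_lt_trans fin; rewrite eD leeDl// eint_ge0.
have D0 : eint P (fun x => (c x * (g x - b x))%R) = 0%E.
  apply/eqP; rewrite eq_le eint_ge0// andbT.
  have := ub c ac c0; rewrite -eg// eD -[leRHS]adde0 leeD2lE//.
have gb : {ae P, forall x, g x <= b x}.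
  have : ae_eq P setT (EFin \o (fun x => c x * (g x - b x))) (cst 0%E).
    apply/(ae_eq_integral_abs P measurableT); first exact/measurable_EFinP.
    by rewrite -[RHS]D0; apply: eq_integral => x _; rewrite gee0_abs// lee_fin.
  apply: filterS => x /(_ I)[]; rewrite /c; case: ifPn => // h /eqP.
  by rewrite mul1r subr_eq0 => /eqP e; move: h; rewrite e lexx.
have am : adapted k (fun x => Num.min (g x) (b x)) by exact: (measurable_minr ag ab).
split => //; first by move=> x; rewrite lt_min g0 b0.
move=> phi aphi phi0; rewrite -eg//.
have mphi := adapted_measurable FF aphi.
have mm := adapted_measurable FF am.
apply: ge0_ae_eq_integral => //.
- by apply/measurable_EFinP; exact: measurable_funM.
- by apply/measurable_EFinP; exact: measurable_funM.
- by move=> x _; rewrite lee_fin mulr_ge0// le_min !ltW.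
- by move=> x _; rewrite lee_fin mulr_ge0// ltW.
- by apply: filterS gb => x h _; rewrite min_l.
Qed.

End versions.

(** * A fixed choice of Doob's constant *)

Section doob_const.
Variables (R : realType) (q : R).

Lemma doob_young_ex : 1 < q -> exists2 C : R, 0 <= C & forall a b : R, 0 <= a -> 0 <= b ->
  q / (q - 1) * a * b <= 2^-1 * a `^ (q / (q - 1)) + C * b `^ q.
Proof.
move=> q1; have q0 : 0 < q := lt_trans ltr01 q1.
have q10 : 0 < q - 1 by rewrite subr_gt0.
apply: young_ex => //; rewrite ?divr_ge0 ?divr_gt0 ?invr_gt0 ?(ltW q0) ?(ltW q10)//.
by field; rewrite !gt_eqF.
Qed.

(** Chosen as a function of [q] alone, so that constants built from it do not depend on the
    probability space; 0 is the default for q <= 1. *)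
Definition doob_const : R :=
  if pselect (1 < q) is left q1 then 2 * s2val (cid2 (doob_young_ex q1)) else 0.

Lemma doob_const_ge0 : 0 <= doob_const.
Proof.
by rewrite /doob_const; case: pselect => // q1; rewrite mulr_ge0//; exact: s2valP (cid2 (doob_young_ex q1)).
Qed.

End doob_const.

(** * Maximal functions for the measures w dP and sg dP *)

Section weighted.
Context d (T : measurableType d) (R : realType) (P : probability T R).
Variable F : nat -> set (set T).
Hypothesis FF : is_filtration F.
Notation adapted := (@adapted d T R F).
Notation pos_version := (@pos_version d T R P F).

Lemma doob q (v v0 phi : T -> R) (Z : nat -> T -> R) n : 1 < q ->
  measurable_fun setT v -> (forall x, 0 < v x) -> pos_version v 0 v0 ->
  measurable_fun setT phi -> (forall x, 0 <= phi x) ->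
  (forall k, adapted k (Z k)) -> (forall k x, 0 <= Z k x) ->
  (forall k g, (k <= n)%N -> adapted k g -> (forall x, 0 <= g x) ->
    (eint P (fun x => (g x * Z k x * v x)%R) <= eint P (fun x => (g x * phi x)%R))%E) ->
  (eint P (fun x => (rmax Z n x `^ q * v x)%R) <=
   (doob_const q)%:E * eint P (fun x => (phi x `^ q * v x `^ (1 - q))%R))%E.
Proof.
move=> q1; rewrite /doob_const; case: pselect => // q1'.
by case: (cid2 _) => C C0 hC /=; exact: doob_maximal.
Qed.

Lemma measurable_rmax (Z : nat -> T -> R) n :
  (forall k, measurable_fun setT (Z k)) -> measurable_fun setT (rmax Z n).
Proof. by move=> mZ; elim: n => [|n IH] //=; exact: measurable_maxr. Qed.

Lemma pos_version_cst1 k : pos_version (fun=> 1) k (fun=> 1).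
Proof. by split => // ; exact: measurable_cst. Qed.

(** Doob in L^2 for [P] itself. By Jensen r_k^(-th) is at most the conditional expectation of
    rho^(-th), and W_k is at most the running maximum, so the process is dominated by conditional
    expectations of the function on the right. *)
Lemma square_jensen_maximal th (rho : T -> R) (r_ W : nat -> T -> R) n : 0 <= th ->
  measurable_fun setT rho -> (forall x, 0 < rho x) ->
  (forall k, pos_version rho k (r_ k)) ->
  (forall k, adapted k (W k)) -> (forall k x, 0 <= W k x) ->
  (eint P (fun x => (rmax (fun k x => W k x * r_ k x `^ (- th)) n x ^+ 2)%R) <=
   (doob_const 2)%:E * eint P (fun x => ((rmax W n x * rho x `^ (- th)) ^+ 2)%R))%E.
Proof.
move=> th0 mrho rho0 vr aW W0.
have mW k := adapted_measurable FF (aW k).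
have mp : measurable_fun setT (fun x => rho x `^ (- th)) by exact: measurable_fun_powR.
have Ws0 x : 0 <= rmax W n x by exact: rmax_ge0.
have mWs : measurable_fun setT (rmax W n) by exact: measurable_rmax.
have Z0 k x : 0 <= W k x * r_ k x `^ (- th) by rewrite mulr_ge0// powR_ge0.
have := @doob 2 (fun=> 1) (fun=> 1) (fun x => rmax W n x * rho x `^ (- th))
  (fun k x => W k x * r_ k x `^ (- th)) n.
have -> : eint P (fun x => (rmax (fun k x => W k x * r_ k x `^ (- th)) n x `^ 2 * 1)%R) =
  eint P (fun x => (rmax (fun k x => W k x * r_ k x `^ (- th)) n x ^+ 2)%R).
  by apply: eq_eint => x; rewrite mulr1 powR_mulrn// rmax_ge0.
have -> : eint P (fun x => ((rmax W n x * rho x `^ (- th)) `^ 2 * 1 `^ (1 - 2))%R) =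
   eint P (fun x => ((rmax W n x * rho x `^ (- th)) ^+ 2)%R).
  by apply: eq_eint => x; rewrite powR1 mulr1 powR_mulrn// mulr_ge0 ?powR_ge0.
apply => //.
- by rewrite (_ : 1 = 1%:R)// ltr_nat.
- exact: pos_version_cst1.
- exact: measurable_funM.
- by move=> x; rewrite mulr_ge0// powR_ge0.
- move=> k; apply: (measurable_funM (aW k)); apply: measurable_fun_powR.
  by case: (vr k).
- move=> k g kn ag g0; have mg := adapted_measurable FF ag.
  apply: (@le_trans _ _ (eint P (fun x => (g x * W k x * rho x `^ (- th))%R))).
    apply: (@le_trans _ _ (eint P (fun x => (g x * W k x * r_ k x `^ (- th))%R))).
      by rewrite le_eqVlt; apply/orP; left; apply/eqP/eq_eint => x; ring.
    (* [jensen_powR] asks for th > 0. The value th = 0, which occurs for p = 3, makes both powers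
       equal to 1. *)
    move: th0; rewrite le_eqVlt => /predU1P[<-|th0].
      by rewrite le_eqVlt; apply/orP; left; apply/eqP/eq_eint => x; rewrite oppr0 !powRr0.
    apply: (jensen_powR FF th0 mrho rho0 (vr k) (measurable_funM ag (aW k))) => x.
    by rewrite mulr_ge0.
  apply: le_eint => [| |x|x]; [by mfun|by mfun|by rewrite !mulr_ge0 ?powR_ge0|].
  by rewrite mulrA ler_wpM2r ?powR_ge0// ler_wpM2l// rmax_ge.
Qed.

Variables (p : R) (w f : T -> R) (w_ s_ f_ : nat -> T -> R) (eps Q : R).
Hypotheses (p1 : 1 < p) (mw : measurable_fun setT w) (mf : measurable_fun setT f)
  (w0 : forall x, 0 < w x) (f0 : forall x, 0 < f x) (eps0 : 0 < eps)
  (f_eps : forall k x, eps <= f_ k x) (Q0 : 0 < Q)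
  (wfin : (eint P w < +oo)%E).
Let sg x := w x `^ (1 - p)^-1.
Hypotheses (vw : forall k, pos_version w k (w_ k)) (vs : forall k, pos_version sg k (s_ k))
  (vf : forall k, pos_version f k (f_ k)).
Hypothesis wsQ : forall k x, w_ k x * s_ k x `^ (p - 1) <= Q.

Let X k x := f_ k x / s_ k x.
Let p10 : 0 < p - 1. Proof. by rewrite subr_gt0. Qed.
Let p0 : 0 < p. Proof. exact: lt_trans ltr01 p1. Qed.
Let sg0 x : 0 < sg x. Proof. exact: powR_gt0. Qed.
Let msg : measurable_fun setT sg. Proof. exact: measurable_fun_powR. Qed.
Let f_0 k x : 0 < f_ k x. Proof. by case: (vf k). Qed.
Let s_0 k x : 0 < s_ k x. Proof. by case: (vs k). Qed.
Let w_0 k x : 0 < w_ k x. Proof. by case: (vw k). Qed.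
Let af k : adapted k (f_ k). Proof. by case: (vf k). Qed.
Let as_ k : adapted k (s_ k). Proof. by case: (vs k). Qed.
Let aw k : adapted k (w_ k). Proof. by case: (vw k). Qed.
Let X0 k x : 0 < X k x. Proof. by rewrite divr_gt0. Qed.
Let aX k : adapted k (X k).
Proof. by apply: (measurable_fun_div _ (@af k) (@as_ k)) => x; exact: ltW. Qed.
Let f_E k x : f_ k x = X k x * s_ k x.
Proof. by rewrite divfK// gt_eqF. Qed.

(** The hypothesis of Doob's inequality holds with equality because f_k = X_k s_k, and its
    right-hand side is f^p w because sg^(1-p) = w. *)
Lemma maximal_sigma n : (eint P (fun x => (rmax X n x `^ p * sg x)%R) <=
  (doob_const p)%:E * eint P (fun x => (f x `^ p * w x)%R))%E.
Proof.
have -> : eint P (fun x => (f x `^ p * w x)%R) = eint P (fun x => (f x `^ p * sg x `^ (1 - p))%R).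
  apply: eq_eint => x; rewrite /sg -powRrM mulVf ?powRr1//; first exact: ltW.
  by rewrite subr_eq0 eq_sym gt_eqF.
apply: (doob p1 msg sg0 (vs 0%N) mf) => //.
- by move=> x; exact: ltW.
- by move=> k x; exact: ltW.
move=> k g kn ag g0; have [_ _ es] := vs k; have [_ _ ef] := vf k.
rewrite -es.
- rewrite -ef//; rewrite le_eqVlt; apply/orP; left; apply/eqP/eq_eint => x.
  by rewrite f_E mulrA.
- exact: (measurable_funM ag (@aX k)).
- by move=> x; rewrite mulr_ge0// ltW.
Qed.

Let pn1 : p - 1 != 0. Proof. by rewrite gt_eqF. Qed.
Let pn2 : 1 - p != 0. Proof. by rewrite lt_eqF// subr_lt0. Qed.
Let mf_ k : measurable_fun setT (f_ k). Proof. exact: (adapted_measurable FF (@af k)). Qed.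
Let mw_ k : measurable_fun setT (w_ k). Proof. exact: (adapted_measurable FF (@aw k)). Qed.
Let ms_ k : measurable_fun setT (s_ k). Proof. exact: (adapted_measurable FF (@as_ k)). Qed.
Let mX k : measurable_fun setT (X k). Proof. exact: (adapted_measurable FF (@aX k)). Qed.

Lemma sigma_version_le k x : s_ k x <= Q `^ (p - 1)^-1 * w_ k x `^ (- (p - 1)^-1).
Proof.
have h : s_ k x `^ (p - 1) <= Q * (w_ k x)^-1.
  by rewrite -[leRHS]/(Q / w_ k x) ler_pdivlMr// mulrC wsQ.
have sE : s_ k x = (s_ k x `^ (p - 1)) `^ (p - 1)^-1.
  by rewrite -powRrM divff ?gt_eqF// powRr1// ltW.
have e : w_ k x `^ (- (p - 1)^-1) = (w_ k x)^-1 `^ (p - 1)^-1.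
  by rewrite -(powR_inv1 (ltW (@w_0 k x))) -powRrM mulN1r.
rewrite sE e -powRM ?(ltW Q0) ?invr_ge0 ?(ltW (@w_0 k x))//.
by rewrite ge0_ler_powR ?invr_ge0 ?(ltW p10)// nnegrE ?powR_ge0// mulr_ge0 ?invr_ge0// ltW.
Qed.

(** * The case p <= 2 *)

Section small_exponent.
Variable n : nat.
Hypothesis p2 : p <= 2.
Let q' := p / (p - 1).
Let H x := rmax f_ n x.
Let Z k x := X k x `^ (p - 1) / w_ k x.
Let Xs := rmax X n.

Let Xs0 x : 0 < Xs x. Proof. exact: rmax_gt0. Qed.
Let Z0 k x : 0 <= Z k x. Proof. by rewrite divr_ge0 ?powR_ge0 ?(ltW (@w_0 _ _)). Qed.
Let H_eps x : eps <= H x. Proof. exact: le_trans (f_eps 0%N x) (rmax_ge _ _ (leq0n n)). Qed.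
Let H0 x : 0 < H x. Proof. exact: lt_le_trans eps0 (H_eps x). Qed.
Let mH : measurable_fun setT H. Proof. exact: measurable_rmax. Qed.
Let mXs : measurable_fun setT Xs. Proof. exact: measurable_rmax. Qed.
Let mZ k : measurable_fun setT (Z k).
Proof. by apply: measurable_fun_div => //; [move=> x; exact: ltW|exact: measurable_fun_powR]. Qed.
Let Qq0 : 0 < Q `^ q'. Proof. exact: powR_gt0. Qed.

(** Doob for w dP with exponent q'. The A_p condition gives f_k^(p-1) <= Q Z_k, and Z_k w_k =
    X_k^(p-1) is at most (max X)^(p-1), whose q'-th power times w^(1-q') is (max X)^p sg. *)
Lemma maximal_le2 : (eint P (fun x => (H x `^ p * w x)%R) <=
  (Q `^ q' * doob_const q')%:E * eint P (fun x => (Xs x `^ p * sg x)%R))%E.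
Proof.
have q'1 : 1 < q' by rewrite /q' ltr_pdivlMr// mul1r gtrBl.
have HZ x : H x `^ p <= Q `^ q' * rmax Z n x `^ q'.
  have Zs0 : 0 <= rmax Z n x by exact: rmax_ge0.
  have -> : Q `^ q' * rmax Z n x `^ q' = (Q `^ (p - 1)^-1 * rmax Z n x `^ (p - 1)^-1) `^ p.
    by rewrite powRM ?powR_ge0// -!powRrM (_ : (p - 1)^-1 * p = q')// mulrC.
  rewrite ge0_ler_powR ?(ltW p0) ?nnegrE ?(ltW (H0 _)) ?mulr_ge0 ?powR_ge0//.
  apply: rmax_le => k kn.
  rewrite f_E; apply: (le_trans (ler_wpM2l (ltW (X0 k x)) (sigma_version_le k x))).
  rewrite mulrCA ler_wpM2l ?powR_ge0//.
  have -> : X k x * w_ k x `^ (- (p - 1)^-1) = Z k x `^ (p - 1)^-1.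
    rewrite /Z powRM ?powR_ge0 ?invr_ge0 ?(ltW (@w_0 _ _))// -powRrM divff ?gt_eqF//.
    rewrite powRr1 ?(ltW (@X0 _ _))//; congr (_ * _).
    by rewrite -(powR_inv1 (ltW (@w_0 k x))) -powRrM mulN1r.
  by rewrite ge0_ler_powR ?invr_ge0 ?(ltW p10) ?nnegrE//; exact: rmax_ge.
have mZs : measurable_fun setT (rmax Z n) by exact: measurable_rmax.
have mHp : measurable_fun setT (fun x => H x `^ p) by exact: measurable_fun_powR.
have mZq : measurable_fun setT (fun x => rmax Z n x `^ q') by exact: measurable_fun_powR.
have w0' x : 0 <= w x := ltW (w0 x).
apply: (@le_trans _ _ (eint P (fun x => (Q `^ q' * (rmax Z n x `^ q' * w x))%R))).
  apply: le_eint => [| |x|x]; [by mfun|by mfun|by rewrite mulr_ge0 ?powR_ge0|].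
  by rewrite mulrA ler_wpM2r.
rewrite eintZ ?(ltW Qq0)//; [|by mfun|by move=> x; rewrite mulr_ge0 ?powR_ge0].
rewrite EFinM -muleA; apply: lee_wpmul2l; first by rewrite lee_fin ltW.
have -> : eint P (fun x => (Xs x `^ p * sg x)%R) =
    eint P (fun x => ((Xs x `^ (p - 1)) `^ q' * w x `^ (1 - q'))%R).
  apply: eq_eint => x; rewrite -powRrM /sg; congr (_ `^ _ * _ `^ _).
    by rewrite /q'; field; rewrite gt_eqF.
  by rewrite /q'; field; rewrite !subr_eq0 [1 == p]eq_sym gt_eqF.
apply: (doob q'1 mw w0 (vw 0%N)) => //.
- exact: measurable_fun_powR.
- by move=> x; exact: powR_ge0.
- move=> k; apply: measurable_fun_div (@aw k) => //; first by move=> x; exact: ltW.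
  by apply: measurable_fun_powR; exact: aX.
- move=> k g kn ag g0; have mg := adapted_measurable FF ag; have [_ _ ew] := vw k.
  have az : adapted k (fun x => g x * Z k x).
    apply: (measurable_funM ag); apply: (measurable_fun_div _ _ (@aw k)).
      by move=> x; exact: ltW.
    by apply: measurable_fun_powR; exact: aX.
  rewrite -ew//; last by move=> x; rewrite mulr_ge0.
  have mXp (Y : T -> R) : measurable_fun setT Y -> measurable_fun setT (fun x => Y x `^ (p - 1)).
    by move=> mY; exact: measurable_fun_powR.
  apply: le_eint => [| |x|x].
  + by apply: measurable_funM => //; exact: (adapted_measurable FF az).
  + by apply: measurable_funM => //; exact: mXp.
  + by apply: mulr_ge0; [exact: mulr_ge0|exact: ltW].
  + rewrite /Z -mulrA divfK ?gt_eqF// ler_wpM2l// ge0_ler_powR ?(ltW p10) ?nnegrE ?(ltW (@X0 _ _)) ?(ltW (Xs0 _))//.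
    exact: rmax_ge.
Qed.

Lemma square_le2 : (eint P (fun x => (sqsum f_ n x `^ (p / 2) * w x)%R) <=
  ((4 / bellman_const * doob_const 2 + doob_const q') * doob_const p * Q `^ q')%:E *
  eint P (fun x => (f x `^ p * w x)%R))%E.
Proof.
pose u x := H x `^ (p - 2) * w x.
have p2' : p - 2 <= 0 by rewrite subr_le0.
have w0' x : 0 <= w x := ltW (w0 x).
have u0 x : 0 < u x by rewrite mulr_gt0// powR_gt0.
have u0' x : 0 <= u x := ltW (u0 x).
have mpow (Y : T -> R) r : measurable_fun setT Y -> measurable_fun setT (fun x => Y x `^ r).
  by move=> mY; exact: measurable_fun_powR.
have mu : measurable_fun setT u by apply: measurable_funM => //; exact: mpow.
have pown (a b : R) : 0 < a -> a <= b -> b `^ (p - 2) <= a `^ (p - 2).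
  move=> a0 ab; rewrite -(opprB 2 p) !powRN.
  have b0 := lt_le_trans a0 ab.
  by rewrite lef_pV2 ?posrE ?powR_gt0// ge0_ler_powR ?subr_ge0 ?nnegrE// ltW.
(* As p - 2 <= 0, it is the lower bound H >= eps that makes [u] integrable. *)
have ufin : (eint P u < +oo)%E.
  apply: (@le_lt_trans _ _ (eint P (fun x => (eps `^ (p - 2) * w x)%R))).
    apply: le_eint => //; first by mfun.
    by move=> x; rewrite ler_wpM2r//; exact: pown.
  rewrite eintZ ?powR_ge0//; apply: lte_mul_pinfty => //.
  by rewrite lee_fin powR_ge0.
(* Since H >= f_k for k <= n and p - 2 <= 0, the conditional expectation of [u] is at most w_k
   f_k^(p-2); taking the minimum with this bound makes it hold everywhere. *)
have /choice[u_ uP] : forall k, exists g, pos_version u k g /\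
    ((k <= n)%N -> forall x, g x <= w_ k x * f_ k x `^ (p - 2)).
  move=> k; have [g vg] := pos_version_ex FF k mu u0 ufin.
  have [kn|kn] := leqP k n; last by exists g; split.
  exists (fun x => Num.min (g x) (w_ k x * f_ k x `^ (p - 2))); split; last first.
    by move=> _ x; rewrite ge_min lexx orbT.
  apply: pos_version_min => //.
  - by apply: (measurable_funM (@aw k)); apply: measurable_fun_powR; exact: af.
  - by move=> x; rewrite mulr_gt0// powR_gt0.
  move=> phi aphi phi0; have mphi := adapted_measurable FF aphi.
  have [_ _ ew] := vw k.
  have -> : eint P (fun x => (phi x * (w_ k x * f_ k x `^ (p - 2)))%R) =
      eint P (fun x => (phi x * f_ k x `^ (p - 2) * w_ k x)%R).
    by apply: eq_eint => x; ring.
  rewrite ew; last 2 first.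
  - by apply: (measurable_funM aphi); apply: measurable_fun_powR; exact: af.
  - by move=> x; rewrite mulr_ge0 ?powR_ge0.
  have mfp := mpow _ (p - 2) (@mf_ k).
  apply: le_eint => [| |x|x]; [by mfun|by mfun|by rewrite mulr_ge0|].
  rewrite mulrA ler_wpM2r// ler_wpM2l//; apply: pown => //.
  exact: rmax_ge.
have vu k : pos_version u k (u_ k) := (uP k).1.
have mS : measurable_fun setT (sqsum f_ n).
  apply: measurable_funD; first exact: measurable_funX.
  by apply: measurable_sum => i; apply: measurable_funX; exact: measurable_funB.
have S0 x : 0 < sqsum f_ n x.
  apply: (@lt_le_trans _ _ (f_ 0%N x ^+ 2)); first by rewrite exprn_gt0.
  by rewrite lerDl sumr_ge0// => i _; exact: sqr_ge0.
have S0' x : 0 <= sqsum f_ n x := ltW (S0 x).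
have [c0 c1] := bellman_const_itv R.
pose EX := eint P (fun x => (Xs x `^ p * sg x)%R).
have EX0 : (0 <= EX)%E by apply: eint_ge0 => x; rewrite mulr_ge0 ?powR_ge0.
have EXf : (EX <= (doob_const p)%:E * eint P (fun x => (f x `^ p * w x)%R))%E.
  exact: maximal_sigma.
have split : (eint P (fun x => (sqsum f_ n x `^ (p / 2) * w x)%R) <=
   eint P (fun x => (sqsum f_ n x * u x)%R) + eint P (fun x => (H x `^ p * w x)%R))%E.
  have mHp := mpow H p mH; have mSp := mpow _ (p / 2) mS.
  rewrite -eintD; [|by mfun|by mfun|by move=> x; rewrite mulr_ge0|by move=> x; rewrite mulr_ge0 ?powR_ge0].
  apply: le_eint => [| |x|x]; [by mfun|by mfun|by rewrite mulr_ge0 ?powR_ge0|].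
  rewrite /u mulrA -mulrDl ler_wpM2r//.
  case: (leP (sqsum f_ n x) (H x ^+ 2)) => h.
    apply: (@le_trans _ _ (H x `^ p)); last by rewrite lerDr mulr_ge0 ?powR_ge0.
    have -> : H x `^ p = (H x ^+ 2) `^ (p / 2).
      by rewrite -powR_mulrn ?(ltW (H0 x))// -powRrM; congr powR; field.
    by rewrite ge0_ler_powR ?divr_ge0 ?(ltW p0) ?nnegrE ?exprn_ge0 ?(ltW (H0 _)).
  apply: (@le_trans _ _ (sqsum f_ n x * H x `^ (p - 2))); last by rewrite lerDl powR_ge0.
  have -> : sqsum f_ n x `^ (p / 2) = sqsum f_ n x * (Num.sqrt (sqsum f_ n x)) `^ (p - 2).
    rewrite -powR12_sqrt// -powRrM -{2}(powRr1 (S0' x)) -powRD; last by rewrite (gt_eqF (S0 x)) implybT.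
    by congr powR; field.
  rewrite ler_wpM2l//; apply: pown => //.
  by rewrite -[leLHS]ger0_norm ?(ltW (H0 _))// -sqrtr_sqr ler_wsqrtr// ltW.
have bell := bellman_integral FF mf mu u0 vf vu n.
(* The A_p condition gives f_k^p w_k <= Q^q' X_k^p w_k^(-1/(p-1)). Halving the exponents writes the
   right-hand side as Q^q' times the square of W_k w_k^(-th), ready for Doob in L^2; and w^(-2 th) =
   sg. *)
pose th := (2 * (p - 1))^-1.
pose W k x := X k x `^ (p / 2).
have W0 k x : 0 <= W k x by exact: powR_ge0.
have aW k : adapted k (W k) by apply: measurable_fun_powR; exact: aX.
have mW k := adapted_measurable FF (aW k).
have th0 : 0 <= th by rewrite invr_ge0 mulr_ge0// ltW.
have jen := @square_jensen_maximal th w w_ W n th0 mw w0 vw aW W0.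
have fu k x : (k <= n)%N -> f_ k x ^+ 2 * u_ k x <= Q `^ q' * (W k x * w_ k x `^ (- th)) ^+ 2.
  move=> kn; have [_ /(_ kn x) ub] := uP k.
  have fp : f_ k x ^+ 2 * (w_ k x * f_ k x `^ (p - 2)) = f_ k x `^ p * w_ k x.
    rewrite -powR_mulrn ?(ltW (@f_0 _ _))// mulrCA -powRD; last by rewrite (gt_eqF (@f_0 _ _)) implybT.
    by rewrite mulrC; congr (_ `^ _ * _); ring.
  apply: (@le_trans _ _ (f_ k x `^ p * w_ k x)); first by rewrite -fp ler_wpM2l// sqr_ge0.
  have -> : (W k x * w_ k x `^ (- th)) ^+ 2 = X k x `^ p * w_ k x `^ (- (p - 1)^-1).
    rewrite exprMn -!powR_mulrn ?powR_ge0// -!powRrM; congr (_ `^ _ * _ `^ _); first by field.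
    by rewrite /th; field; rewrite gt_eqF.
  rewrite f_E powRM ?(ltW (@X0 _ _)) ?(ltW (@s_0 _ _))// -mulrA [leRHS]mulrCA ler_wpM2l ?powR_ge0//.
  have h : s_ k x `^ p <= (Q `^ (p - 1)^-1 * w_ k x `^ (- (p - 1)^-1)) `^ p.
    rewrite ge0_ler_powR ?(ltW p0) ?nnegrE ?mulr_ge0 ?powR_ge0 ?(ltW (@s_0 _ _))//.
    exact: sigma_version_le.
  apply: (le_trans (ler_wpM2r (ltW (w_0 k x)) h)).
  rewrite powRM ?powR_ge0// -!powRrM -mulrA.
  have -> : (p - 1)^-1 * p = q' by rewrite mulrC.
  rewrite ler_wpM2l ?powR_ge0// -{2}(powRr1 (ltW (w_0 k x))) -powRD; last by rewrite (gt_eqF (@w_0 _ _)) implybT.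
  rewrite le_eqVlt; apply/orP; left; apply/eqP; congr powR.
  by field; rewrite gt_eqF.
have mfu k : measurable_fun setT (fun x => f_ k x ^+ 2 * u_ k x).
  apply: measurable_funM; first exact: measurable_funX.
  by case: (vu k) => /(adapted_measurable FF).
have mWw k : measurable_fun setT (fun x => W k x * w_ k x `^ (- th)).
  by apply: measurable_funM => //; exact: mpow.
have Ww0 k x : 0 <= W k x * w_ k x `^ (- th) by rewrite mulr_ge0 ?powR_ge0.
have mfw : measurable_fun setT (fun x => f x `^ p * w x).
  by apply: measurable_funM => //; exact: mpow.
have bound1 : (eint P (rmax (fun k x => (f_ k x ^+ 2 * u_ k x)%R) n) <=
   (Q `^ q')%:E * ((doob_const 2)%:E * EX))%E.
  apply: (@le_trans _ _ (eint P (fun x => (Q `^ q' * rmax (fun k x => W k x * w_ k x `^ (- th)) n x ^+ 2)%R))).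
    apply: le_eint.
    - exact: measurable_rmax.
    - by apply: measurable_funM => //; apply: measurable_funX; exact: measurable_rmax.
    - move=> x; apply: rmax_ge0 => k; rewrite mulr_ge0 ?sqr_ge0//.
      by case: (vu k) => _ h _; exact: ltW.
    - move=> x; apply: rmax_le => k kn; apply: (le_trans (fu k x kn)).
      rewrite ler_wpM2l ?(ltW Qq0)// lerXn2r ?nnegrE//; first exact: rmax_ge0.
      exact: (rmax_ge (fun k x => W k x * w_ k x `^ (- th))).
  rewrite eintZ ?(ltW Qq0)//; last 2 first.
  - by apply: measurable_funX; exact: measurable_rmax.
  - by move=> x; exact: sqr_ge0.
  apply: lee_wpmul2l; first by rewrite lee_fin ltW.
  apply: (le_trans jen); apply: lee_wpmul2l; first by rewrite lee_fin doob_const_ge0.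
  have Wle x : rmax W n x <= Xs x `^ (p / 2).
    apply: rmax_le => k kn; rewrite ge0_ler_powR ?divr_ge0 ?(ltW p0) ?nnegrE ?(ltW (@X0 _ _)) ?(ltW (Xs0 _))//.
    exact: rmax_ge.
  apply: le_eint => [| |x|x].
  - by apply: measurable_funX; apply: measurable_funM; [exact: measurable_rmax|exact: mpow].
  - by apply: measurable_funM => //; exact: mpow.
  - exact: sqr_ge0.
  - rewrite exprMn (_ : (w x `^ (- th)) ^+ 2 = sg x); last first.
      rewrite -powR_mulrn ?powR_ge0// -powRrM /sg; congr powR; rewrite /th.
      by field; rewrite ?pn1 ?pn2.
    rewrite ler_wpM2r ?(ltW (@sg0 _))// (_ : Xs x `^ p = (Xs x `^ (p / 2)) ^+ 2).
      rewrite lerXn2r ?nnegrE ?powR_ge0//; exact: rmax_ge0.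
    by rewrite -powR_mulrn ?powR_ge0// -powRrM; congr powR; field.
have D0 r : 0 <= doob_const r :> R by exact: doob_const_ge0.
have b0 : 0 <= 4 / bellman_const :> R by rewrite divr_ge0// ltW.
apply: (le_trans split).
apply: (@le_trans _ _ (((4 / bellman_const * doob_const 2 + doob_const q') * Q `^ q')%:E * EX)%E).
  rewrite mulrDl EFinD ge0_muleDl ?lee_fin ?mulr_ge0 ?powR_ge0 ?invr_ge0 ?(ltW c0)//.
  apply: leeD; last by rewrite [_ * Q `^ _]mulrC; exact: maximal_le2.
  apply: (le_trans bell).
  rewrite (_ : 4 / bellman_const * doob_const 2 * Q `^ q' =
    4 / bellman_const * (Q `^ q' * doob_const 2)); last by ring.
  rewrite [X in (_ <= X * _)%E]EFinM -muleA; apply: lee_wpmul2l; first by rewrite lee_fin.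
  by rewrite EFinM -muleA.
rewrite (_ : (4 / bellman_const * doob_const 2 + doob_const q') * doob_const p * Q `^ q' =
  (4 / bellman_const * doob_const 2 + doob_const q') * Q `^ q' * doob_const p); last by ring.
rewrite [X in (_ <= X * _)%E]EFinM -muleA; apply: lee_wpmul2l => //.
by rewrite lee_fin mulr_ge0 ?powR_ge0// addr_ge0// mulr_ge0.
Qed.

End small_exponent.

(** * The case p > 2 *)

Section large_exponent.
Variables (rho : T -> R) (r_ : nat -> T -> R) (th kap C : R) (n : nat).
Let q := p / (p - 2).
Hypotheses (p2 : 2 < p) (th0 : 0 <= th) (mrho : measurable_fun setT rho)
  (rho0 : forall x, 0 < rho x) (vr : forall k, pos_version rho k (r_ k))
  (hr : forall k x, s_ k x ^+ 2 * w_ k x <= Q `^ kap * (r_ k x `^ (- th)) ^+ 2)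
  (hrho : forall x, (rho x `^ (- th)) ^+ 2 = sg x `^ (2 / p) * w x `^ ((p - 2) / p))
  (C0 : 0 <= C)
  (hC : forall a b : R, 0 <= a -> 0 <= b ->
    4 / bellman_const * doob_const 2 * a * b <=
    (2 * (doob_const q + 1))^-1 * a `^ q + C * b `^ (p / 2)).
Let Xs := rmax X n.
Let Xs0 x : 0 < Xs x. Proof. exact: rmax_gt0. Qed.
Let mXs : measurable_fun setT Xs. Proof. exact: measurable_rmax. Qed.
Let Qk0 : 0 < Q `^ kap. Proof. exact: powR_gt0. Qed.

(** [rho] will be w for p <= 3 and sg for p > 3. [hr] is what the A_p condition yields in each case,
    and [hrho] identifies the function left after Jensen, in a form that splits between the two
    factors of Young's inequality. *)
Lemma square_gt2 : (eint P (fun x => (sqsum f_ n x `^ (p / 2) * w x)%R) <=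
  (2 * C * doob_const p * Q `^ (kap * (p / 2)))%:E *
  eint P (fun x => (f x `^ p * w x)%R))%E.
Proof.
have p20 : 0 < p - 2 by rewrite subr_gt0.
have pn0 : p != 0 by rewrite gt_eqF.
have pn3 : p - 2 != 0 by rewrite gt_eqF.
have ph0 : 0 < p / 2 by rewrite divr_gt0.
have q1 : 1 < q by rewrite /q ltr_pdivlMr// mul1r gtrBl.
have w0' x : 0 <= w x := ltW (w0 x).
have mpow (Y : T -> R) r : measurable_fun setT Y -> measurable_fun setT (fun x => Y x `^ r).
  by move=> mY; exact: measurable_fun_powR.
have mS : measurable_fun setT (sqsum f_ n).
  apply: measurable_funD; first exact: measurable_funX.
  by apply: measurable_sum => i; apply: measurable_funX; exact: measurable_funB.
have S0 x : 0 < sqsum f_ n x.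
  apply: (@lt_le_trans _ _ (f_ 0%N x ^+ 2)); first by rewrite exprn_gt0.
  by rewrite lerDl sumr_ge0// => i _; exact: sqr_ge0.
have S0' x : 0 <= sqsum f_ n x := ltW (S0 x).
(* The truncation makes the left-hand side finite, hence absorbable; the levels j + 1 keep the
   truncated square function positive. *)
apply: (@eint_monotone _ _ _ _ (fun j x => Num.min (sqsum f_ n x) j.+1%:R `^ (p / 2) * w x)).
- by move=> j; apply: measurable_funM => //; apply: mpow; exact: measurable_minr.
- by move=> j x; rewrite mulr_ge0 ?powR_ge0.
- move=> x i j ij; rewrite ler_wpM2r// ge0_ler_powR ?(ltW ph0) ?nnegrE ?le_min ?S0' ?ler0n//.
  by rewrite !ge_min lexx/= ler_nat ltnS ij orbT.
- move=> x; apply: filterS (cutoff_near1 (sqsum f_ n) x) => j hj.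
  by rewrite min_l// (le_trans hj)// ler_nat.
move=> j; set L : R := j.+1%:R.
have L0 : 0 < L by rewrite ltr0n.
pose S' x := Num.min (sqsum f_ n x) L.
have S'0 x : 0 < S' x by rewrite lt_min S0.
have mS' : measurable_fun setT S' by exact: measurable_minr.
pose h x := S' x `^ ((p - 2) / 2).
have ph20 : 0 < (p - 2) / 2 by rewrite divr_gt0.
have h0 x : 0 < h x by exact: powR_gt0.
have mh : measurable_fun setT h by exact: mpow.
pose u x := h x * w x.
have u0 x : 0 < u x by rewrite mulr_gt0.
have u0' x : 0 <= u x := ltW (u0 x).
have mu : measurable_fun setT u by exact: measurable_funM.
have ufin : (eint P u < +oo)%E.
  apply: (@le_lt_trans _ _ (eint P (fun x => (L `^ ((p - 2) / 2) * w x)%R))).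
    apply: le_eint => //; first by mfun.
    move=> x; rewrite ler_wpM2r// ge0_ler_powR ?(ltW ph20) ?nnegrE ?(ltW (S'0 _)) ?(ltW L0)//.
    by rewrite ge_min lexx orbT.
  rewrite eintZ ?powR_ge0//; apply: lte_mul_pinfty => //.
  by rewrite lee_fin powR_ge0.
pose I := eint P (fun x => (S' x `^ (p / 2) * w x)%R).
have mSp : measurable_fun setT (fun x => S' x `^ (p / 2)) by exact: mpow.
have I0 : (0 <= I)%E by apply: eint_ge0 => x; rewrite mulr_ge0 ?powR_ge0.
have Ifin : I \is a fin_num.
  rewrite (ge0_fin_numE I0); apply: (@le_lt_trans _ _ (eint P (fun x => (L `^ (p / 2) * w x)%R))).
    apply: le_eint => [| |x|x]; [by mfun|by mfun|by rewrite mulr_ge0 ?powR_ge0|].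
    rewrite ler_wpM2r// ge0_ler_powR ?(ltW ph0) ?nnegrE ?(ltW (S'0 _)) ?(ltW L0)//.
    by rewrite ge_min lexx orbT.
  rewrite eintZ ?powR_ge0//; apply: lte_mul_pinfty => //.
  by rewrite lee_fin powR_ge0.
have /choice[u_ vu] : forall k, exists g, pos_version u k g.
  by move=> k; exact: (pos_version_ex FF).
have u_0 k x : 0 < u_ k x by case: (vu k).
have au k : adapted k (u_ k) by case: (vu k).
(* Y_k is the conditional expectation of [h] for the measure w dP, and h^q is the truncated p-th
   power of the square function. Doob thus bounds max Y by [I] itself, the quantity to be
   absorbed. *)
pose Y k x := u_ k x / w_ k x.
have Y0 k x : 0 < Y k x by rewrite divr_gt0.
have aY k : adapted k (Y k).
  by apply: (measurable_fun_div _ (au k) (@aw k)) => x; exact: ltW.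
have mY k := adapted_measurable FF (aY k).
pose Ys := rmax Y n.
have Ys0 x : 0 < Ys x by exact: rmax_gt0.
have mYs : measurable_fun setT Ys by exact: measurable_rmax.
have Ys0' x : 0 <= Ys x := ltW (Ys0 x).
have [c0 c1] := bellman_const_itv R.
have D0 r : 0 <= doob_const r :> R by exact: doob_const_ge0.
have b0 : 0 <= 4 / bellman_const :> R by rewrite divr_ge0// ltW.
pose EX := eint P (fun x => (Xs x `^ p * sg x)%R).
have EX0 : (0 <= EX)%E by apply: eint_ge0 => x; rewrite mulr_ge0 ?powR_ge0.
have EXf : (EX <= (doob_const p)%:E * eint P (fun x => (f x `^ p * w x)%R))%E.
  exact: maximal_sigma.
have EY : (eint P (fun x => (Ys x `^ q * w x)%R) <= (doob_const q)%:E * I)%E.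
  have -> : I = eint P (fun x => (u x `^ q * w x `^ (1 - q))%R).
    apply: eq_eint => x; rewrite /u powRM ?(ltW (h0 x))// -mulrA -powRD; last first.
      by rewrite (gt_eqF (w0 x)) implybT.
    rewrite addrC subrK powRr1// /h -powRrM; congr (_ `^ _ * _).
    by rewrite /q; field.
  apply: (doob q1 mw w0 (vw 0%N)) => //; first by move=> k x; exact: ltW.
  move=> k g kn ag g0; have [_ _ ew] := vw k; have [_ _ eu] := vu k.
  rewrite -ew; last 2 first.
  - exact: (measurable_funM ag (aY k)).
  - by move=> x; rewrite mulr_ge0// ltW.
  rewrite -eu// le_eqVlt; apply/orP; left; apply/eqP/eq_eint => x.
  by rewrite -mulrA divfK// gt_eqF.
have bell := bellman_integral FF mf mu u0 vf vu n.
pose W k x := X k x * Y k x `^ 2^-1.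
have W0 k x : 0 <= W k x by rewrite mulr_ge0 ?powR_ge0// ltW.
have aW k : adapted k (W k).
  by apply: (measurable_funM (@aX k)); apply: measurable_fun_powR; exact: aY.
have mW k := adapted_measurable FF (aW k).
have jen := @square_jensen_maximal th rho r_ W n th0 mrho rho0 vr aW W0.
have sq (y : R) : 0 <= y -> (y `^ 2^-1) ^+ 2 = y.
  by move=> y0; rewrite -powR_mulrn ?powR_ge0// -powRrM mulVf// powRr1.
have fu k x : f_ k x ^+ 2 * u_ k x <= Q `^ kap * (W k x * r_ k x `^ (- th)) ^+ 2.
  have -> : f_ k x ^+ 2 * u_ k x = X k x ^+ 2 * Y k x * (s_ k x ^+ 2 * w_ k x).
    by rewrite f_E /Y; field; rewrite gt_eqF.
  have -> : (W k x * r_ k x `^ (- th)) ^+ 2 = X k x ^+ 2 * Y k x * (r_ k x `^ (- th)) ^+ 2.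
    by rewrite -[in RHS](sq (Y k x) (ltW (Y0 k x))) /W; ring.
  have XY : 0 <= X k x ^+ 2 * Y k x by rewrite mulr_ge0 ?sqr_ge0// ltW.
  by apply: (le_trans (ler_wpM2l XY (hr k x))); rewrite mulrCA.
have mr_ k : measurable_fun setT (r_ k) by case: (vr k) => /(adapted_measurable FF).
have mfu k : measurable_fun setT (fun x => f_ k x ^+ 2 * u_ k x).
  apply: measurable_funM; first exact: measurable_funX.
  exact: (adapted_measurable FF (au k)).
have mWr k : measurable_fun setT (fun x => W k x * r_ k x `^ (- th)).
  by apply: measurable_funM => //; exact: mpow.
have Wr0 k x : 0 <= W k x * r_ k x `^ (- th) by rewrite mulr_ge0 ?powR_ge0.
(* The exponents q and p/2 are conjugate, a^q = (max Y)^q w, and b^(p/2) is a power of Q times (max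
   X)^p sg. *)
pose a x := Ys x * w x `^ ((p - 2) / p).
pose b x := Q `^ kap * (Xs x ^+ 2 * sg x `^ (2 / p)).
have a0 x : 0 <= a x by rewrite mulr_ge0 ?powR_ge0.
have b0' x : 0 <= b x.
  by apply: mulr_ge0; [exact: powR_ge0|apply: mulr_ge0; [exact: sqr_ge0|exact: powR_ge0]].
have ma : measurable_fun setT a by apply: measurable_funM => //; exact: mpow.
have mb : measurable_fun setT b.
  apply: measurable_funM => //; apply: measurable_funM; first exact: measurable_funX.
  exact: mpow.
have ab0 x : 0 <= a x * b x by rewrite mulr_ge0.
have bound1 : (eint P (rmax (fun k x => (f_ k x ^+ 2 * u_ k x)%R) n) <=
   (doob_const 2)%:E * eint P (fun x => (a x * b x)%R))%E.
  apply: (@le_trans _ _ (eint P (fun x => (Q `^ kap * rmax (fun k x => W k x * r_ k x `^ (- th)) n x ^+ 2)%R))).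
    apply: le_eint.
    - exact: measurable_rmax.
    - by apply: measurable_funM => //; apply: measurable_funX; exact: measurable_rmax.
    - by move=> x; apply: rmax_ge0 => k; rewrite mulr_ge0 ?sqr_ge0// ltW.
    - move=> x; apply: rmax_le => k kn; apply: (le_trans (fu k x)).
      rewrite ler_wpM2l ?(ltW Qk0)// lerXn2r ?nnegrE//; first exact: rmax_ge0.
      exact: (rmax_ge (fun k x => W k x * r_ k x `^ (- th))).
  rewrite eintZ ?(ltW Qk0)//; last 2 first.
  - by apply: measurable_funX; exact: measurable_rmax.
  - by move=> x; exact: sqr_ge0.
  apply: (@le_trans _ _ ((Q `^ kap)%:E * ((doob_const 2)%:E *
      eint P (fun x => ((rmax W n x * rho x `^ (- th)) ^+ 2)%R)))%E).
    by apply: lee_wpmul2l => //; rewrite lee_fin ltW.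
  have mrt : measurable_fun setT (fun x => (rmax W n x * rho x `^ (- th)) ^+ 2).
    by apply: measurable_funX; apply: measurable_funM; [exact: measurable_rmax|exact: mpow].
  rewrite muleCA; apply: lee_wpmul2l; first by rewrite lee_fin.
  rewrite -(eintZ _ (ltW Qk0) mrt); last by move=> x; exact: sqr_ge0.
  have Wle x : rmax W n x ^+ 2 <= Xs x ^+ 2 * Ys x.
    rewrite -(sq (Ys x) (Ys0' x)) -exprMn; apply: le_expn; first exact: rmax_ge0.
    apply: rmax_le => k kn; rewrite ler_pM ?powR_ge0 ?(ltW (X0 _ _))//; first exact: rmax_ge.
    rewrite ge0_ler_powR ?invr_ge0 ?nnegrE ?(ltW (Y0 _ _))//; exact: rmax_ge.
  apply: le_eint => [| |x|x]; [by apply: measurable_funM|by mfun|by rewrite mulr_ge0 ?sqr_ge0 ?(ltW Qk0)|].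
  rewrite exprMn hrho.
  have -> : a x * b x = Q `^ kap * (Xs x ^+ 2 * Ys x * (sg x `^ (2 / p) * w x `^ ((p - 2) / p))).
    by rewrite /a /b; ring.
  by rewrite ler_wpM2l ?(ltW Qk0)// ler_wpM2r// mulr_ge0 ?powR_ge0.
have SI : (I <= eint P (fun x => (sqsum f_ n x * u x)%R))%E.
  apply: le_eint => [| |x|x]; [by mfun|by mfun|by rewrite mulr_ge0 ?powR_ge0|].
  rewrite /u mulrA ler_wpM2r//.
  have -> : S' x `^ (p / 2) = S' x * h x.
    rewrite /h -{2}(powRr1 (ltW (S'0 x))) -powRD; last by rewrite (gt_eqF (S'0 x)) implybT.
    by congr powR; field.
  by rewrite ler_wpM2r ?(ltW (h0 _))// ge_min lexx.
(* With this value eta times Doob's constant is at most 1/2; the added 1 excludes a division by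
   0. *)
pose eta : R := (2 * (doob_const q + 1))^-1.
have Dq1 : 0 < 2 * (doob_const q + 1) :> R by rewrite mulr_gt0// ltr_wpDl.
have eta0 : 0 < eta by rewrite invr_gt0.
have K0 : 0 <= 4 / bellman_const * doob_const 2 :> R by rewrite mulr_ge0.
have main : (I <= (2^-1)%:E * I + (C * Q `^ (kap * (p / 2)))%:E * EX)%E.
  apply: (le_trans SI); apply: (le_trans bell).
  apply: (@le_trans _ _ ((4 / bellman_const)%:E * ((doob_const 2)%:E * eint P (fun x => (a x * b x)%R)))%E).
    by apply: lee_wpmul2l => //; rewrite lee_fin.
  rewrite muleA -EFinM -eintZ//; last by mfun.
  have mYq : measurable_fun setT (fun x => Ys x `^ q * w x).
    by apply: measurable_funM => //; exact: mpow.
  have mXp : measurable_fun setT (fun x => Xs x `^ p * sg x).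
    by apply: measurable_funM => //; exact: mpow.
  have Yq0 x : 0 <= Ys x `^ q * w x by rewrite mulr_ge0 ?powR_ge0.
  have Xp0 x : 0 <= Xs x `^ p * sg x by rewrite mulr_ge0 ?powR_ge0 ?(ltW (@sg0 _)).
  have CQ0 : 0 <= C * Q `^ (kap * (p / 2)) by rewrite mulr_ge0 ?powR_ge0.
  apply: (@le_trans _ _ (eint P (fun x => (eta * (Ys x `^ q * w x) +
      C * Q `^ (kap * (p / 2)) * (Xs x `^ p * sg x))%R))).
    apply: le_eint => [| |x|x].
    - by apply: measurable_funM => //; mfun.
    - by apply: measurable_funD; apply: measurable_funM.
    - by rewrite mulr_ge0.
    - have := hC (a0 x) (b0' x).
      have -> : a x `^ q = Ys x `^ q * w x.
        rewrite /a powRM ?powR_ge0// -powRrM; congr (_ * _).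
        by rewrite (_ : (p - 2) / p * q = 1) ?powRr1// /q; field; rewrite pn0 pn3.
      have -> : b x `^ (p / 2) = Q `^ (kap * (p / 2)) * (Xs x `^ p * sg x).
        have Xq0 : 0 <= Xs x ^+ 2 by exact: sqr_ge0.
        rewrite /b powRM ?powR_ge0//; last by rewrite mulr_ge0 ?powR_ge0.
        rewrite (powRM _ Xq0 (powR_ge0 _ _)) -(powRrM Q) -(powRrM (sg x)).
        rewrite -powR_mulrn ?(ltW (Xs0 _))// -(powRrM (Xs x)).
        have -> : 2 / p * (p / 2) = 1 by field.
        have -> : 2 * (p / 2) = p by field.
        by rewrite powRr1// ltW.
      by rewrite !mulrA.
  rewrite eintD; [|by mfun|by mfun|by move=> x; rewrite mulr_ge0 ?(ltW eta0)|by move=> x; rewrite mulr_ge0].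
  rewrite (eintZ _ (ltW eta0) mYq Yq0) (eintZ _ CQ0 mXp Xp0); apply: leeD; last exact: lexx.
  apply: (@le_trans _ _ (eta%:E * ((doob_const q)%:E * I))%E).
    by apply: lee_wpmul2l => //; rewrite lee_fin ltW.
  rewrite muleA -EFinM; apply: lee_wpmul2r => //.
  rewrite lee_fin /eta mulrC ler_pdivrMr// mulrA mulVf// mul1r lerDl.
  exact: ler01.
have final : (I <= (2 * C * Q `^ (kap * (p / 2)))%:E * EX)%E.
  have CQ0 : 0 <= C * Q `^ (kap * (p / 2)) by rewrite mulr_ge0 ?powR_ge0.
  have [EXoo|EXn] := eqVneq EX +oo%E.
    rewrite EXoo in main *; move: CQ0; rewrite le_eqVlt => /predU1P[CQ|CQ].
      move: main; rewrite -CQ mul0e adde0 -(fineK Ifin) -EFinM lee_fin => main.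
      rewrite -mulrA -CQ mulr0 mul0e lee_fin; lra.
    by rewrite gt0_muley ?leey// lte_fin -mulrA mulr_gt0.
  have Ef : EX \is a fin_num by rewrite ge0_fin_numE// ltey.
  move: main; rewrite -(fineK Ifin) -(fineK Ef) -!EFinM -EFinD !lee_fin; lra.
apply: (le_trans final).
rewrite (_ : 2 * C * doob_const p * Q `^ (kap * (p / 2)) =
  2 * C * Q `^ (kap * (p / 2)) * doob_const p); last by ring.
rewrite [X in (_ <= X * _)%E]EFinM -muleA; apply: lee_wpmul2l; last exact: EXf.
by rewrite lee_fin !mulr_ge0 ?powR_ge0.
Qed.

End large_exponent.

End weighted.

(** * The estimate for positive functions and all p > 1 *)

Section core.
Variables (R : realType) (p : R).
Hypothesis p1 : 1 < p.
Let kappa : R := Num.max 2^-1 (p - 1)^-1.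

(** Spaces, weights and functions are quantified after [C], which expresses that it depends on p
    alone. *)
Definition core_bound (C : R) := forall d (T : measurableType d) (P : probability T R)
  (F : nat -> set (set T)) (w f : T -> R) (w_ s_ f_ : nat -> T -> R) (eps Q : R) (n : nat),
  is_filtration F ->
  measurable_fun setT w -> measurable_fun setT f ->
  (forall x, 0 < w x) -> (forall x, 0 < f x) -> 0 < eps ->
  (forall k x, eps <= f_ k x) -> 0 < Q -> (eint P w < +oo)%E ->
  (forall k, pos_version P F w k (w_ k)) ->
  (forall k, pos_version P F (fun x => w x `^ (1 - p)^-1) k (s_ k)) ->
  (forall k, pos_version P F f k (f_ k)) ->
  (forall k x, w_ k x * s_ k x `^ (p - 1) <= Q) ->
  (eint P (fun x => (sqsum f_ n x `^ (p / 2) * w x)%R) <=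
   (C * Q `^ (p * kappa))%:E * eint P (fun x => (f x `^ p * w x)%R))%E.

Let p10 : 0 < p - 1. Proof. by rewrite subr_gt0. Qed.
Let p0 : 0 < p. Proof. exact: lt_trans ltr01 p1. Qed.
Let pn0 : p != 0. Proof. by rewrite gt_eqF. Qed.
Let pn1 : p - 1 != 0. Proof. by rewrite gt_eqF. Qed.
Let pn2 : 1 - p != 0. Proof. by rewrite lt_eqF// subr_lt0. Qed.

Let kappa_le3 : p <= 3 -> kappa = (p - 1)^-1.
Proof.
move=> p3; rewrite /kappa max_r// lef_pV2 ?posrE//.
by rewrite lerBlDr (_ : 2 + 1 = 3)//; ring.
Qed.

Let kappa_gt3 : 3 < p -> kappa = 2^-1.
Proof.
move=> p3; rewrite /kappa max_l// lef_pV2 ?posrE//.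
by rewrite lerBrDr (_ : 2 + 1 = 3) ?ltW//; ring.
Qed.

Let young_large : 2 < p -> exists2 C : R, 0 <= C & forall a b : R, 0 <= a -> 0 <= b ->
    4 / bellman_const * doob_const 2 * a * b <=
    (2 * (doob_const (p / (p - 2)) + 1))^-1 * a `^ (p / (p - 2)) + C * b `^ (p / 2).
Proof.
move=> p2; have p20 : 0 < p - 2 by rewrite subr_gt0.
have [c0 _] := bellman_const_itv R.
apply: young_ex.
- by rewrite mulr_ge0 ?doob_const_ge0// divr_ge0// ltW.
- by rewrite invr_gt0 mulr_gt0// ltr_wpDl// doob_const_ge0.
- by rewrite divr_gt0.
- by rewrite divr_gt0.
- by field; rewrite pn0 gt_eqF.
Qed.

Lemma core_estimate : exists2 C, 0 <= C & core_bound C.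
Proof.
have [c0 _] := bellman_const_itv R.
have D0 r : 0 <= doob_const r :> R by exact: doob_const_ge0.
have [p2|p2] := leP p 2.
  exists ((4 / bellman_const * doob_const 2 + doob_const (p / (p - 1))) * doob_const p).
    by rewrite mulr_ge0// addr_ge0// mulr_ge0// divr_ge0// ltW.
  move=> d T P F w f w_ s_ f_ eps Q n FF mw mf w0 f0 e0 fe Q0 wfin vw vs vf wsQ.
  rewrite kappa_le3; last by rewrite (le_trans p2)// ler_nat.
  exact: (square_le2 FF p1 mw mf w0 f0 e0 fe Q0 wfin vw vs vf wsQ).
have [C C0 hC] := young_large p2.
exists (2 * C * doob_const p); first by rewrite !mulr_ge0.
move=> d T P F w f w_ s_ f_ eps Q n FF mw mf w0 f0 e0 fe Q0 wfin vw vs vf wsQ.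
have w_0 k x : 0 < w_ k x by case: (vw k).
have s_0 k x : 0 < s_ k x by case: (vs k).
have expo x : w x `^ (1 - p)^-1 `^ (2 / p) * w x `^ ((p - 2) / p) = w x `^ ((p - 3) / (p - 1)).
  rewrite -powRrM -powRD; last by rewrite (gt_eqF (w0 x)) implybT.
  by congr powR; field; rewrite pn0 pn1 pn2.
have [p3|p3] := leP p 3.
  (* Squaring s_k <= (Q / w_k)^(1/(p-1)) and multiplying by w_k leaves Q^(2/(p-1))
     w_k^((p-3)/(p-1)); this dictates [th] and the power of Q. *)
  rewrite kappa_le3// (_ : p / (p - 1) = 2 / (p - 1) * (p / 2)); last by field.
  apply: (square_gt2 (rho := w) (r_ := w_) (th := (3 - p) / (2 * (p - 1))) FF p1 mw mf w0 f0 Q0 wfin vw vs vf n p2) => //.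
  - by rewrite divr_ge0 ?mulr_ge0 ?subr_ge0// ltW.
  - move=> k x; have := sigma_version_le p1 Q0 vw vs wsQ k x.
    move=> /(le_expn 2 (ltW (s_0 k x))) /(ler_wpM2r (ltW (w_0 k x))).
    move=> /le_trans; apply; rewrite exprMn -!powR_mulrn ?powR_ge0// -!powRrM.
    rewrite -mulrA -{2}(powRr1 (ltW (w_0 k x))) -powRD; last by rewrite (gt_eqF (w_0 k x)) implybT.
    rewrite le_eqVlt; apply/orP; left; apply/eqP; congr (_ `^ _ * _ `^ _); first by field.
    by field.
  - move=> x; rewrite expo -powR_mulrn ?powR_ge0// -powRrM; congr powR.
    by field.
rewrite kappa_gt3// [X in Q `^ X](_ : _ = 1 * (p / 2)); last by rewrite mul1r.
have msg : measurable_fun setT (fun x => w x `^ (1 - p)^-1) by exact: measurable_fun_powR.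
(* Here s_k^2 w_k = (w_k s_k^(p-1)) s_k^(3-p) costs a single factor Q, whence the exponent 1/2 in
   the norm estimate. *)
apply: (square_gt2 (r_ := s_) (th := (p - 3) / 2) FF p1 mw mf w0 f0 Q0 wfin vw vs vf n p2 _ msg) => //.
- by rewrite divr_ge0// subr_ge0 ltW.
- by move=> x; exact: powR_gt0.
- move=> k x; rewrite powRr1 ?(ltW Q0)//.
  have -> : s_ k x ^+ 2 * w_ k x = w_ k x * s_ k x `^ (p - 1) * (s_ k x `^ (- ((p - 3) / 2))) ^+ 2.
    rewrite -!powR_mulrn ?powR_ge0 ?(ltW (s_0 k x))// -powRrM -mulrA -powRD; last by rewrite (gt_eqF (s_0 k x)) implybT.
    by rewrite mulrC; congr (_ * _ `^ _); field.
  by rewrite ler_wpM2r ?sqr_ge0.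
- move=> x; rewrite expo -powR_mulrn ?powR_ge0// -!powRrM; congr powR.
  by field; rewrite pn1 pn2.
Qed.

End core.

(** * Everywhere valid versions for an A_p weight *)

Section link.
Context d (T : measurableType d) (R : realType) (P : probability T R).
Variable F : nat -> set (set T).
Hypothesis FF : is_filtration F.
Notation adapted := (@adapted d T R F).
Notation pos_version := (@pos_version d T R P F).

(* The predicate defining E[h | G] only involves the integrals of h over G, so two functions with
   the same integrals have the very same chosen version. *)
Lemma eq_cexp_ge0 G (h h' : T -> \bar R) :
  (forall A, G A -> (\int[P]_(x in A) h x = \int[P]_(x in A) h' x)%E) ->
  cexp_ge0 P G h = cexp_ge0 P G h'.
Proof.
move=> hh'; rewrite /cexp_ge0; congr xget; apply/funext => g; apply/propext.
by split => -[mg g0 gE]; split => // A GA; rewrite gE// hh'.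
Qed.

(** [cexp] subtracts a chosen version for the negative part; that part is zero almost everywhere, so
    its version is too. *)
Lemma cexp_ae n (h : T -> \bar R) (h' : T -> R) :
  measurable_fun setT h -> measurable_fun setT h' -> (forall x, 0 <= h' x) ->
  {ae P, forall x, h x = (h' x)%:E} ->
  {ae P, forall x, cexp P (F n) h x = cexp_ge0 P (F n) (EFin \o h') x}.
Proof.
move=> mh mh' h'0 hh'.
have Fm A : F n A -> measurable A by case: FF => _ m _; exact: m.
have mEh' : measurable_fun setT (EFin \o h') by exact/measurable_EFinP.
have pos : cexp_ge0 P (F n) (h^\+)%E = cexp_ge0 P (F n) (EFin \o h').
  apply: eq_cexp_ge0 => A /Fm mA; apply: ge0_ae_eq_integral => //.
  - by apply: measurable_funTS; exact: measurable_funepos.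
  - exact: measurable_funTS.
  - by move=> x _; rewrite lee_fin.
  - by apply: filterS hh' => x hx _; rewrite funeposE hx /= max_l// lee_fin.
have neg : cexp_ge0 P (F n) (h^\-)%E = cexp_ge0 P (F n) (EFin \o (fun=> 0)).
  apply: eq_cexp_ge0 => A /Fm mA; apply: ge0_ae_eq_integral => //.
  - by apply: measurable_funTS; exact: measurable_funeneg.
  - exact: measurable_cst.
  - apply: filterS hh' => x hx _; rewrite funenegE hx /= max_r//.
    by rewrite lee_fin oppr_le0.
have m0 : measurable_fun setT (fun _ : T => (0 : R)) by exact: measurable_cst.
have [mz z0 zE] := filtration_cexp P FF n m0 (fun=> lexx 0).
have mz' := cexp_measurable P FF n m0 (fun=> lexx 0).
have FT : F n setT by case: FF => s _ _; apply/(sub_measurableG (s n)); exact: measurableT.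
have : ae_eq P setT (cexp_ge0 P (F n) (EFin \o (fun=> 0))) (cst 0%E).
  apply/(ae_eq_integral_abs P measurableT) => //.
  under eq_integral => x _ do rewrite gee0_abs//.
  by rewrite zE//= integral0.
apply: filterS => x /(_ I) zx.
by rewrite /cexp pos neg zx /= sube0.
Qed.

Variables (p : R) (w : T -> R).
Hypothesis p1 : 1 < p.
Let p10 : 0 < p - 1. Proof. by rewrite subr_gt0. Qed.

(** The chosen conditional expectations satisfy the A_p bound only almost surely. Changing the
    weight and the versions on null sets makes positivity and the bound hold at every point. *)
Lemma Ap_versions : in_Ap P F p w -> exists (v : T -> R) (Q : R) (w_ s_ : nat -> T -> R),
  [/\ Ap_char P F p w = Q%:E, 0 < Q, measurable_fun setT v, (forall x, 0 < v x) &
    {ae P, forall x, w x = v x}] /\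
  [/\ (eint P v < +oo)%E, forall k, pos_version v k (w_ k),
    forall k, pos_version (fun x => v x `^ (1 - p)^-1) k (s_ k) &
    forall k x, w_ k x * s_ k x `^ (p - 1) <= Q].
Proof.
move=> [[iw wpos] Alt].
have mw : measurable_fun setT w by apply/measurable_EFinP; exact: measurable_int iw.
pose v x := if 0 < w x then w x else 1.
have mv : measurable_fun setT v.
  by apply: measurable_fun_ifT => //; exact: measurable_fun_ltr.
have v0 x : 0 < v x by rewrite /v; case: ifP.
have v0' x : 0 <= v x := ltW (v0 x).
have wv : {ae P, forall x, w x = v x} by apply: filterS wpos => x; rewrite /v => ->.
have vfin : (eint P v < +oo)%E.
  have -> : eint P v = (\int[P]_x `|(EFin \o w) x|)%E.
    apply: ge0_ae_eq_integral => //.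
    - exact/measurable_EFinP.
    - by apply: measurableT_comp => //; exact/measurable_EFinP.
    - by move=> x _; rewrite lee_fin.
    - by apply: filterS wv => x e _; rewrite /= e ger0_norm.
  by case/integrableP: iw.
pose sg x := v x `^ (1 - p)^-1.
have msg : measurable_fun setT sg by exact: measurable_fun_powR.
have sg0 x : 0 < sg x by exact: powR_gt0.
have sg0' x : 0 <= sg x := ltW (sg0 x).
pose Ew n := cexp_ge0 P (F n) (EFin \o v).
pose Es n := cexp_ge0 P (F n) (EFin \o sg).
have Ewp n := cexp_ae_gt0 P FF n mv v0.
have Esp n := cexp_ae_gt0 P FF n msg sg0.
have Ewf n : {ae P, forall x, (Ew n x < +oo)%E}.
  have := @cexp_ae_fin _ _ _ P _ FF v n mv v0' (fun=> 1) (measurable_cst _) (fun=> ler01).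
  have -> : eint P (fun x => (1 * v x)%R) = eint P v by apply: eq_eint => x; rewrite mul1r.
  by move=> /(_ vfin); apply: filterS => x; apply.
have cw n : {ae P, forall x, cexp P (F n) (EFin \o w) x = Ew n x}.
  apply: cexp_ae => //; first exact/measurable_EFinP.
  by apply: filterS wv => x /= ->.
have cs n : {ae P, forall x, cexp P (F n) (fun y => (w y `^ (1 - p)^-1)%:E) x = Es n x}.
  apply: cexp_ae => //.
    by apply/measurable_EFinP; exact: measurable_fun_powR.
  by apply: filterS wv => x /= ->.
pose A := Ap_char P F p w.
have ApP n : {ae P, forall x, (Ew n x * (Es n x `^ (p - 1)) <= A)%E}.
  pose g x := (cexp P (F n) (EFin \o w) x *
      (cexp P (F n) (fun y => (w y `^ (1 - p)^-1)%:E) x) `^ (p - 1))%E.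
  have gA : (Lnorm P +oo g <= A)%E by apply: ereal_sup_ubound; exists n.
  have : {ae P, forall x, (`|g x| <= A)%E}.
    move: gA; rewrite unlock /Lnorm.
    have -> : (0 < P setT)%E by have -> : P setT = 1%E by exact: probability_setT.
    by move/ess_supP.
  have Ewn := Ewp n; have Esn := Esp n; have cwn := cw n; have csn := cs n.
  move=> gA'; near=> x.
  have e1 : cexp P (F n) (EFin \o w) x = Ew n x by near: x.
  have e2 : cexp P (F n) (fun y => (w y `^ (1 - p)^-1)%:E) x = Es n x by near: x.
  have : (`|g x| <= A)%E by near: x.
  by rewrite /g e1 e2; apply: le_trans; exact: lee_abs.
have good n : {ae P, forall x, [/\ 0 < fine (Ew n x), 0 < fine (Es n x),
    Ew n x \is a fin_num, Es n x \is a fin_num & ((fine (Ew n x) * fine (Es n x) `^ (p - 1))%:E <= A)%E]}.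
  have h1 := Ewp n; have h2 := Esp n; have h3 := Ewf n; have h4 := ApP n.
  near=> x.
  have Ew0 : (0 < Ew n x)%E by near: x.
  have Es0 : (0 < Es n x)%E by near: x.
  have Ewoo : (Ew n x < +oo)%E by near: x.
  have EA : (Ew n x * (Es n x `^ (p - 1)) <= A)%E by near: x.
  have wf : Ew n x \is a fin_num by rewrite ge0_fin_numE// ltW.
  (* Finiteness for the dual weight comes from the characteristic: since [Ew n x] > 0, an infinite
     value here would make the A_p product infinite. *)
  have sf : Es n x \is a fin_num.
    rewrite ge0_fin_numE ?(ltW Es0)// ltey; apply/negP => /eqP Eoo.
    move: EA; rewrite Eoo poweRyr ?gt_eqF// gt0_muley// leye_eq => /eqP AE.
    by move: Alt; rewrite -/A AE ltxx.
  split => //; rewrite -?lte_fin ?fineK//.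
  by rewrite EFinM -poweR_EFin !fineK.
(* A single point where all bounds hold shows that the characteristic is positive; it exists because
   the whole space is not a null set. *)
have [x0 hx0] : exists x, [/\ 0 < fine (Ew 0%N x), 0 < fine (Es 0%N x),
    Ew 0%N x \is a fin_num, Es 0%N x \is a fin_num & ((fine (Ew 0%N x) * fine (Es 0%N x) `^ (p - 1))%:E <= A)%E].
  apply: contrapT => /forallNP no.
  have : P setT = 0%E.
    apply/negligibleP => //; have [N [mN N0 sN]] := good 0%N.
    by exists N; split => // x _; apply: sN; exact: no.
  have -> : P setT = 1%E by exact: probability_setT.
  by case=> /eqP; rewrite oner_eq0.
have [Q AQ Q0] : exists2 Q, A = Q%:E & 0 < Q.
  case: hx0 => e0 s0 _ _ hA.
  have q0 : 0 < fine (Ew 0%N x0) * fine (Es 0%N x0) `^ (p - 1).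
    by rewrite mulr_gt0// powR_gt0.
  have A0 : (0 < A)%E by apply: lt_le_trans hA; rewrite lte_fin.
  have Af : A \is a fin_num by rewrite ge0_fin_numE// ltW.
  by exists (fine A); rewrite -?lte_fin fineK.
pose gd n x := [&& 0 < fine (Ew n x), 0 < fine (Es n x) & fine (Ew n x) * fine (Es n x) `^ (p - 1) <= Q].
have mfw n : adapted n (fine \o Ew n).
  by apply: measurableT_comp => //; exact: (cexp_measurableG P FF mv v0').
have mfs n : adapted n (fine \o Es n).
  by apply: measurableT_comp => //; exact: (cexp_measurableG P FF msg sg0').
have mgd n : measurable_fun [set: g_sigma_algebraType (F n)] (gd n).
  apply: measurable_and; first exact: (measurable_fun_ltr (measurable_cst _) (mfw n)).
  apply: measurable_and; first exact: (measurable_fun_ltr (measurable_cst _) (mfs n)).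
  apply: measurable_fun_ler => //; apply: (measurable_funM (mfw n)).
  exact: (measurable_fun_powR _ (mfs n)).
have gda n : {ae P, forall x, gd n x /\ (Ew n x \is a fin_num /\ Es n x \is a fin_num)}.
  by apply: filterS (good n) => x [a b c e f]; rewrite AQ lee_fin in f; rewrite /gd a b f.
(* The exceptional set lies in F_n, and on it the values 1 and Q^(1/(p-1)) make the A_p product
   equal to Q. *)
exists v, Q, (fun n x => if gd n x then fine (Ew n x) else 1),
  (fun n x => if gd n x then fine (Es n x) else Q `^ (p - 1)^-1).
split; split => //.
- move=> k; apply: (pos_version_cexp FF mv v0').
  + by apply: measurable_fun_ifT => //; exact: mfw.
  + by move=> x; case: ifPn => // /and3P[].
  + by apply: filterS (gda k) => x [-> [f1 f2]]; rewrite fineK.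
- move=> k; apply: (pos_version_cexp FF msg sg0').
  + by apply: measurable_fun_ifT => //; exact: mfs.
  + by move=> x; case: ifPn => [/and3P[]//|_]; exact: powR_gt0.
  + by apply: filterS (gda k) => x [-> [f1 f2]]; rewrite fineK.
- move=> k x; case: ifPn => [/and3P[]//|_].
  by rewrite mul1r -powRrM mulVf ?gt_eqF// powRr1// ltW.
Unshelve. all: by end_near. Qed.

End link.

(** * Versions for a function of the weighted space *)

Section function_versions.
Context d (T : measurableType d) (R : realType) (P : probability T R).
Variable F : nat -> set (set T).
Hypothesis FF : is_filtration F.
Notation adapted := (@adapted d T R F).
Notation pos_version := (@pos_version d T R P F).
Variables (p : R) (v : T -> R) (s_ : nat -> T -> R) (g : T -> R).
Hypotheses (p1 : 1 < p) (mv : measurable_fun setT v) (v0 : forall x, 0 < v x)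
  (vs : forall k, pos_version (fun x => v x `^ (1 - p)^-1) k (s_ k))
  (mg : measurable_fun setT g) (g0 : forall x, 0 <= g x)
  (gfin : (eint P (fun x => (g x `^ p * v x)%R) < +oo)%E).

Let Eg n := cexp_ge0 P (F n) (EFin \o g).

(** Young's inequality gives g <= g^p v + v^(1/(1-p)). The first term is integrable and the second
    has the finite conditional expectation s_n, so [g] is integrable over each set where s_n <= j,
    and these sets exhaust the space. *)
Lemma cexp_ae_fin_weighted n : {ae P, forall x, (Eg n x < +oo)%E}.
Proof.
have p0 : 0 < p := lt_trans ltr01 p1.
have p10 : 0 < p - 1 by rewrite subr_gt0.
have v0' x : 0 <= v x := ltW (v0 x).
have [as_ s0 es] := vs n.
have mpow (Y : T -> R) r : measurable_fun setT Y -> measurable_fun setT (fun x => Y x `^ r).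
  by move=> mY; exact: measurable_fun_powR.
have young x : g x <= g x `^ p * v x + v x `^ (1 - p)^-1.
  have pp : p^-1 + (p / (p - 1))^-1 = 1 by field; rewrite !gt_eqF.
  have q0 : 0 < p / (p - 1) by rewrite divr_gt0.
  have := @conjugate_powR R (g x * v x `^ p^-1) (v x `^ (- p^-1)) p (p / (p - 1)).
  rewrite mulr_ge0 ?powR_ge0// => /(_ isT isT p0 q0 pp).
  rewrite powRM ?powR_ge0// -!powRrM mulVf ?gt_eqF// powRr1//.
  rewrite -mulrA -powRD ?subrr ?powRr0 ?mulr1; last by rewrite (gt_eqF (v0 x)) implybT.
  have -> : - p^-1 * (p / (p - 1)) = (1 - p)^-1.
    by field; rewrite (gt_eqF p0) (gt_eqF p10) lt_eqF// subr_lt0.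
  move=> /le_trans; apply; apply: lerD.
    rewrite ler_pdivrMr// ler_peMr ?mulr_ge0 ?powR_ge0// ltW//.
  rewrite ler_pdivrMr// ler_peMr ?powR_ge0//.
  by rewrite ler_pdivlMr// mul1r gerBl.
have fin j : {ae P, forall x, s_ n x <= j%:R -> (Eg n x < +oo)%E}.
  have ac : adapted n (cutoff (s_ n) j%:R) by exact: adapted_cutoff.
  have mc := adapted_measurable FF ac.
  have c0 x : 0 <= cutoff (s_ n) j%:R x := cutoff_ge0 _ _ _.
  have cfin : (eint P (fun x => (cutoff (s_ n) j%:R x * g x)%R) < +oo)%E.
    apply: (@le_lt_trans _ _ (eint P (fun x => (g x `^ p * v x +
      cutoff (s_ n) j%:R x * v x `^ (1 - p)^-1)%R))).
      have mgp := mpow _ p mg; have mvp := mpow _ (1 - p)^-1 mv.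
      apply: le_eint => [| |x|x]; [by mfun|by mfun|by rewrite mulr_ge0|].
      apply: (le_trans (ler_wpM2l (c0 x) (young x))); rewrite mulrDr lerD2r.
      by rewrite ler_piMl ?mulr_ge0 ?powR_ge0//; exact: cutoff_le1.
    have mgp := mpow _ p mg; have mvp := mpow _ (1 - p)^-1 mv.
    rewrite eintD; [|by mfun|by mfun|by move=> x; rewrite mulr_ge0 ?powR_ge0|by move=> x; rewrite mulr_ge0 ?powR_ge0].
    apply: lte_add_pinfty => //; rewrite -es//.
    apply: (@le_lt_trans _ _ (eint P (fun=> j%:R))); last by rewrite eint_cst ltry.
    have ms := adapted_measurable FF as_.
    apply: le_eint => [| |x|x]; [by mfun|by []|by rewrite mulr_ge0// ltW|].
    by rewrite /cutoff; case: ifPn => h; rewrite ?mul1r ?mul0r.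
  have := cexp_ae_fin FF mg g0 ac c0 cfin; apply: filterS => x h sj; apply: h.
  by rewrite /cutoff sj.
have := ae_foralln fin; apply: filterS => x h.
apply: (h (Num.truncn (s_ n x)).+1); exact/ltW/truncnS_gt.
Qed.

Lemma pos_version_shift eps n : 0 < eps ->
  pos_version (fun x => g x + eps) n (fun x => fine (Eg n x) + eps).
Proof.
move=> e0.
have E0 x : (0 <= Eg n x)%E by exact: cexp_nonneg.
have mG : adapted n (fine \o Eg n).
  by apply: measurableT_comp => //; exact: (cexp_measurableG P FF mg g0).
have mf := adapted_measurable FF mG.
have mE := cexp_measurable P FF n mg g0.
have f0 x : 0 <= fine (Eg n x) by exact: fine_ge0.
split.
- by apply: (measurable_funD mG); exact: measurable_cst.
- by move=> x; rewrite ltr_wpDl.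
move=> phi aphi phi0; have mphi := adapted_measurable FF aphi.
have e0' := ltW e0.
have e1 : eint P (fun x => (phi x * fine (Eg n x))%R) = eint P (fun x => (phi x * g x)%R).
  rewrite -(integral_cexp_testing P FF mg g0 aphi phi0).
  apply: ge0_ae_eq_integral => //.
  - by apply/measurable_EFinP; apply: measurable_funM.
  - by apply: emeasurable_funM => //; exact/measurable_EFinP.
  - by move=> x _; rewrite lee_fin mulr_ge0.
  - by move=> x _; apply: mule_ge0; [rewrite lee_fin|exact: E0].
  - apply: filterS (cexp_ae_fin_weighted n) => x h _.
    by rewrite EFinM fineK// ge0_fin_numE.
have split (h : T -> R) : measurable_fun setT h -> (forall x, 0 <= h x) ->
    eint P (fun x => (phi x * (h x + eps))%R) = (eint P (fun x => (phi x * h x)%R) + eint P (fun x => (phi x * eps)%R))%E.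
  move=> mh h0; rewrite -eintD; [|by mfun|by mfun|by move=> x; rewrite mulr_ge0|by move=> x; rewrite mulr_ge0].
  by apply: eq_eint => x; rewrite mulrDr.
by rewrite !split// e1.
Qed.

End function_versions.

(** * Signed functions and the full square function *)

Section estimate.
Context d (T : measurableType d) (R : realType) (P : probability T R).
Variable F : nat -> set (set T).
Hypothesis FF : is_filtration F.
Notation adapted := (@adapted d T R F).
Notation pos_version := (@pos_version d T R P F).
Variables (p : R) (v f : T -> R) (w_ s_ : nat -> T -> R) (Q C : R).
Hypotheses (p1 : 1 < p) (mv : measurable_fun setT v) (v0 : forall x, 0 < v x)
  (mf : measurable_fun setT f) (Q0 : 0 < Q) (vfin : (eint P v < +oo)%E)
  (vw : forall k, pos_version v k (w_ k))
  (vs : forall k, pos_version (fun x => v x `^ (1 - p)^-1) k (s_ k))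
  (wsQ : forall k x, w_ k x * s_ k x `^ (p - 1) <= Q)
  (ffin : (eint P (fun x => (`|f x| `^ p * v x)%R) < +oo)%E)
  (C0 : 0 <= C) (hC : core_bound p C).

Let p0 : 0 < p. Proof. exact: lt_trans ltr01 p1. Qed.
Let ph0 : 0 < p / 2. Proof. by rewrite divr_gt0. Qed.
Let v0' x : 0 <= v x. Proof. exact: ltW. Qed.
Let fp x := Num.max (f x) 0.
Let fm x := Num.max (- f x) 0.
Let A k x := fine (cexp_ge0 P (F k) (EFin \o fp) x).
Let B k x := fine (cexp_ge0 P (F k) (EFin \o fm) x).
Let dk k x := if k is j.+1 then (A j.+1 x - A j x) - (B j.+1 x - B j x) else A 0%N x - B 0%N x.
Let D n x := \sum_(k < n.+1) dk k x ^+ 2.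
(** The factor 4^(p/2) comes from D <= 2 (SA + SB) <= 4 max(SA, SB), the single 2 from the two parts
    of f, and 2^p from (|f| + eps)^p <= 2^p (|f|^p + eps^p). *)
Let K : R := 4 `^ (p / 2) * (C * Q `^ (p * Num.max 2^-1 (p - 1)^-1)) * (2 * 2 `^ p).
Let N := eint P (fun x => (`|f x| `^ p * v x)%R).

Let mpow (Y : T -> R) r : measurable_fun setT Y -> measurable_fun setT (fun x => Y x `^ r).
Proof. by move=> mY; exact: measurable_fun_powR. Qed.
Let fp0 x : 0 <= fp x. Proof. by rewrite le_max lexx orbT. Qed.
Let fm0 x : 0 <= fm x. Proof. by rewrite le_max lexx orbT. Qed.
Let mfp : measurable_fun setT fp. Proof. exact: measurable_maxr. Qed.
Let mfm : measurable_fun setT fm.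
Proof. by apply: measurable_maxr => //; exact: measurableT_comp. Qed.
Let mabs : measurable_fun setT (fun x => `|f x|). Proof. exact: measurableT_comp. Qed.
Let fpn x : fp x <= `|f x|. Proof. by rewrite ge_max ler_norm normr_ge0. Qed.
Let fmn x : fm x <= `|f x|. Proof. by rewrite ge_max -normrN ler_norm normr_ge0. Qed.
Let K0 : 0 <= K.
Proof. by apply: mulr_ge0; apply: mulr_ge0; rewrite ?powR_ge0 ?mulr_ge0 ?powR_ge0. Qed.

Let part_fin (g : T -> R) : measurable_fun setT g -> (forall x, 0 <= g x) ->
  (forall x, g x <= `|f x|) -> (eint P (fun x => (g x `^ p * v x)%R) < +oo)%E.
Proof.
move=> mg g0 gf; apply: le_lt_trans ffin; have m1 := mpow p mg; have m2 := mpow p mabs.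
apply: le_eint => [| |x|x]; [by mfun|by mfun|by rewrite mulr_ge0 ?powR_ge0|].
by rewrite ler_wpM2r// ge0_ler_powR ?(ltW p0) ?nnegrE.
Qed.

Let part_bound (g : T -> R) eps n : measurable_fun setT g -> (forall x, 0 <= g x) ->
  (forall x, g x <= `|f x|) -> 0 < eps ->
  (eint P (fun x => (sqsum (fun k x => fine (cexp_ge0 P (F k) (EFin \o g) x) + eps) n x `^ (p / 2) * v x)%R) <=
   (C * Q `^ (p * Num.max 2^-1 (p - 1)^-1))%:E * ((2 `^ p)%:E * (N + (eps `^ p)%:E * eint P v)))%E.
Proof.
move=> mg g0 gf e0.
have gfin := part_fin mg g0 gf.
have vg k := pos_version_shift FF p1 mv v0 vs mg g0 gfin k e0.
have mge : measurable_fun setT (fun x => g x + eps) by apply: measurable_funD.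
have ge0 x : 0 < g x + eps by rewrite ltr_wpDl.
have eg k x : eps <= fine (cexp_ge0 P (F k) (EFin \o g) x) + eps.
  by rewrite lerDr fine_ge0//; exact: cexp_nonneg.
apply: (le_trans (hC n FF mv mge v0 ge0 e0 eg Q0 vfin vw vs vg wsQ)).
apply: lee_wpmul2l; first by rewrite lee_fin mulr_ge0 ?powR_ge0.
have m2 := mpow p mabs; have m3 := mpow p mge.
rewrite -eintZ ?powR_ge0// -eintD; [|by mfun|by mfun|by move=> x; rewrite mulr_ge0 ?powR_ge0|
  by move=> x; rewrite mulr_ge0 ?powR_ge0].
rewrite -eintZ ?powR_ge0//; [|by mfun|by move=> x; rewrite addr_ge0 ?mulr_ge0 ?powR_ge0].
apply: le_eint => [| |x|x]; [by mfun|by mfun|by rewrite mulr_ge0 ?powR_ge0|].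
rewrite -mulrDl mulrA ler_wpM2r//.
pose M := Num.max `|f x| eps.
have M0 : 0 <= M by rewrite le_max normr_ge0.
have h1 : g x + eps <= 2 * M.
  rewrite (_ : 2 * M = M + M); last by ring.
  by rewrite lerD// le_max ?gf ?lexx ?orbT.
apply: (@le_trans _ _ ((2 * M) `^ p)).
  by rewrite ge0_ler_powR ?(ltW p0) ?nnegrE ?(ltW (ge0 _)) ?mulr_ge0.
rewrite powRM// ler_wpM2l ?powR_ge0// /M; case: (leP `|f x| eps) => h.
  by rewrite lerDr powR_ge0.
by rewrite lerDl powR_ge0.
Qed.

(** Both parts of f are shifted by the same eps, which therefore cancels in every difference, also
    in A_0 - B_0 at time 0. *)
Let dk_bound eps n : 0 < eps -> (eint P (fun x => (D n x `^ (p / 2) * v x)%R) <=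
  K%:E * (N + (eps `^ p)%:E * eint P v))%E.
Proof.
move=> e0.
pose SA := sqsum (fun k x => A k x + eps) n.
pose SB := sqsum (fun k x => B k x + eps) n.
have mA k : measurable_fun setT (A k).
  by apply: measurableT_comp => //; exact: (cexp_measurable P FF k mfp fp0).
have mB k : measurable_fun setT (B k).
  by apply: measurableT_comp => //; exact: (cexp_measurable P FF k mfm fm0).
have mD : measurable_fun setT (D n).
  by apply: measurable_sum => -[[|k] _] /=; rewrite /dk; mfun.
have mS (E : nat -> T -> R) : (forall k, measurable_fun setT (E k)) ->
    measurable_fun setT (sqsum (fun k x => E k x + eps) n).
  move=> mE; apply: measurable_funD; first by mfun.
  by apply: measurable_sum => i; mfun.
have S0 (E : nat -> T -> R) x : 0 <= sqsum (fun k x => E k x + eps) n x.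
  by rewrite addr_ge0 ?sqr_ge0// sumr_ge0// => i _; exact: sqr_ge0.
have D0 x : 0 <= D n x by apply: sumr_ge0 => i _; exact: sqr_ge0.
have DS x : D n x <= 2 * (SA x + SB x).
  have sq (a b : R) : (a - b) ^+ 2 <= 2 * (a ^+ 2 + b ^+ 2).
    by have := sqr_ge0 (a + b); lra.
  rewrite /D big_ord_recl /SA /SB /sqsum addrACA -big_split mulrDr; apply: lerD.
    by rewrite /dk (_ : A 0%N x - B 0%N x = (A 0%N x + eps) - (B 0%N x + eps)) ?sq//; ring.
  rewrite mulr_sumr; apply: ler_sum => i _.
  rewrite lift0 /dk.
  have -> : A i.+1 x + eps - (A i x + eps) = A i.+1 x - A i x by ring.
  have -> : B i.+1 x + eps - (B i x + eps) = B i.+1 x - B i x by ring.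
  exact: sq.
have mSA : measurable_fun setT SA := mS _ mA.
have mSB : measurable_fun setT SB := mS _ mB.
have SA0 x : 0 <= SA x := S0 A x.
have SB0 x : 0 <= SB x := S0 B x.
have bA := part_bound n mfp fp0 fpn e0.
have bB := part_bound n mfm fm0 fmn e0.
rewrite -/SA in bA; rewrite -/SB in bB.
have [Dn DnE] : exists E, E = D n by exists (D n).
rewrite -DnE in mD D0 DS *.
clearbody SA SB; clear DnE.
have m1 := mpow (p / 2) mD; have m2 := mpow (p / 2) mSA; have m3 := mpow (p / 2) mSB.
pose c4 : R := 4 `^ (p / 2).
have c40 : 0 <= c4 by exact: powR_ge0.
apply: (@le_trans _ _ (c4%:E * (eint P (fun x => (SA x `^ (p / 2) * v x)%R) +
   eint P (fun x => (SB x `^ (p / 2) * v x)%R)))%E).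
  have mAv := measurable_funM m2 mv.
  have mBv := measurable_funM m3 mv.
  have A0 x : 0 <= SA x `^ (p / 2) * v x by apply: mulr_ge0; [exact: powR_ge0|].
  have B0 x : 0 <= SB x `^ (p / 2) * v x by apply: mulr_ge0; [exact: powR_ge0|].
  rewrite -(eintD P mAv mBv A0 B0).
  rewrite -eintZ//; [|by mfun|by move=> x; rewrite addr_ge0 ?mulr_ge0 ?powR_ge0].
  apply: le_eint => [| |x|x]; [by mfun|by mfun|by rewrite mulr_ge0 ?powR_ge0|].
  rewrite -mulrDl mulrA ler_wpM2r//.
  pose M := Num.max (SA x) (SB x).
  have M0 : 0 <= M by rewrite le_max SA0.
  have h4 : Dn x <= 4 * M.
    apply: (le_trans (DS x)).
    have : SA x <= M by rewrite le_max lexx.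
    have : SB x <= M by rewrite le_max lexx orbT.
    lra.
  apply: (@le_trans _ _ ((4 * M) `^ (p / 2))).
    by rewrite ge0_ler_powR ?(ltW ph0) ?nnegrE ?mulr_ge0.
  rewrite powRM// ler_wpM2l// /M; case: (leP (SA x) (SB x)) => h.
    by rewrite lerDr powR_ge0.
  by rewrite lerDl powR_ge0.
apply: (@le_trans _ _ (c4%:E * ((C * Q `^ (p * Num.max 2^-1 (p - 1)^-1))%:E * ((2 `^ p)%:E * (N + (eps `^ p)%:E * eint P v)) +
  (C * Q `^ (p * Num.max 2^-1 (p - 1)^-1))%:E * ((2 `^ p)%:E * (N + (eps `^ p)%:E * eint P v))))%E).
  by apply: lee_wpmul2l; [rewrite lee_fin; exact: c40|exact: (leeD bA bB)].
rewrite -mule2n -mule_natl !muleA -!EFinM le_eqVlt; apply/orP; left; apply/eqP.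
by congr (_%:E * _)%E; rewrite /K /c4; ring.
Qed.

Lemma eint_partial_sums n : (eint P (fun x => (D n x `^ (p / 2) * v x)%R) <= K%:E * N)%E.
Proof.
have Nf : N \is a fin_num.
  by rewrite ge0_fin_numE//; apply: eint_ge0 => x; rewrite mulr_ge0 ?powR_ge0.
have Vf : eint P v \is a fin_num by rewrite ge0_fin_numE//; exact: eint_ge0.
apply/lee_addgt0Pr => e e0.
pose V := fine (eint P v).
have V0 : 0 <= V by apply: fine_ge0; exact: eint_ge0.
(* The shift is taken with eps^p = [del], so that its contribution K V eps^p is at most e; the added
   1 excludes a division by 0. *)
pose del := e / (K * V + 1).
have KV : 0 <= K * V by exact: mulr_ge0.
have del0 : 0 < del by rewrite divr_gt0// ltr_wpDl.
have := @dk_bound (del `^ p^-1) n (powR_gt0 _ del0).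
move=> /le_trans; apply.
rewrite -powRrM mulVf ?gt_eqF// powRr1 ?(ltW del0)//.
rewrite -(fineK Nf) -(fineK Vf) -/V.
change ((K * (fine N + del * V))%:E <= (K * fine N + e)%:E)%E.
rewrite lee_fin mulrDr lerD2l.
rewrite mulrCA /del mulrAC ler_pdivrMr ?ltr_wpDl// ler_wpM2l ?(ltW e0)//.
by rewrite lerDl.
Qed.

Let Ap_fin n : {ae P, forall x, (cexp_ge0 P (F n) (EFin \o fp) x < +oo)%E}.
Proof. exact: (cexp_ae_fin_weighted FF p1 mv v0 vs mfp fp0 (part_fin mfp fp0 fpn)). Qed.
Let Am_fin n : {ae P, forall x, (cexp_ge0 P (F n) (EFin \o fm) x < +oo)%E}.
Proof. exact: (cexp_ae_fin_weighted FF p1 mv v0 vs mfm fm0 (part_fin mfm fm0 fmn)). Qed.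

Let martE n : mart P F f n =
  (fun x => cexp_ge0 P (F n) (EFin \o fp) x - cexp_ge0 P (F n) (EFin \o fm) x)%E.
Proof.
rewrite /mart /cexp; apply/funext => x; congr (cexp_ge0 P (F n) _ x - cexp_ge0 P (F n) _ x)%E.
- by apply/funext => y; rewrite funeposE /= /fp EFin_max.
- by apply/funext => y; rewrite funenegE /= /fm EFin_max.
Qed.

Let mart_measurable n : measurable_fun setT (mart P F f n).
Proof.
rewrite martE; apply: emeasurable_funB.
  exact: (cexp_measurable P FF n mfp fp0).
exact: (cexp_measurable P FF n mfm fm0).
Qed.

Lemma mart_diff_measurable n : measurable_fun setT (mart_diff P F f n).
Proof.
case: n => [|n]; first exact: mart_measurable.
by apply: emeasurable_funB; exact: mart_measurable.
Qed.

Lemma mart_diff_ae : {ae P, forall x k, mart_diff P F f k x = (dk k x)%:E}.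
Proof.
have h : {ae P, forall x, forall n, mart P F f n x = (A n x - B n x)%:E}.
  apply: ae_foralln => n; have a1 := Ap_fin n; have a2 := Am_fin n.
  near=> x; rewrite martE EFinB /A /B !fineK//.
    rewrite ge0_fin_numE; first by near: x.
    exact: (cexp_nonneg P FF n mfm fm0).
  rewrite ge0_fin_numE; first by near: x.
  exact: (cexp_nonneg P FF n mfp fp0).
apply: filterS h => x h [|k] /=; first by rewrite h.
by rewrite !h -EFinB; congr (_%:E); ring.
Unshelve. all: by end_near. Qed.

Lemma mart_square_measurable :
  measurable_fun setT (fun x => (\sum_(0 <= k <oo) `|mart_diff P F f k x| ^+ 2)%E).
Proof.
apply: ge0_emeasurable_sum => [k x _ _|k _]; first exact: sqre_ge0.
apply: (@measurableT_comp _ _ _ _ _ _ (fun y : \bar R => `|y| ^+ 2)%E); last exact: mart_diff_measurable.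
under eq_fun do rewrite expe2.
by apply: emeasurable_funM; exact: abse_measurable.
Qed.

Lemma square_integral :
  (\int[P]_x ((\sum_(0 <= k <oo) `|mart_diff P F f k x| ^+ 2) `^ (p / 2) * (v x)%:E) <= K%:E * N)%E.
Proof.
have mA k : measurable_fun setT (A k).
  by apply: measurableT_comp => //; exact: (cexp_measurable P FF k mfp fp0).
have mB k : measurable_fun setT (B k).
  by apply: measurableT_comp => //; exact: (cexp_measurable P FF k mfm fm0).
have mD n : measurable_fun setT (D n).
  by apply: measurable_sum => -[[|k] _] /=; rewrite /dk; mfun.
have D0 n x : 0 <= D n x by apply: sumr_ge0 => i _; exact: sqr_ge0.
have Dnd x : nondecreasing_seq (fun n => D n x).
  apply/nondecreasing_seqP => n; rewrite /D [leRHS]big_ord_recr/= lerDl.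
  exact: sqr_ge0.
pose g n x : \bar R := (D n x `^ (p / 2) * v x)%:E.
have mg n : measurable_fun setT (g n).
  by apply/measurable_EFinP; apply: measurable_funM => //; exact: mpow.
have g0 n x : (0 <= g n x)%E by rewrite lee_fin mulr_ge0 ?powR_ge0.
have gnd x : nondecreasing_seq (fun n => g n x).
  move=> i j ij; rewrite lee_fin ler_wpM2r// ge0_ler_powR ?(ltW ph0) ?nnegrE//.
  exact: Dnd.
have gcv x : cvgn (fun n => g n x) by exact: ereal_nondecreasing_is_cvgn.
have gL n x : (g n x <= limn (fun n => g n x))%E.
  by apply: lime_ge => //; exists n => // m /=; exact: gnd.
have L0 x : (0 <= limn (fun n => g n x))%E by rewrite (le_trans _ (gL 0%N x)).
apply: (@le_trans _ _ (\int[P]_x limn (fun n => g n x))%E); last first.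
  rewrite monotone_convergence//.
  apply: lime_le; last by apply: nearW => n; exact: eint_partial_sums.
  apply: ereal_nondecreasing_is_cvgn => i j ij; apply: ge0_le_integral => // x _.
  exact: gnd.
apply: ae_ge0_le_integral => //.
- by move=> x _; rewrite mule_ge0 ?poweR_ge0 ?lee_fin.
- apply: emeasurable_funM; last exact/measurable_EFinP.
  exact: (measurableT_comp (measurable_poweR _) mart_square_measurable).
- by apply: (emeasurable_fun_cvg _ _ mg) => x _; exact: gcv.
have h := mart_diff_ae; apply: filterS h => x h _.
set L := limn (fun n => g n x).
(* [c] bounds every D_n^(p/2), so c^(2/p) bounds every partial sum and hence the series. Raising
   back to p/2 replaces an appeal to continuity of the power at +oo. *)
pose c := (L * ((v x)^-1)%:E)%E.
have vx0 : v x != 0 by rewrite gt_eqF.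
have c0 : (0 <= c)%E by apply: mule_ge0; [exact: L0|rewrite lee_fin invr_ge0].
have -> : L = (c * (v x)%:E)%E by rewrite /c -muleA -EFinM mulVf// mule1.
apply: lee_wpmul2r; first by rewrite lee_fin.
have pn0 : p != 0 by rewrite gt_eqF.
have -> : c = ((c `^ (2 / p)) `^ (p / 2))%E.
  by rewrite -poweRrM (_ : 2 / p * (p / 2) = 1) ?poweRe1//; field.
have S0 : (0 <= \sum_(0 <= k <oo) `|mart_diff P F f k x| ^+ 2)%E.
  by apply: nneseries_ge0 => n _ _; exact: sqre_ge0.
apply: gt0_ler_poweR; rewrite ?(ltW ph0) ?in_itv/= ?leey ?andbT ?poweR_ge0//.
apply: lime_le.
  by apply: is_cvg_nneseries => n _ _; exact: sqre_ge0.
apply: nearW => n.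
have -> : (\sum_(0 <= k < n) `|mart_diff P F f k x| ^+ 2)%E = (\sum_(0 <= k < n) dk k x ^+ 2)%:E.
  rewrite -sumEFin; apply: eq_bigr => k _; rewrite h abse_EFin -EFin_expe.
  by rewrite real_normK// num_real.
(* The partial sum has n terms and [D n] has n + 1. *)
apply: (@le_trans _ _ (D n x)%:E).
  by rewrite lee_fin big_mkord /D big_ord_recr/= lerDl sqr_ge0.
have -> : (D n x)%:E = ((D n x `^ (p / 2))%:E `^ (2 / p))%E.
  by rewrite poweR_EFin -powRrM (_ : p / 2 * (2 / p) = 1) ?powRr1//; field.
apply: gt0_ler_poweR; rewrite ?in_itv/= ?leey ?andbT ?lee_fin ?powR_ge0 ?divr_ge0 ?(ltW p0)//.
have -> : (D n x `^ (p / 2))%:E = (g n x * ((v x)^-1)%:E)%E.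
  by rewrite -EFinM mulfK.
by apply: lee_wpmul2r; [rewrite lee_fin invr_ge0|exact: gL].
Qed.

Lemma wnorm_square_fun (w : T -> R) : measurable_fun setT w ->
  {ae P, forall x, w x = v x} ->
  (wnorm P p w (square_fun P F f) <= (K `^ p^-1)%:E * wnorm P p w (EFin \o f))%E.
Proof.
move=> mw wv.
have N0 : (0 <= N)%E by apply: eint_ge0 => x; rewrite mulr_ge0 ?powR_ge0.
have pV0 : 0 <= p^-1 by rewrite invr_ge0 ltW.
have -> : wnorm P p w (EFin \o f) = (N `^ p^-1)%E.
  rewrite /wnorm; congr (_ `^ _)%E; apply: ae_eq_integral => //.
  - apply: emeasurable_funM; last exact/measurable_EFinP.
    exact/measurable_EFinP/mpow.
  - by apply/measurable_EFinP; apply: measurable_funM => //; exact: mpow.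
  - by apply: filterS wv => x e _; rewrite e.
rewrite -poweR_EFin -poweRM//.
have I0 : (0 <= \int[P]_x ((\sum_(0 <= k <oo) `|mart_diff P F f k x| ^+ 2) `^ (p / 2) * (v x)%:E))%E.
  by apply: integral_ge0 => x _; rewrite mule_ge0 ?poweR_ge0 ?lee_fin.
have -> : wnorm P p w (square_fun P F f) =
   ((\int[P]_x ((\sum_(0 <= k <oo) `|mart_diff P F f k x| ^+ 2) `^ (p / 2) * (v x)%:E)) `^ p^-1)%E.
  rewrite /wnorm; congr (_ `^ _)%E.
  have ms r : measurable_fun setT (fun x => (\sum_(0 <= k <oo) `|mart_diff P F f k x| ^+ 2) `^ r)%E.
    exact: (measurableT_comp (measurable_poweR _) mart_square_measurable).
  apply: ae_eq_integral => //.
  - apply: emeasurable_funM; last exact/measurable_EFinP.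
    apply: (measurableT_comp (measurable_poweR _)).
    by apply: measurableT_comp => //; exact: ms.
  - by apply: emeasurable_funM; [exact: ms|exact/measurable_EFinP].
  - apply: filterS wv => x e _; rewrite e /square_fun gee0_abs ?poweR_ge0// -poweRrM.
    by rewrite [2^-1 * p]mulrC.
apply: gt0_ler_poweR; rewrite ?in_itv/= ?leey ?andbT ?mule_ge0 ?lee_fin//.
exact: square_integral.
Qed.

End estimate.

Lemma square_fun_upper (R : realType) (p : R) : 1 < p ->
  exists C : R, square_fun_estimate p (Num.max 2^-1 (p - 1)^-1) C.
Proof.
move=> p1; have p0 : 0 < p := lt_trans ltr01 p1.
have [C C0 hC] := core_estimate p1.
exists ((4 `^ (p / 2) * C * (2 * 2 `^ p)) `^ p^-1).
move=> d T P F FF _ w Aw f [mf ffin].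
have [v [Q [w_ [s_ [[AQ Q0 mv v0 wv] [vfin vw vs wsQ]]]]]] := Ap_versions FF p1 Aw.
have mw : measurable_fun setT w.
  by case: Aw => -[iw _] _; apply/measurable_EFinP; exact: measurable_int iw.
have ffin' : (eint P (fun x => (`|f x| `^ p * v x)%R) < +oo)%E.
  have := lty_poweRy (invr_neq0 (lt0r_neq0 p0)) ffin.
  congr (_ < _)%E; apply: ae_eq_integral => //.
  - apply: emeasurable_funM; last exact/measurable_EFinP.
    apply/measurable_EFinP; apply: measurable_fun_powR; exact: measurableT_comp.
  - apply/measurable_EFinP; apply: measurable_funM => //.
    by apply: measurable_fun_powR; exact: measurableT_comp.
  - by apply: filterS wv => x e _; rewrite e.
have := wnorm_square_fun FF p1 mv v0 mf Q0 vfin vw vs wsQ ffin' C0 hC mw wv.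
rewrite AQ poweR_EFin -EFinM; congr (_ <= _%:E * _)%E.
set k := Num.max _ _.
have -> : 4 `^ (p / 2) * (C * Q `^ (p * k)) * (2 * 2 `^ p) =
   4 `^ (p / 2) * C * (2 * 2 `^ p) * Q `^ (p * k) by ring.
rewrite powRM ?powR_ge0//; last by rewrite !mulr_ge0 ?powR_ge0.
by rewrite -(powRrM Q) (_ : p * k / p = k)// mulrAC divff ?mul1r// gt_eqF.
Qed.

Lemma pmuleI (R : realType) (r : R) (x y : \bar R) : 0 < r ->
  (r%:E * x = r%:E * y)%E -> x = y.
Proof.
move=> r0 /(congr1 (fun z => (r^-1)%:E * z)%E).
by rewrite !muleA -EFinM mulVf ?gt_eqF// !mul1e.
Qed.

(** * The geometric distribution on nat and its tail filtration *)

Section geometric.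
Variable R : realType.

Definition geom_weight (k : nat) : R := 2^-1 ^+ k.+1.

Lemma geom_weight_ge0 k : 0 <= geom_weight k.
Proof. by rewrite exprn_ge0. Qed.

Lemma geom_weight_gt0 k : 0 < geom_weight k.
Proof. by rewrite exprn_gt0. Qed.

Definition geom_term (k : nat) : {measure set nat -> \bar R} :=
  mscale (NngNum (geom_weight_ge0 k)) (dirac k).

Definition geom : set nat -> \bar R := mseries geom_term 0.

HB.instance Definition _ := Measure.on geom.

Lemma integral_geom_series (D : set nat) (f : nat -> \bar R) :
  (forall k, 0 <= f k)%E ->
  (\int[geom]_(x in D) f x = \sum_(0 <= k <oo) (geom_weight k)%:E * (\d_k D * f k))%E.
Proof.
move=> f0; rewrite ge0_integral_measure_series//.
by apply: eq_eseriesr => k _; rewrite ge0_integral_mscale// integral_dirac.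
Qed.

(* Tail sums telescope as soon as the candidate conditional expectation c solves 2 c(n) = h(n) + c(n+1). *)
Lemma integral_geom_tail (h c : nat -> R) n :
  (forall k, 0 <= h k) -> (forall k, 2 * c k = h k + c k.+1) ->
  (fun k => 2^-1 ^+ k * c k) @ \oo --> (0 : R) ->
  (\int[geom]_(x in [set k | (n <= k)%N]) (h x)%:E = (2^-1 ^+ n * c n)%:E)%E.
Proof.
move=> h0 hc cv; rewrite integral_geom_series; last by move=> k; rewrite lee_fin.
apply/cvg_lim => //.
have e m : (n <= m)%N -> (\sum_(0 <= k < m) (geom_weight k)%:E * (\d_k [set k | (n <= k)%N] * (h k)%:E) =
    (2^-1 ^+ n * c n - 2^-1 ^+ m * c m)%:E)%E.
  move=> nm; rewrite (big_cat_nat (n := n))//= big_nat_cond big1 ?add0e; last first.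
    move=> k; rewrite andbT => /andP[_ kn]; rewrite diracE memNset ?mul0e ?mule0//=.
    by apply/negP; rewrite -ltnNge.
  have -> : (\sum_(n <= k < m) (geom_weight k)%:E * (\d_k [set k | (n <= k)%N] * (h k)%:E))%E =
     (\sum_(n <= k < m) (2^-1 ^+ k * c k - 2^-1 ^+ k.+1 * c k.+1))%:E.
    rewrite -sumEFin big_nat_cond [RHS]big_nat_cond; apply: eq_bigr => k; rewrite andbT => /andP[nk _].
    rewrite diracE mem_set//= mul1e -EFinM; congr (_%:E).
    have -> : h k = 2 * c k - c k.+1 by rewrite hc addrK.
    by rewrite /geom_weight exprS; field.
  congr (_%:E); rewrite (@telescope_sumr_eq _ n m (fun k => - (2^-1 ^+ k * c k)))//.
    by rewrite opprK addrC.
  by move=> k _; rewrite opprK addrC.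
have lim1 : (2^-1 ^+ n * c n - 2^-1 ^+ m * c m) @[m --> \oo] --> 2^-1 ^+ n * c n - 0.
  by apply: cvgB; [exact: cvg_cst|exact: cv].
rewrite subr0 in lim1.
have lim2 : (2^-1 ^+ n * c n - 2^-1 ^+ m * c m)%:E @[m --> \oo] --> (2^-1 ^+ n * c n)%:E.
  by apply: cvg_EFin => //; exact: nearW.
apply: cvg_trans lim2; apply: near_eq_cvg; near=> m; rewrite e//.
by near: m; exists n.
Unshelve. all: by end_near. Qed.

Let cvg_half_pow : (fun k => 2^-1 ^+ k * 1) @ \oo --> (0 : R).
Proof.
under eq_fun do rewrite mulr1.
by apply: cvg_expr; rewrite ger0_norm// invf_lt1// ltr1n.
Qed.

Lemma geom_tail n : geom [set k | (n <= k)%N] = (2^-1 ^+ n)%:E.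
Proof.
rewrite -[LHS]mul1e -(integral_cst geom)//.
have -> : 2^-1 ^+ n = 2^-1 ^+ n * 1 :> R by rewrite mulr1.
rewrite -(@integral_geom_tail (fun=> 1) (fun=> 1) n)// => _.
by rewrite mulr1 -[2]/(1 + 1).
Qed.

Lemma geom_setT : geom setT = 1%E.
Proof. by rewrite -[RHS](geom_tail 0); congr geom; apply/seteqP; split. Qed.

HB.instance Definition _ := Measure_isProbability.Build _ _ _ geom geom_setT.

Definition geomP : probability nat R := geom.

Definition tail_filtration (n : nat) : set (set nat) :=
  [set A | forall i, (n <= i)%N -> (A i <-> A n)].

Lemma tail_is_filtration : is_filtration tail_filtration.
Proof.
split => // [n|m n mn A Am i ni].
  split => [i _ //|A An i ni|A An i ni].
  - by split => -[_ Ai]; split => // /(An i ni).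
  - by split=> -[k _ Aki]; exists k => //; apply/(An k i ni).
by rewrite (Am i (leq_trans mn ni)) (Am n mn).
Qed.

Lemma tail_filtration_generates : @measurable _ nat = <<s \bigcup_n tail_filtration n >>.
Proof.
apply/seteqP; split => [A _|A _ //].
have -> : A = \bigcup_k (if k \in A then [set k] else set0).
  apply/seteqP; split => [k Ak|k [i _]]; first by exists k; rewrite ?mem_set.
  by case: ifPn => // /set_mem Ai /= ->.
apply: sigma_algebra_bigcup => k; case: ifPn => _; last exact: sigma_algebra0.
(* The singleton of k is constant on [k + 1, oo) but not on [k, oo). *)
apply: sub_sigma_algebra; exists k.+1 => // i ki /=; split => [ik|/eqP].
  by move: ki; rewrite ik ltnn.
by rewrite gtn_eqF.
Qed.

Section cexp.
Variables (h c : nat -> R).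
Hypotheses (h0 : forall k, 0 <= h k) (hc : forall k, 2 * c k = h k + c k.+1)
  (cv : (fun k => 2^-1 ^+ k * c k) @ \oo --> (0 : R)).

Let mh : measurable_fun setT h. Proof. by []. Qed.
Let Eh n := cexp_ge0 geomP (tail_filtration n) (EFin \o h).

Lemma integral_geom_point (f : nat -> \bar R) k : (forall k, 0 <= f k)%E ->
  (\int[geomP]_(x in [set k]) f x = (geom_weight k)%:E * f k)%E.
Proof.
move=> f0; rewrite integral_geom_series//.
rewrite (nneseriesD1 (n := k))//; last first.
  by move=> n _; rewrite mule_ge0 ?lee_fin ?geom_weight_ge0// mule_ge0.
rewrite diracE mem_set//= mul1e eseries0 ?adde0// => i _ ik.
by rewrite diracE memNset ?mul0e ?mule0//= => /eqP; rewrite (negbTE ik).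
Qed.

(** F_n has the atoms {k} for k < n and [n, oo), all of positive mass, so the chosen version is
    determined at every point. *)
Lemma cexp_geom n k : Eh n k = (if (k < n)%N then h k else c n)%:E.
Proof.
have FF := tail_is_filtration.
have [mE E0 hE] := filtration_cexp geomP FF n mh h0.
have w0 := geom_weight_gt0.
have h0' x : (0 <= (EFin \o h) x)%E by rewrite lee_fin.
case: ifPn => [kn|]; last rewrite -leqNgt => nk.
  have Fk : tail_filtration n [set k].
    move=> i ni /=; split => e; first by move: ni; rewrite e leqNgt kn.
    by move: kn; rewrite -e ltnn.
  have := hE _ Fk; rewrite !integral_geom_point//.
  exact: pmuleI.
have const i : (n <= i)%N -> Eh n i = Eh n n.
  move=> ni; have : tail_filtration n (Eh n @^-1` [set Eh n n]).
    by apply/sub_measurableG; [case: FF|have := mE measurableT [set Eh n n] (emeasurable_set1 _); rewrite setTI].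
  by move=> /(_ i ni) /= -> .
have FT : tail_filtration n [set k | (n <= k)%N] by move=> i ni /=; rewrite ni leqnn.
have := hE _ FT; rewrite (integral_geom_tail _ h0 hc cv).
have -> : (\int[geomP]_(x in [set k | (n <= k)%N]) Eh n x)%E = (Eh n n * (2^-1 ^+ n)%:E)%E.
  rewrite -geom_tail -(integral_cst geom)//; apply: eq_integral => x /set_mem /= nx.
  exact: const.
move=> e; rewrite const//.
have n0 : 0 < 2^-1 ^+ n :> R by rewrite exprn_gt0.
by apply: (pmuleI n0); rewrite muleC.
Qed.

End cexp.

Lemma cexp_geom_ge0 (h c : nat -> R) : (forall k, 0 <= h k) ->
  (forall k, 2 * c k = h k + c k.+1) ->
  (fun k => 2^-1 ^+ k * c k) @ \oo --> (0 : R) ->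
  forall n k, cexp geomP (tail_filtration n) (EFin \o h) k = (if (k < n)%N then h k else c n)%:E.
Proof.
move=> h0 hc cv n k; rewrite /cexp.
have -> : ((EFin \o h)^\+)%E = EFin \o h.
  by apply/funext => x; rewrite funeposE /= max_l// lee_fin.
have -> : ((EFin \o h)^\-)%E = EFin \o (fun=> 0).
  by apply/funext => x; rewrite funenegE /= max_r// lee_fin oppr_le0.
rewrite (cexp_geom h0 hc cv) (@cexp_geom (fun=> 0) (fun=> 0))//.
- by case: ifP => _; rewrite sube0.
- by move=> _; rewrite mulr0 addr0.
- by under eq_fun do rewrite mulr0; exact: cvg_cst.
Qed.

End geometric.

(** * Exponential weights and the reduction to real inequalities *)

Section geometric_examples.
Variables (R : realType) (p : R).
Hypothesis p1 : 1 < p.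
Let p0 : 0 < p. Proof. exact: lt_trans ltr01 p1. Qed.
Let p10 : 0 < p - 1. Proof. by rewrite subr_gt0. Qed.
Notation P := (@geomP R).
Notation F := tail_filtration.

Lemma ae_geom (Q : nat -> Prop) : {ae P, forall k, Q k} -> forall k, Q k.
Proof.
move=> [N [mN N0 sN]] k; apply: contrapT => nQ.
have : (P [set k] <= P N)%E.
  by apply: le_measure; rewrite ?inE// => j ->; exact: sN.
rewrite N0 -[P [set k]]mul1e -(integral_cst P)// integral_geom_point// mule1.
by rewrite lee_fin leNgt geom_weight_gt0.
Qed.

(** So the mean of a^k over the tail [n, oo) is a^n / (2 - a); its blow-up as a tends to 2 drives
    both counterexamples. *)
Lemma pow_rec (a : R) : a < 2 -> forall k, 2 * (a ^+ k / (2 - a)) = a ^+ k + a ^+ k.+1 / (2 - a).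
Proof. by move=> a2 k; rewrite exprS; field; rewrite gt_eqF// subr_gt0. Qed.

Lemma pow_cvg (a : R) : 0 < a -> a < 2 ->
  (fun k => 2^-1 ^+ k * (a ^+ k / (2 - a))) @ \oo --> (0 : R).
Proof.
move=> a0 a2.
have -> : (fun k => 2^-1 ^+ k * (a ^+ k / (2 - a))) = (fun k => (2 - a)^-1 * (a / 2) ^+ k).
  by apply/funext => k; rewrite exprMn; ring.
rewrite -[X in _ --> X](mulr0 (2 - a)^-1); apply: cvgMr.
apply: cvg_expr; rewrite ger0_norm ?divr_ge0 ?(ltW a0)//.
by rewrite ltr_pdivrMr// mul1r.
Qed.

Lemma integral_pow (a : R) : 0 < a -> a < 2 ->
  (\int[P]_x (a ^+ x)%:E = ((2 - a)^-1)%:E)%E.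
Proof.
move=> a0 a2.
have -> : [set: nat] = [set k | (0 <= k)%N] by apply/seteqP; split.
rewrite (integral_geom_tail 0 _ (pow_rec a2) (pow_cvg a0 a2)); last by move=> k; rewrite exprn_ge0// ltW.
by rewrite !expr0 !mul1r.
Qed.

Lemma cexp_pow (a : R) : 0 < a -> a < 2 -> forall n k,
  cexp P (F n) (fun x => (a ^+ x)%:E) k = (if (k < n)%N then a ^+ k else a ^+ n / (2 - a))%:E.
Proof.
move=> a0 a2 n k.
by rewrite (cexp_geom_ge0 _ (pow_rec a2) (pow_cvg a0 a2))// => j; rewrite exprn_ge0// ltW.
Qed.

Section weight.
Variables (a b : R).
Hypotheses (a0 : 0 < a) (a2 : a < 2) (b2 : b < 2) (bE : b = a `^ (1 - p)^-1).
Let w (k : nat) := a ^+ k.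
Let q := ((2 - a) * (2 - b) `^ (p - 1))^-1.

Let b0 : 0 < b. Proof. by rewrite bE powR_gt0. Qed.

Let ab1 : a * b `^ (p - 1) = 1.
Proof.
rewrite bE -powRrM (_ : (1 - p)^-1 * (p - 1) = -1); last first.
  by field; rewrite lt_eqF// subr_lt0.
by rewrite powR_inv1 ?(ltW a0)// divff// gt_eqF.
Qed.

Let powXn (x : R) r k : 0 <= x -> (x ^+ k) `^ r = (x `^ r) ^+ k.
Proof. by move=> x0; rewrite -(powR_mulrn _ x0) -(powR_mulrn _ (powR_ge0 x r)) powRAC. Qed.

Let sigmaE k : w k `^ (1 - p)^-1 = b ^+ k.
Proof. by rewrite powXn ?(ltW a0)// -bE. Qed.

Let g n k := (cexp P (F n) (EFin \o w) k *
      (cexp P (F n) (fun y => (w y `^ (1 - p)^-1)%:E) k) `^ (p - 1))%E.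

Let gE n k : g n k = (if (k < n)%N then 1 else q)%:E.
Proof.
rewrite /g; have -> : (fun y => (w y `^ (1 - p)^-1)%:E) = (fun y => (b ^+ y)%:E).
  by apply/funext => y; rewrite sigmaE.
rewrite (cexp_pow a0 a2) (cexp_pow b0 b2) poweR_EFin -EFinM; congr (_%:E).
have ak m : a ^+ m * (b ^+ m) `^ (p - 1) = 1.
  by rewrite powXn ?(ltW b0)// -exprMn ab1 expr1n.
case: ifPn => // _.
have b20 : 0 < 2 - b by rewrite subr_gt0.
rewrite powRM ?invr_ge0 ?exprn_ge0 ?(ltW b0) ?(ltW b20)//.
rewrite (_ : a ^+ n / (2 - a) * _ = a ^+ n * (b ^+ n) `^ (p - 1) * ((2 - a)^-1 * (2 - b)^-1 `^ (p - 1))); last by ring.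
by rewrite ak mul1r /q invfM -(powR_inv1 (ltW b20)) -powRrM mulN1r powRN.
Qed.

Variable M : R.
Hypotheses (M1 : 1 <= M) (qM : q <= M).

(** Since a b^(p-1) = 1, the A_p product at time n is 1 at the points below n and the constant [q]
    on [n, oo). *)
Lemma Ap_char_pow : exists A : R, [/\ Ap_char P F p w = A%:E, 1 <= A & A <= M].
Proof.
have PT : (0 < P setT)%E by rewrite (_ : P setT = 1%E)//; exact: probability_setT.
have q0 : 0 <= q by rewrite invr_ge0 mulr_ge0 ?powR_ge0// subr_ge0 ltW.
have Le : (Ap_char P F p w <= M%:E)%E.
  apply: ge_ereal_sup => _ [n _ <-]; rewrite -[X in Lnorm _ _ X]/(g n) unlock /Lnorm PT.
  apply/ess_supP; apply: aeW => k; rewrite /= gE abse_EFin lee_fin.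
  by case: ifP => _; rewrite ger0_norm.
have Ge : (1%:E <= Ap_char P F p w)%E.
  (* In [F 1] the point 0 is an atom by itself, where the product equals 1. *)
  apply: (@le_trans _ _ (Lnorm P +oo (g 1%N))); last by apply: ereal_sup_ubound; exists 1%N.
  rewrite unlock /Lnorm PT.
  have := ess_sup_ge P (abse \o g 1%N) => /ae_geom /(_ 0%N).
  by rewrite /= gE /= normr1.
have Af : Ap_char P F p w \is a fin_num.
  by rewrite ge0_fin_numE ?(le_lt_trans Le) ?ltry// (le_trans _ Ge).
by exists (fine (Ap_char P F p w)); rewrite -2!lee_fin fineK.
Qed.

Lemma in_Ap_pow : in_Ap P F p w.
Proof.
have [A [AE _ _]] := Ap_char_pow.
split; last by rewrite AE ltry.
split; last by apply: aeW => k; rewrite exprn_gt0.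
apply/integrableP; split => //.
rewrite (eq_integral (fun k => (a ^+ k)%:E)) ?integral_pow ?ltry// => k _.
by rewrite abse_EFin ger0_norm// exprn_ge0// ltW.
Qed.

End weight.

Lemma wnorm_square_fun_ge (w f G : nat -> R) : (forall k, 0 <= w k) -> (forall k, 0 <= G k) ->
  (forall k, ((G k)%:E <= square_fun P F f k)%E) ->
  ((\int[P]_k (G k `^ p * w k)%:E) `^ p^-1 <= wnorm P p w (square_fun P F f))%E.
Proof.
move=> w0 G0 GS.
have int0 h : (forall k, 0 <= h k)%E -> (0 <= \int[P]_k h k)%E.
  by move=> h0; apply: integral_ge0.
have l0 k : (0 <= (G k `^ p * w k)%:E)%E by rewrite lee_fin mulr_ge0 ?powR_ge0.
have r0 k : (0 <= `|square_fun P F f k| `^ p * (w k)%:E)%E.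
  by rewrite mule_ge0 ?poweR_ge0 ?lee_fin.
apply: gt0_ler_poweR; rewrite ?invr_ge0 ?(ltW p0) ?in_itv/= ?leey ?andbT ?int0//.
apply: ge0_le_integral => // k _; rewrite EFinM -poweR_EFin.
apply: lee_wpmul2r; first by rewrite lee_fin.
apply: gt0_ler_poweR; rewrite ?(ltW p0) ?in_itv/= ?leey ?andbT ?abse_ge0 ?lee_fin//.
by rewrite (le_trans (GS k))// lee_abs.
Qed.

Lemma square_fun_ge (f : nat -> R) (r : R) m k : 0 <= r ->
  (r%:E <= \sum_(0 <= j < m) `|mart_diff P F f j k| ^+ 2)%E ->
  ((r `^ 2^-1)%:E <= square_fun P F f k)%E.
Proof.
move=> r0 h; rewrite -poweR_EFin /square_fun.
have s0 : (0 <= \sum_(0 <= j <oo) `|mart_diff P F f j k| ^+ 2)%E.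
  by apply: nneseries_ge0 => n _ _; exact: sqre_ge0.
apply: gt0_ler_poweR; rewrite ?invr_ge0 ?in_itv/= ?leey ?andbT ?lee_fin//.
by apply: (le_trans h); apply: nneseries_lim_ge => n _ _; exact: sqre_ge0.
Qed.

Lemma estimate_max0 kappa C : square_fun_estimate p kappa C ->
  square_fun_estimate p kappa (Num.max C 0).
Proof.
move=> h d T Q G FG gen w Aw f Lf; apply: (le_trans (h d T Q G FG gen w Aw f Lf)).
rewrite -!muleA; apply: lee_wpmul2r; first by rewrite mule_ge0 ?poweR_ge0.
by rewrite lee_fin le_max lexx.
Qed.

(** For negative kappa an upper bound on the characteristic says nothing about its power; A >= 1
    allows kappa to be replaced by its positive part. *)
Lemma poweR_le_max0 (A q kappa : R) : 1 <= A -> A <= q -> A `^ kappa <= q `^ (Num.max kappa 0).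
Proof.
move=> A1 Aq; apply: (@le_trans _ _ (A `^ Num.max kappa 0)).
  by apply: ler_powR => //; rewrite le_max lexx.
by rewrite ge0_ler_powR ?nnegrE ?le_max ?lexx ?orbT// (le_trans ler01)// (le_trans A1).
Qed.

Lemma power_unbounded (alpha beta c C : R) : alpha < beta -> 0 < c ->
  ~ (forall N : nat, (2 <= N)%N -> c * N%:R `^ beta <= C * N%:R `^ alpha).
Proof.
move=> ab c0 h.
have d0 : 0 < beta - alpha by rewrite subr_gt0.
pose y := (`|C / c| + 1) `^ (beta - alpha)^-1.
pose N := (Num.truncn y).+2.
have yN : y <= N%:R by rewrite (le_trans (ltW (truncnS_gt _)))// ler_nat.
have N0 : 0 < N%:R :> R by rewrite ltr0n.
have := h N isT.
rewrite -[beta](subrK alpha) powRD; last by rewrite (gt_eqF N0) implybT.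
rewrite mulrA ler_pM2r ?powR_gt0// mulrC -ler_pdivlMr// => h2.
have : `|C / c| + 1 <= N%:R `^ (beta - alpha).
  have -> : `|C / c| + 1 = y `^ (beta - alpha).
    by rewrite /y -powRrM mulVf ?gt_eqF// powRr1// addr_ge0.
  by rewrite ge0_ler_powR ?(ltW d0) ?nnegrE ?powR_ge0// ltW.
have := ler_norm (C / c); lra.
Qed.

End geometric_examples.

(** * Lower bounds for the exponent *)

Section geometric_sharpness.
Variables (R : realType) (p : R).
Hypothesis p1 : 1 < p.
Let p0 : 0 < p. Proof. exact: lt_trans ltr01 p1. Qed.
Let p10 : 0 < p - 1. Proof. by rewrite subr_gt0. Qed.
Notation P := (@geomP R).
Notation F := tail_filtration.

(** Reduces an example to numbers: [M] bounds the characteristic, [I] the p-th power of the norm of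
    [f], and [J] bounds that of the square function from below through a minorant [G]. *)
Lemma geometric_estimate (kappa C a b M I J : R) (f G : nat -> R) :
  square_fun_estimate p kappa C ->
  0 < a -> a < 2 -> b < 2 -> b = a `^ (1 - p)^-1 ->
  1 <= M -> ((2 - a) * (2 - b) `^ (p - 1))^-1 <= M ->
  (forall k, 0 <= f k) -> (forall k, 0 <= G k) -> 0 <= I -> 0 <= J ->
  (forall k, ((G k)%:E <= square_fun P F f k)%E) ->
  (\int[P]_k (f k `^ p * a ^+ k)%:E <= I%:E)%E ->
  (J%:E <= \int[P]_k (G k `^ p * a ^+ k)%:E)%E ->
  J `^ p^-1 <= Num.max C 0 * M `^ Num.max kappa 0 * I `^ p^-1.
Proof.
move=> hC a0 a2 b2 bE M1 qM f0 G0 I0 J0 GS fI JG.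
have w0 k : 0 <= a ^+ k by rewrite exprn_ge0// ltW.
have [A [AE A1 AM]] := Ap_char_pow p1 a0 a2 b2 bE M1 qM.
have pV0 : 0 <= p^-1 by rewrite invr_ge0 ltW.
have intf0 h : (0 <= \int[P]_k (h k `^ p * a ^+ k)%:E)%E.
  by apply: integral_ge0 => k _; rewrite lee_fin mulr_ge0 ?powR_ge0.
have nf : (wnorm P p (fun k => a ^+ k)%R (EFin \o f) <= (I `^ p^-1)%:E)%E.
  rewrite /wnorm (eq_integral (fun k => (f k `^ p * a ^+ k)%R%:E)); last first.
    by move=> k _; rewrite /= ger0_norm.
  by rewrite -poweR_EFin; apply: gt0_ler_poweR; rewrite ?in_itv/= ?leey ?andbT ?lee_fin.
have Lf : in_Lpw P p (fun k => a ^+ k)%R f by split => //; exact: (le_lt_trans nf (ltry _)).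
have h := estimate_max0 hC tail_is_filtration tail_filtration_generates
   (in_Ap_pow p1 a0 a2 b2 bE M1 qM) Lf.
have h1 : ((J `^ p^-1)%:E <= wnorm P p (fun k => a ^+ k)%R (square_fun P F f))%E.
  apply: le_trans (wnorm_square_fun_ge p1 w0 G0 GS).
  by rewrite -poweR_EFin; apply: gt0_ler_poweR; rewrite ?in_itv/= ?leey ?andbT ?lee_fin.
have C0 : 0 <= Num.max C 0 by rewrite le_max lexx orbT.
rewrite -lee_fin EFinM; apply: (le_trans h1); apply: (le_trans h).
rewrite AE poweR_EFin -[X in (X * _ <= _)%E]EFinM; apply: lee_pmul => //.
- by rewrite lee_fin mulr_ge0 ?powR_ge0.
- exact: poweR_ge0.
- by rewrite lee_fin ler_wpM2l//; exact: poweR_le_max0.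
Qed.

Lemma mart_diff_geom (h c : nat -> R) j k : (forall k, 0 <= h k) ->
  (forall k, 2 * c k = h k + c k.+1) ->
  (fun k => 2^-1 ^+ k * c k) @ \oo --> (0 : R) ->
  mart_diff P F h j.+1 k = ((if (k < j.+1)%N then h k else c j.+1) - (if (k < j)%N then h k else c j))%:E.
Proof. by move=> h0 hc cv; rewrite /mart_diff /mart !(cexp_geom_ge0 h0 hc cv). Qed.

(** One jump suffices: when k is separated from its tail, the martingale at k drops from N b^k to
    b^k. As f^p w = b^k, the estimate becomes (N/2) N^(1/p) <= C N^((p-1) kappa) N^(1/p), with C and
    kappa replaced by their positive parts. *)
Lemma sharp_jump (kappa C : R) : square_fun_estimate p kappa C -> 1 <= (p - 1) * Num.max kappa 0.
Proof.
move=> hC; rewrite leNgt; apply/negP => k1.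
apply: (@power_unbounded _ _ _ 2^-1 (Num.max C 0) k1) => // N N2.
have N0 : 0 < N%:R :> R by rewrite ltr0n (leq_trans _ N2).
have N2' : 2 <= N%:R :> R by rewrite (ler_nat _ 2).
have NV : N%:R^-1 <= 2^-1 :> R by rewrite lef_pV2 ?posrE.
have NV0 : 0 < N%:R^-1 :> R by rewrite invr_gt0.
(* Here 1/(2 - b) = N is the tail factor of the dual weight b^k, and a <= 1 keeps the factor 1/(2 -
   a) of the weight at most 1. *)
pose b : R := 2 - N%:R^-1; pose a := b `^ (1 - p).
have b1 : 1 <= b by rewrite /b; lra.
have b0 : 0 < b by lra.
have b2 : b < 2 by rewrite /b; lra.
have bN : 2 - b = N%:R^-1 by rewrite /b; lra.
have a0 : 0 < a by rewrite powR_gt0.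
have a1 : a <= 1.
  rewrite /a -[leRHS](powRr0 b); apply: ler_powR => //; by rewrite subr_le0 ltW.
have bE : b = a `^ (1 - p)^-1.
  by rewrite /a -powRrM divff ?powRr1 ?(ltW b0)// lt_eqF// subr_lt0.
have a2 : a < 2 by lra.
have fw k : (b ^+ k) `^ p * a ^+ k = b ^+ k.
  rewrite -powR_mulrn ?(ltW b0)// powRAC -!powR_mulrn ?powR_ge0 ?(ltW a0)// -powRM ?powR_ge0 ?(ltW a0)//.
  rewrite /a -powRD; last by rewrite (gt_eqF b0) implybT.
  by rewrite addrC subrK powRr1// ltW.
have pw k : 0 <= b ^+ k by rewrite exprn_ge0// ltW.
have N1N : N%:R / 2 <= N%:R - 1 :> R by lra.
have est : (N%:R / 2) `^ p * N%:R `^ 1 = (N%:R / 2) `^ p * N%:R by rewrite powRr1// ltW.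
have := @geometric_estimate kappa C a b (N%:R `^ (p - 1)) N%:R ((N%:R / 2) `^ p * N%:R) (fun k => b ^+ k) (fun k => N%:R / 2 * b ^+ k) hC a0 a2 b2 bE.
have -> : ((N%:R / 2) `^ p * N%:R) `^ p^-1 = N%:R / 2 * N%:R `^ p^-1.
  by rewrite powRM ?powR_ge0 ?(ltW N0)// -powRrM divff ?gt_eqF// powRr1// divr_ge0// ltW.
rewrite -powRrM => H; rewrite powRr1 ?(ltW N0)// mulrC.
rewrite -(ler_pM2r (powR_gt0 p^-1 N0)); apply: H => //.
- by rewrite -[leLHS](powRr0 N%:R) ler_powR ?(ltW p10)//; lra.
- have -> : (2 - b) `^ (p - 1) = (N%:R `^ (p - 1))^-1.
    by rewrite bN -(powR_inv1 (ltW N0)) -powRrM mulN1r powRN.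
  by rewrite invfM invrK ler_piMl ?powR_ge0// invf_le1; lra.
- by move=> k; rewrite mulr_ge0// divr_ge0// ltW.
- move=> k; pose r := ((N%:R - 1) * b ^+ k) ^+ 2.
  have N10 : 0 <= (N%:R - 1) * b ^+ k by rewrite mulr_ge0//; lra.
  apply: (@le_trans _ _ (r `^ 2^-1)%:E).
    by rewrite lee_fin /r powR12_sqrt ?sqr_ge0// sqrtr_sqr ger0_norm// ler_wpM2r.
  apply: (@square_fun_ge _ _ _ k.+2); first exact: sqr_ge0.
  rewrite big_nat_recr//= -[leLHS]add0e; apply: leeD; first by apply: sume_ge0 => j _; exact: sqre_ge0.
  have md := @mart_diff_geom (fun k => b ^+ k) _ k k pw (pow_rec b2) (pow_cvg b0 b2).
  rewrite /= in md; rewrite md ltnSn ltnn bN invrK abse_EFin -EFinM -expr2 lee_fin.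
  by rewrite real_normK ?num_real// le_eqVlt; apply/orP; left; apply/eqP; rewrite /r; ring.
- under eq_integral do rewrite fw.
  by rewrite integral_pow// bN invrK.
- rewrite (eq_integral (fun k => ((N%:R / 2) `^ p)%:E * (b ^+ k)%:E)%E); last first.
    move=> k _; rewrite -EFinM; congr (_%:E).
    by rewrite powRM ?divr_ge0 ?(ltW N0)// -mulrA fw.
  rewrite ge0_integralZl_EFin ?powR_ge0//; last by move=> k _; rewrite lee_fin.
  by rewrite integral_pow// bN invrK.
Qed.

(** The mean over [k, oo) of the indicator of the even integers is 2/3 for even k and 1/3 for odd k,
    so consecutive means differ by 1/3. *)
Let osc_rec (k : nat) :
  2 * (2^-1 + (-1) ^+ k / 6) = (1 + (-1) ^+ k) / 2 + (2^-1 + (-1) ^+ k.+1 / 6) :> R.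
Proof. by rewrite exprS; field. Qed.

Let osc_cvg : (fun k => 2^-1 ^+ k * (2^-1 + (-1) ^+ k / 6)) @ \oo --> (0 : R).
Proof.
have c1 : (2^-1 ^+ k * (2^-1 : R)) @[k --> \oo] --> (0 : R).
  rewrite -[X in _ --> X](mul0r 2^-1); apply: cvgMl; apply: cvg_expr.
  by rewrite ger0_norm// invf_lt1// ltr1n.
have c2 : ((2^-1 * -1) ^+ k * (6^-1 : R)) @[k --> \oo] --> (0 : R).
  rewrite -[X in _ --> X](mul0r 6^-1); apply: cvgMl; apply: cvg_expr.
  by rewrite normrM normrN1 mulr1 ger0_norm// invf_lt1// ltr1n.
rewrite -[X in _ --> X](addr0 0); under eq_fun do rewrite mulrDr mulrA -exprMn.
exact: cvgD.
Qed.

(** With a = 2 - 1/N, the number (a/2)^N is the share of the mass of the weight a^k carried by [N,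
    oo); Bernoulli's inequality gives 1 - N/(2N) = 1/2. *)
Lemma bernoulli_half (N : nat) : (0 < N)%N -> 2^-1 <= (2^-1 * (2 - N%:R^-1)) ^+ N :> R.
Proof.
move=> N0; have N0' : 0 < N%:R :> R by rewrite ltr0n.
have B : forall (x : R) n, 0 <= x -> x <= 1 -> 1 - n%:R * x <= (1 - x) ^+ n.
  move=> x n x0 x1; elim: n => [|n IH]; first by rewrite mul0r subr0.
  rewrite exprS; have : (1 - x) * (1 - n%:R * x) <= (1 - x) * (1 - x) ^+ n.
    by rewrite ler_wpM2l// subr_ge0.
  apply: le_trans; rewrite -natr1.
  have : 0 <= n%:R * (x * x) by rewrite !mulr_ge0.
  lra.
have NV1 : N%:R^-1 <= 1 :> R by rewrite invf_le1// ler1n.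
have NV0 : 0 < N%:R^-1 :> R by rewrite invr_gt0.
have -> : 2^-1 * (2 - N%:R^-1) = 1 - N%:R^-1 / 2 :> R by field; rewrite gt_eqF.
apply: le_trans (B _ _ _ _); [|lra|lra].
by rewrite mulrA divff ?gt_eqF//; lra.
Qed.

(** At least half of the total mass N of the weight lies on [N, oo), and the norm of [f] is at most
    N^(1/p). The estimate becomes (N/9)^(1/2) (N/2)^(1/p) <= C N^kappa N^(1/p), again with positive
    parts. *)
Lemma sharp_oscillation (kappa C : R) : square_fun_estimate p kappa C -> 2^-1 <= Num.max kappa 0.
Proof.
move=> hC; rewrite leNgt; apply/negP => k1.
have cst0 : 0 < 9 `^ (- 2^-1) * 2 `^ (- p^-1) :> R by rewrite mulr_gt0 ?powR_gt0.
apply: (@power_unbounded _ _ _ _ (Num.max C 0) k1 cst0) => // N N2.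
have N0 : 0 < N%:R :> R by rewrite ltr0n (leq_trans _ N2).
have N2' : 2 <= N%:R :> R by rewrite (ler_nat _ 2).
have NV : N%:R^-1 <= 2^-1 :> R by rewrite lef_pV2 ?posrE.
have NV0 : 0 < N%:R^-1 :> R by rewrite invr_gt0.
(* The roles are exchanged: now the weight has the large tail factor N, and b <= 1 keeps that of the
   dual weight at most 1. *)
pose a : R := 2 - N%:R^-1; pose b := a `^ (1 - p)^-1.
have a1 : 1 <= a by rewrite /a; lra.
have a0 : 0 < a by lra.
have a2 : a < 2 by rewrite /a; lra.
have aN : 2 - a = N%:R^-1 by rewrite /a; lra.
have b0 : 0 < b by rewrite powR_gt0.
have b1 : b <= 1.
  by rewrite /b -[leRHS](powRr0 a) ler_powR// invr_le0 subr_le0 ltW.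
have b2 : b < 2 by lra.
pose f (k : nat) : R := (1 + (-1) ^+ k) / 2.
have f01 k : 0 <= f k <= 1 by rewrite /f -signr_odd; case: odd; rewrite ?expr1 ?expr0; lra.
have f0 k : 0 <= f k by case/andP: (f01 k).
have aw k : 0 <= a ^+ k by rewrite exprn_ge0// ltW.
pose G k := if (N <= k)%N then (N%:R / 9) `^ 2^-1 else 0 : R.
have G0 k : 0 <= G k by rewrite /G; case: ifP => // _; exact: powR_ge0.
pose K : R := (N%:R / 9) `^ 2^-1 `^ p.
have := @geometric_estimate kappa C a b N%:R N%:R (K * (N%:R / 2)) f G hC a0 a2 b2 erefl.
have -> : (K * (N%:R / 2)) `^ p^-1 = 9 `^ (- 2^-1) * 2 `^ (- p^-1) * N%:R `^ 2^-1 * N%:R `^ p^-1.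
  rewrite powRM ?powR_ge0 ?divr_ge0 ?(ltW N0)// /K -!powRrM divff ?gt_eqF// mulr1.
  rewrite !powRM ?invr_ge0 ?(ltW N0)// -(powR_inv1 (ler0n R 9)) -(powR_inv1 (ler0n R 2)) -!powRrM !mulN1r.
  by ring.
move=> H; rewrite -(ler_pM2r (powR_gt0 p^-1 N0)); apply: H => //.
- by lra.
- rewrite aN invfM invrK ler_piMr ?(ltW N0)// invf_le1 ?powR_gt0 ?subr_gt0//.
  by rewrite -[leLHS](powRr0 (2 - b)) ler_powR ?(ltW p10)//; lra.
- by rewrite mulr_ge0 ?powR_ge0// divr_ge0// ltW.
- move=> k; rewrite /G; case: ifPn => [Nk|_]; last first.
    by rewrite poweR_ge0.
  apply: (@square_fun_ge _ _ _ k.+1); first by rewrite divr_ge0// ltW.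
  rewrite big_nat_recl// -[leLHS]add0e; apply: leeD; first exact: sqre_ge0.
  rewrite (eq_big_nat _ _ (F2 := fun=> (9^-1)%:E)); last first.
    move=> j /andP[_ jk].
    rewrite (mart_diff_geom _ _ f0 osc_rec osc_cvg) (ltnNge k j.+1) (ltnNge k j) jk (ltnW jk) /=.
    rewrite -EFinM -expr2 real_normK ?num_real//; congr (_%:E).
    have s2 : ((-1) ^+ j) ^+ 2 = 1 :> R by rewrite -exprM mulnC exprM sqrrN !expr1n.
    rewrite [in LHS](exprS (-1) j).
    have -> : (2^-1 + -1 * (-1) ^+ j / 6 - (2^-1 + (-1) ^+ j / 6)) ^+ 2 = ((-1) ^+ j) ^+ 2 / 9 :> R by field.
    by rewrite s2 mul1r.
  rewrite sumEFin lee_fin sumr_const_nat subn0 -[leRHS]mulr_natl ler_wpM2r//.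
  by rewrite ler_nat.
- apply: (@le_trans _ _ (\int[P]_k (a ^+ k)%:E)%E); last by rewrite integral_pow// aN invrK.
  apply: ge0_le_integral => //.
  + by move=> k _; rewrite lee_fin mulr_ge0 ?powR_ge0.
  + move=> k _; rewrite lee_fin ler_piMl//.
    have /andP[fk0 fk1] := f01 k.
    rewrite (_ : 1 = 1 `^ p); last by rewrite powR1.
    by rewrite ge0_ler_powR ?nnegrE ?(ltW p0).
- apply: (@le_trans _ _ (\int[P]_(k in [set k | (N <= k)%N]) (K * a ^+ k)%:E)%E); last first.
    rewrite (eq_integral (fun k => (G k `^ p * a ^+ k)%:E)%R); last first.
      by move=> k /set_mem/= Nk; rewrite /G Nk.
    by apply: ge0_subset_integral => // k _; rewrite lee_fin mulr_ge0 ?powR_ge0.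
  rewrite (@integral_geom_tail _ _ (fun k => K * (a ^+ k / (2 - a)))).
  + rewrite lee_fin aN invrK [leRHS]mulrCA ler_wpM2l ?powR_ge0//.
    rewrite mulrA -exprMn [leLHS]mulrC ler_wpM2r ?(ltW N0)//.
    by apply: bernoulli_half; exact: (leq_trans _ N2).
  + by move=> k; rewrite mulr_ge0 ?powR_ge0.
  + by move=> k; rewrite mulrCA pow_rec// mulrDr.
  + rewrite -[X in _ --> X](mulr0 K); under eq_fun do rewrite mulrCA.
    by apply: cvgMr; exact: pow_cvg.
Qed.

End geometric_sharpness.

Theorem theorem1 (R : realType) (p : R) (hp : 1 < p) :
  (exists C : R, square_fun_estimate p (Num.max 2^-1 (p - 1)^-1) C) /\
  (forall kappa : R, kappa < Num.max 2^-1 (p - 1)^-1 ->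
     ~ exists C : R, square_fun_estimate p kappa C).
Proof.
split; first exact: square_fun_upper.
have p10 : 0 < p - 1 by rewrite subr_gt0.
move=> kappa; rewrite lt_max => /orP[k1|k1] [C hC].
- by have := sharp_oscillation hp hC; rewrite leNgt gt_max k1 invr_gt0 ltr0n.
- have k0 : Num.max kappa 0 < (p - 1)^-1 by rewrite gt_max k1 invr_gt0.
  by have := sharp_jump hp hC; rewrite leNgt -ltr_pdivlMl// mulr1 k0.
Qed.
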